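(* Let $k\in\mathbb N$ and $\alpha\in\mathbb R$. Suppose $E$ is a Hermite–Biehler function satisfying: (C1) $E$ has no real zeros; (C2) the function $z\mapsto E(iz)$ is real entire; (C3) $A\notin\mathcal H(E)$; and suppose that $\mathcal X_k\neq\{0\}$. Setting $\lambda_0:=\big((\mathbb{EP})(E,k,\alpha)\big)^{1/2k}$, $\lambda_0$ is the first positive zero of the equation $$A(\alpha+\lambda)A(\alpha-\lambda)\det\mathcal V(\lambda)=0,$$ where $\mathcal V(\lambda)$ is the $k\times k$ matrix with entries $$\big(\mathcal V(\lambda)\big)_{lj}=\sum_{r=0}^{2k-1}\omega^{-r(l+j-1)}\,C(\alpha+\omega^r\lambda)\qquad(1\le l,j\le k),$$ $\omega:=e^{i\pi/k}$ and $C(z):=B(z)/A(z)$.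
   Context: Notation: $f^*(z)=\overline{f(\bar z)}$; an entire function is real entire if $f=f^*$. A function analytic in the upper half-plane $\mathbb C^+$ is of bounded type if it is a quotient of two bounded analytic functions on $\mathbb C^+$; its mean type is $v(f)=\limsup_{y\to+\infty}y^{-1}\log|f(iy)|$. A Hermite–Biehler function is an entire $E$ with $|E^*(z)|<|E(z)|$ for all $z\in\mathbb C^+$. The de Branges space $\mathcal H(E)$ is the Hilbert space of entire $f$ with $\|f\|_{\mathcal H(E)}^2=\int_{\mathbb R}|f(x)/E(x)|^2\,\mathrm dx<\infty$ such that $f/E$ and $f^*/E$ are of bounded type in $\mathbb C^+$ with non-positive mean type, with inner product $\langle f,g\rangle=\int_{\mathbb R}f(x)\overline{g(x)}|E(x)|^{-2}\,\mathrm dx$. $A=\tfrac12(E+E^* )$ and $B=\tfrac i2(E-E^* )$ are the real entire functions with $E=A-iB$. For $k\in\mathbb N$, $\mathcal X_k:=\{f\in\mathcal H(E): z^kf\in\mathcal H(E)\}$, and for $\alpha\in\mathbb R$ $$(\mathbb{EP})(E,k,\alpha):=\inf_{0\ne f\in\mathcal X_k}\frac{\|(z-\alpha)^kf\|_{\mathcal H(E)}^2}{\|f\|_{\mathcal H(E)}^2}.$$ *)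

(* Defs.v *)
From HB Require Import structures.
From mathcomp Require Import all_boot all_order all_algebra.
From mathcomp Require Import all_classical all_reals all_analysis.
From mathcomp Require Import complex.

Set Implicit Arguments.
Unset Strict Implicit.
Unset Printing Implicit Defensive.

Import Order.TTheory GRing.Theory Num.Theory.
Import numFieldNormedType.Exports.

Local Open Scope classical_set_scope.
Local Open Scope ring_scope.
Local Open Scope complex_scope.

Section DeBranges.
Variable R : realType.
Implicit Types (f g h E : R[i] -> R[i]) (z : R[i]) (k : nat) (alpha lam : R).

(* The modulus with values in R; the MathComp norm `|z| lives in R[i]. *)
Local Notation modulus := Normc.normc.

(* Complex differentiability: R[i]^o is R[i] as a normed module over itself,
   so the increments in derivable are complex. *)
Definition cdifferentiable f z : Prop :=
  derivable (f : R[i]^o -> R[i]^o) z 1.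

Definition entire f : Prop := forall z, cdifferentiable f z.

Definition fstar f : R[i] -> R[i] := fun z => conjc (f (conjc z)).

Definition real_entire f : Prop := entire f /\ f = fstar f.

Definition upper_half_plane : set R[i] := [set z | 0 < complex.Im z].

Definition analytic_uhp f : Prop :=
  forall z, upper_half_plane z -> cdifferentiable f z.

Definition bounded_uhp f : Prop :=
  exists M : R, forall z, upper_half_plane z -> modulus (f z) <= M.

(* f = g / h as meromorphic functions: h is not identically zero on the upper
   half-plane, but it may have zeros there (cancelled by those of g). *)
Definition bounded_type f : Prop :=
  analytic_uhp f /\
  exists g h,
    [/\ analytic_uhp g /\ bounded_uhp g,
        analytic_uhp h /\ bounded_uhp h,
        exists2 z, upper_half_plane z & h z != 0 &
        forall z, upper_half_plane z -> f z * h z = g z].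

(* lne 0 = -oo, so the zero function has mean type -oo. *)
Definition mean_type f : \bar R :=
  limf_esup (fun y : R => ((y^-1)%:E * lne (modulus (f (0 +i* y)%C))%:E)%E)
            (pinfty_nbhs R).

Definition bounded_type_nonpos f : Prop :=
  bounded_type f /\ (mean_type f <= 0)%E.

Definition hermite_biehler E : Prop :=
  entire E /\
  forall z, upper_half_plane z -> modulus (fstar E z) < modulus (E z).

Definition dB_sqnorm E f : \bar R :=
  (\int[lebesgue_measure]_x (modulus (f x%:C / E x%:C) ^+ 2)%:E)%E.

Definition dB_space E : set (R[i] -> R[i]) :=
  [set f | [/\ entire f,
               (dB_sqnorm E f < +oo)%E,
               bounded_type_nonpos (fun z => f z / E z) &
               bounded_type_nonpos (fun z => fstar f z / E z)]].

Definition dB_A E : R[i] -> R[i] := fun z => 2^-1 * (E z + fstar E z).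

Definition dB_B E : R[i] -> R[i] :=
  fun z => 'i%C / 2 * (E z - fstar E z).

Definition dB_C E : R[i] -> R[i] := fun z => dB_B E z / dB_A E z.

Definition dB_X E k : set (R[i] -> R[i]) :=
  [set f | dB_space E f /\ dB_space E (fun z => z ^+ k * f z)].

Definition nonzero_fun f : Prop := exists z, f z != 0.

(* For f in X_k both squared norms are finite, so fine loses nothing. *)
Definition EP E k alpha : R :=
  inf [set fine (dB_sqnorm E (fun z => (z - alpha%:C) ^+ k * f z))
             / fine (dB_sqnorm E f)
      | f in [set f | dB_X E k f /\ nonzero_fun f]].

(* exp (i pi / k) *)
Definition omega k : R[i] := cos (pi / k%:R) +i* sin (pi / k%:R).

(* Indices are shifted by one: for l, j counted from 0 the exponent l + j - 1
   of the 1-based convention reads l + j + 1. *)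
Definition dB_V E k alpha lam : 'M[R[i]]_k :=
  \matrix_(l < k, j < k)
    \sum_(r < k.*2) omega k ^- (r * (l + j).+1)
                    * dB_C E (alpha%:C + omega k ^+ r * lam%:C).

Definition eq_lhs E k alpha lam : R[i] :=
  dB_A E (alpha + lam)%:C * dB_A E (alpha - lam)%:C
    * \det (dB_V E k alpha lam).

(* The poles of the entries of dB_V at zeros of A are cancelled in eq_lhs, which
   is meant after removal of these singularities; at a pole the totalized
   division x / 0 = 0 would give eq_lhs the spurious value 0.  Being a zero is
   therefore expressed by the punctured limit, which is the value of the
   continuous extension. *)
Definition zero_of_equation E k alpha lam : Prop :=
  (fun mu : R => eq_lhs E k alpha mu : R[i]^o) @ lam^' --> (0 : R[i]^o).

Definition first_positive_zero (Z : R -> Prop) lam : Prop :=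
  [/\ 0 < lam, Z lam & forall mu, 0 < mu -> mu < lam -> ~ Z mu].

End DeBranges.

(* Main.v *)
(* For s = lambda^(2k) write (z - alpha)^(2k) - s = prod_r (z - zeta_r) with the
   nodes zeta_r = alpha + omega^r lambda, and consider on X_k the form
   b(f, h) = <(z - alpha)^k f, (z - alpha)^k h> - s <f, h>.
   If g and z g belong to H(E), then the integral of g / E over the real line
   vanishes.  On the real line A Q + B P, for polynomials P, Q of degree < k, is
   half of E (Q + iP) + E^* (Q - iP), so it is orthogonal to X_k in
   L^2(|E|^-2 dx).
   If A Q + B P vanishes at all the nodes and (P, Q) <> 0, then the quotient of
   A Q + B P by (z - alpha)^(2k) - s is a nonzero element of X_k that is isotropic
   for b, whence EP <= s.  If there is no such pair, then every f in H(E) can be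
   corrected by some A Q + B P of size O(|f|) to vanish at the nodes, and
   h = (f + A Q + B P) / ((z - alpha)^(2k) - s) satisfies b(h, v) = <f, v> on X_k;
   as h is bounded by f, b >= 0 would imply b >= c <., .> with c > 0, so EP <> s.
   A discrete Fourier transform identifies the determinant of the conditions at
   the nodes with det V, up to the values A(zeta_r).
   Contour integrals are avoided: Goursat's lemma yields primitives, and Rolle's
   theorem applied to a primitive on a circle yields a mean value property that
   replaces Cauchy's integral formula. *)

(* Whether the infimum is attained never matters, because [EP] enters only through two facts: a
   singular node system at mu forces EP <= mu^(2k), and a regular one at lambda forces EP <>
   lambda^(2k). Taking lambda^(2k) = EP, the second fact makes lambda a zero and the first excludes
   every smaller positive one. The analytic obstacle is that membership in H(E) is given by an L^2
   condition on the real line together with bounded type and mean type, none of which is a pointwise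
   bound. Bounded type gives only |f / E| <= A exp (c (1 + |z|^2) / Im z), which blows up at the
   real line. The integral of f / E over [z, z + d] is however bounded on the real line by
   Cauchy-Schwarz, so Phragmen-Lindelof applies to it; with d = Im z this yields |f / E|^2 Im z <=
   25 |f|^2. That one estimate supports the vanishing of the integral of g / E, the bounds O(|f|)
   for the correction at the nodes, and the fact that A Q + B P is not identically zero. Its
   singularity at the real line is absorbed each time by a factor z^2 - r^2 on a circle of radius
   r. *)
From HB Require Import structures.
Require Import Defs.
From mathcomp Require Import all_boot all_order all_algebra.
From mathcomp Require Import all_classical all_reals all_analysis.
From mathcomp Require Import complex measurable_realfun.
From mathcomp Require Import ring lra zify.
Set Implicit Arguments.
Unset Strict Implicit.
Unset Printing Implicit Defensive.
Import Order.TTheory GRing.Theory Num.Theory.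
Import numFieldNormedType.Exports.
Local Open Scope classical_set_scope.
Local Open Scope ring_scope.
Local Open Scope complex_scope.

(** * Moduli and Caratheodory derivatives *)

Section ComplexModulus.
Variable R : realType.
Implicit Types (x y z w : R[i]) (a b r e : R).

Definition mc z : R := Normc.normc z.

Lemma mcE z : mc z = Num.sqrt (complex.Re z ^+ 2 + complex.Im z ^+ 2).
Proof. by case: z. Qed.
Lemma mc_ge0 z : 0 <= mc z. Proof. by rewrite mcE sqrtr_ge0. Qed.
Lemma mcM x y : mc (x * y) = mc x * mc y. Proof. exact: Normc.normcM. Qed.
Lemma mcD x y : mc (x + y) <= mc x + mc y. Proof. exact: le_normcD. Qed.
Lemma mcN x : mc (- x) = mc x. Proof. exact: normcN. Qed.
Lemma mcV x : mc x^-1 = (mc x)^-1. Proof. exact: Normc.normcV. Qed.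
Lemma mc_div x y : mc (x / y) = mc x / mc y. Proof. by rewrite mcM mcV. Qed.
Lemma mc0 : mc 0 = 0. Proof. exact: Normc.normc0. Qed.
Lemma mc1 : mc 1 = 1. Proof. exact: Normc.normc1. Qed.
Lemma mcB x y : mc (x - y) <= mc x + mc y.
Proof. by rewrite -(mcN y) mcD. Qed.
Lemma mc_distC x y : mc (x - y) = mc (y - x).
Proof. by rewrite -mcN opprB. Qed.
Lemma mc_dist x y : mc x - mc y <= mc (x - y).
Proof. by rewrite lerBlDr -{1}(subrK y x) mcD. Qed.
Lemma mc_tri x y z : mc (x - z) <= mc (x - y) + mc (y - z).
Proof. by rewrite -{1}(subrK y x) -addrA mcD. Qed.
Lemma mcX x n : mc (x ^+ n) = mc x ^+ n.
Proof. by elim: n => [|n IH]; rewrite ?expr0 ?mc1 // !exprS mcM IH. Qed.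
Lemma mc_eq0 z : (mc z == 0) = (z == 0).
Proof. apply/eqP/eqP => [|->]; [exact: Normc.eq0_normc|exact: mc0]. Qed.
Lemma mc_gt0 z : (0 < mc z) = (z != 0).
Proof. by rewrite lt_def mc_ge0 andbT mc_eq0. Qed.
Lemma mc_sqr z : mc z ^+ 2 = complex.Re z ^+ 2 + complex.Im z ^+ 2.
Proof. by rewrite mcE sqr_sqrtr // addr_ge0 // sqr_ge0. Qed.
Lemma mcR a : mc a%:C = `|a|.
Proof. by rewrite mcE /= expr0n addr0 sqrtr_sqr. Qed.
Lemma mcBR a b : mc (a%:C - b%:C) = `|a - b|.
Proof. by rewrite -[a%:C - b%:C](rmorphB (real_complex R) a b) mcR. Qed.
Lemma mc_re z : `|complex.Re z| <= mc z.
Proof. by rewrite mcE -sqrtr_sqr ler_wsqrtr // lerDl sqr_ge0. Qed.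
Lemma mc_im z : `|complex.Im z| <= mc z.
Proof. by rewrite mcE -sqrtr_sqr ler_wsqrtr // lerDr sqr_ge0. Qed.
Lemma mc_le z : mc z <= `|complex.Re z| + `|complex.Im z|.
Proof.
rewrite mcE -[leRHS]ger0_norm ?addr_ge0 // -sqrtr_sqr ler_wsqrtr //.
rewrite sqrrD !real_normK ?num_real //.
by have := mulr_ge0 (normr_ge0 (complex.Re z)) (normr_ge0 (complex.Im z)); lra.
Qed.
Lemma mcJ z : mc (conjc z) = mc z.
Proof. by case: z => a b; rewrite !mcE /= sqrrN. Qed.
Lemma mc_i : mc 'i%C = 1.
Proof. by rewrite mcE /= expr0n add0r expr1n sqrtr1. Qed.
Lemma mc_sum (I : Type) (s : seq I) (P : pred I) (F : I -> R[i]) :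
  mc (\sum_(i <- s | P i) F i) <= \sum_(i <- s | P i) mc (F i).
Proof.
elim/big_ind2: _ => [|x a y b hx hy|//]; first by rewrite mc0.
by rewrite (le_trans (mcD _ _)) // lerD.
Qed.
Lemma reM x y : complex.Re (x * y) =
  complex.Re x * complex.Re y - complex.Im x * complex.Im y.
Proof. by case: x; case: y. Qed.
Lemma imM x y : complex.Im (x * y) =
  complex.Re x * complex.Im y + complex.Im x * complex.Re y.
Proof. by case: x; case: y. Qed.
Lemma reD x y : complex.Re (x + y) = complex.Re x + complex.Re y.
Proof. by case: x; case: y. Qed.
Lemma imD x y : complex.Im (x + y) = complex.Im x + complex.Im y.
Proof. by case: x; case: y. Qed.
Lemma reN x : complex.Re (- x) = - complex.Re x. Proof. by case: x. Qed.
Lemma imN x : complex.Im (- x) = - complex.Im x. Proof. by case: x. Qed.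
Lemma reB x y : complex.Re (x - y) = complex.Re x - complex.Re y.
Proof. by rewrite reD reN. Qed.
Lemma imB x y : complex.Im (x - y) = complex.Im x - complex.Im y.
Proof. by rewrite imD imN. Qed.
Lemma reJ x : complex.Re (conjc x) = complex.Re x. Proof. by case: x. Qed.
Lemma imJ x : complex.Im (conjc x) = - complex.Im x. Proof. by case: x. Qed.
Lemma complex_ext x y : complex.Re x = complex.Re y ->
  complex.Im x = complex.Im y -> x = y.
Proof. by case: x; case: y => a b c d /= -> ->. Qed.
Lemma mulJ x : x * conjc x = (mc x ^+ 2)%:C.
Proof.
rewrite mc_sqr; apply: complex_ext; rewrite ?reM ?imM reJ imJ /=; ring.
Qed.

End ComplexModulus.

Definition cE := (reM, imM, reD, imD, reN, imN, reJ, imJ).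

Section ComplexCalculus.
Variable R : realType.
Local Notation C := R[i].
Implicit Types (S : set C) (f g : C -> C) (z w d : C).

(** The set S is the whole plane for complex derivatives, a real segment for curves, and a closed
    half-plane or quadrant for boundary behaviour; one calculus then serves all of them. *)
Definition near_in S z (P : C -> Prop) :=
  exists2 r : R, 0 < r & forall w, S w -> mc (w - z) < r -> P w.

Lemma near_in_and S z P Q : near_in S z P -> near_in S z Q ->
  near_in S z (fun w => P w /\ Q w).
Proof.
move=> [r r0 hP] [s s0 hQ]; exists (Num.min r s); first by rewrite lt_min r0.
by move=> w Sw; rewrite lt_min => /andP[h1 h2]; split; [apply: hP|apply: hQ].
Qed.
Lemma near_in_imp S z (P Q : C -> Prop) :
  (forall w, S w -> P w -> Q w) -> near_in S z P -> near_in S z Q.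
Proof. by move=> PQ [r r0 h]; exists r => // w Sw hw; exact/PQ/h. Qed.
Lemma near_in_sub S S' z P : S `<=` S' -> near_in S' z P -> near_in S z P.
Proof. by move=> SS [r r0 h]; exists r => // w /SS; apply: h. Qed.

Definition ccont S f z := forall e : R, 0 < e ->
  near_in S z (fun w => mc (f w - f z) < e).

Lemma ccont_cst S c z : ccont S (fun=> c) z.
Proof. by move=> e e0; exists 1 => // w _ _; rewrite subrr mc0. Qed.
Lemma ccont_id S z : ccont S id z.
Proof. by move=> e e0; exists e. Qed.
Lemma ccontD S f g z : ccont S f z -> ccont S g z ->
  ccont S (fun w => f w + g w) z.
Proof.
move=> hf hg e e0; have e20 : 0 < e / 2 by rewrite divr_gt0.
apply: near_in_imp (near_in_and (hf _ e20) (hg _ e20)) => w _ [h1 h2].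
have -> : f w + g w - (f z + g z) = (f w - f z) + (g w - g z) by ring.
by apply: le_lt_trans (mcD _ _) _; lra.
Qed.
Lemma ccont_bnd S f z : ccont S f z ->
  near_in S z (fun w => mc (f w) < mc (f z) + 1).
Proof.
move=> /(_ 1 ltr01); apply: near_in_imp => w _ h.
by have := mc_dist (f w) (f z); lra.
Qed.
Lemma ccontM S f g z : ccont S f z -> ccont S g z ->
  ccont S (fun w => f w * g w) z.
Proof.
move=> hf hg e e0; set K := mc (f z) + mc (g z) + 1.
have K0 : 0 < K by rewrite /K; have := mc_ge0 (f z); have := mc_ge0 (g z); lra.
have e20 : 0 < e / (2 * K) by rewrite divr_gt0 // mulr_gt0.
apply: near_in_imp (near_in_and (ccont_bnd hg) (near_in_and (hf _ e20) (hg _ e20))).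
move=> w _ [h0 [h1 h2]].
have -> : f w * g w - f z * g z = (f w - f z) * g w + f z * (g w - g z) by ring.
apply: le_lt_trans (mcD _ _) _; rewrite !mcM.
have eE : e = e / (2 * K) * K + K * (e / (2 * K)) by field; rewrite lt0r_neq0.
rewrite [ltRHS]eE ltr_leD //.
  apply: (@le_lt_trans _ _ (mc (f w - f z) * K)).
    by rewrite ler_wpM2l ?mc_ge0 // /K; have := mc_ge0 (f z); lra.
  by rewrite ltr_pM2r.
apply: ler_pM; rewrite ?mc_ge0 //; last exact: ltW.
by rewrite /K; have := mc_ge0 (g z); lra.
Qed.
Lemma ccontN S f z : ccont S f z -> ccont S (fun w => - f w) z.
Proof.
move=> hf e e0; apply: near_in_imp (hf e e0) => w _.
by rewrite -opprD mcN.
Qed.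
Lemma ccontB S f g z : ccont S f z -> ccont S g z ->
  ccont S (fun w => f w - g w) z.
Proof. by move=> hf hg; apply: ccontD => //; exact: ccontN. Qed.
Lemma ccont_neq0 S f z : ccont S f z -> f z != 0 ->
  near_in S z (fun w => mc (f z) / 2 < mc (f w)).
Proof.
rewrite -mc_gt0 => hf h; have h2 : 0 < mc (f z) / 2 by rewrite divr_gt0.
apply: near_in_imp (hf _ h2) => w _ hw.
by have := mc_dist (f z) (f w); rewrite mc_distC; lra.
Qed.
Lemma ccontV S f z : ccont S f z -> f z != 0 -> ccont S (fun w => (f w)^-1) z.
Proof.
move=> hf h e e0; have h0 : 0 < mc (f z) by rewrite mc_gt0.
have e20 : 0 < e * mc (f z) ^+ 2 / 2 by rewrite divr_gt0 // mulr_gt0 // exprn_gt0.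
apply: near_in_imp (near_in_and (ccont_neq0 hf h) (hf _ e20)) => w _ [h1 h2].
have w0 : f w != 0 by rewrite -mc_gt0; lra.
have -> : (f w)^-1 - (f z)^-1 = (f z - f w) / (f w * f z) by field; rewrite h w0.
rewrite mc_div mcM mc_distC ltr_pdivrMr; last by rewrite mulr_gt0 // mc_gt0.
apply: lt_le_trans h2 _.
rewrite -mulrA ler_pM2l // expr2 mulrAC ler_pM2r //.
exact: ltW.
Qed.
Lemma ccont_comp S S' f g z : (forall w, S w -> S' (g w)) ->
  ccont S g z -> ccont S' f (g z) -> ccont S (fun w => f (g w)) z.
Proof.
move=> SS hg hf e e0; have [r r0 hr] := hf e e0.
by apply: near_in_imp (hg r r0) => w Sw hw; apply: hr; first exact: SS.
Qed.
Lemma ccont_sub S S' f z : S `<=` S' -> ccont S' f z -> ccont S f z.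
Proof. by move=> SS hf e e0; exact: near_in_sub SS (hf e e0). Qed.
Lemma ccontJ S f z : ccont S f z -> ccont S (fun w => conjc (f w)) z.
Proof.
move=> hf e e0; apply: near_in_imp (hf e e0) => w _.
by rewrite -rmorphB mcJ.
Qed.

(* Caratheodory's form of differentiability relative to S; the difference
   quotient q is continuous at z, so that the derivative rules reduce to the
   continuity rules. *)
Definition cder S f z d := exists q : C -> C, [/\ ccont S q z, q z = d &
  forall w, S w -> f w - f z = q w * (w - z)].

Lemma cder_cont S f z d : cder S f z d -> ccont S f z.
Proof.
move=> [q [hq _ hE]] e e0.
have : ccont S (fun w => q w * (w - z)) z.
  apply: ccontM => //; apply: ccontB; [exact: ccont_id|exact: ccont_cst].
move=> /(_ e e0); apply: near_in_imp => w Sw.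
by rewrite subrr mulr0 subr0 hE.
Qed.
Lemma cder_cst S c z : cder S (fun=> c) z 0.
Proof.
exists (fun=> 0); split => //; first exact: ccont_cst.
by move=> w _; rewrite subrr mul0r.
Qed.
Lemma cder_id S z : cder S id z 1.
Proof.
exists (fun=> 1); split => //; first exact: ccont_cst.
by move=> w _; rewrite mul1r.
Qed.
Lemma cderD S f g z a b : cder S f z a -> cder S g z b ->
  cder S (fun w => f w + g w) z (a + b).
Proof.
move=> [p [hp <- pE]] [q [hq <- qE]]; exists (fun w => p w + q w); split => //.
  exact: ccontD.
by move=> w Sw; rewrite mulrDl -pE // -qE //; ring.
Qed.
Lemma cderN S f z a : cder S f z a -> cder S (fun w => - f w) z (- a).
Proof.
move=> [p [hp <- pE]]; exists (fun w => - p w); split => //; first exact: ccontN.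
by move=> w Sw; rewrite mulNr -pE //; ring.
Qed.
Lemma cderB S f g z a b : cder S f z a -> cder S g z b ->
  cder S (fun w => f w - g w) z (a - b).
Proof. by move=> hf hg; apply: cderD => //; exact: cderN. Qed.
Lemma cderM S f g z a b : cder S f z a -> cder S g z b ->
  cder S (fun w => f w * g w) z (a * g z + f z * b).
Proof.
move=> hf hg; have cg := cder_cont hg.
case: hf hg => [p [hp <- pE]] [q [hq <- qE]].
exists (fun w => p w * g w + f z * q w); split => //.
  by apply: ccontD; apply: ccontM => //; exact: ccont_cst.
move=> w Sw; rewrite mulrDl mulrAC -pE // -[f z * q w * _]mulrA -qE //; ring.
Qed.
Lemma cderV S f z a : S z -> (forall w, S w -> f w != 0) -> cder S f z a ->
  cder S (fun w => (f w)^-1) z (- a / f z ^+ 2).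
Proof.
move=> Sz f0 hf; have cf := cder_cont hf; have fz := f0 _ Sz.
case: hf => [p [hp <- pE]].
exists (fun w => - p w * ((f w)^-1 * (f z)^-1)); split.
- apply: ccontM; first exact: ccontN.
  by apply: ccontM; [apply: ccontV|apply: ccont_cst].
- by rewrite expr2 invfM.
- move=> w Sw; have fw := f0 _ Sw.
  rewrite mulrAC mulNr -pE //; field; by rewrite fz fw.
Qed.
Lemma cder_comp S S' f g z a b : (forall w, S w -> S' (g w)) ->
  cder S g z a -> cder S' f (g z) b -> cder S (fun w => f (g w)) z (b * a).
Proof.
move=> SS hg; have cg := cder_cont hg.
case: hg => [p [hp <- pE]] [q [hq <- qE]].
exists (fun w => q (g w) * p w); split => //.
  by apply: ccontM => //; exact: ccont_comp SS cg hq.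
by move=> w Sw; rewrite (qE _ (SS _ Sw)) (pE _ Sw) mulrA.
Qed.
Lemma cder_sub S S' f z a : S `<=` S' -> cder S' f z a -> cder S f z a.
Proof.
move=> SS [p [hp <- pE]]; exists p; split => //; first exact: ccont_sub hp.
by move=> w /SS; exact: pE.
Qed.
Lemma cder_ext S f g z a : (forall w, S w -> f w = g w) -> S z ->
  cder S f z a -> cder S g z a.
Proof.
move=> fg Sz [p [hp <- pE]]; exists p; split => // w Sw.
by rewrite -!fg // pE.
Qed.
Lemma cder_eps S f z d : cder S f z d -> forall e : R, 0 < e ->
  near_in S z (fun w => mc (f w - f z - d * (w - z)) <= e * mc (w - z)).
Proof.
move=> [q [hq <- qE]] e e0; apply: near_in_imp (hq e e0) => w Sw hw.
by rewrite qE // -mulrBl mcM ler_wpM2r ?mc_ge0 // ltW.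
Qed.
Lemma eps_cder S f z d : (forall e : R, 0 < e ->
  near_in S z (fun w => mc (f w - f z - d * (w - z)) <= e * mc (w - z))) ->
  cder S f z d.
Proof.
move=> h; exists (fun w => if w == z then d else (f w - f z) / (w - z)).
split=> [e e0||w Sw]; last first.
  - case: eqP => [->|/eqP]; first by rewrite !subrr mulr0.
    by rewrite -subr_eq0 => ?; rewrite divfK.
  - by rewrite eqxx.
have e20 : 0 < e / 2 by rewrite divr_gt0.
apply: near_in_imp (h _ e20) => w Sw hw; rewrite eqxx.
case: eqP => [_|/eqP]; first by rewrite subrr mc0.
rewrite -subr_eq0 => wz.
have -> : (f w - f z) / (w - z) - d = (f w - f z - d * (w - z)) / (w - z).
  by field.
rewrite mc_div ltr_pdivrMr ?mc_gt0 //; apply: le_lt_trans hw _.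
by rewrite ltr_pM2r ?mc_gt0 //; lra.
Qed.
End ComplexCalculus.

(** * Curves: mean value inequality and primitives in a real parameter *)

Section RealCurves.
Variable R : realType.
Local Notation C := R[i].
Implicit Types (S : set C) (f g : C -> C) (z w d : C).

Lemma cder_near S f g z a : near_in S z (fun w => f w = g w) -> f z = g z ->
  cder S f z a -> cder S g z a.
Proof.
move=> fg fgz h; apply: eps_cder => e e0.
apply: near_in_imp (near_in_and fg (cder_eps h e0)) => w _ [<- +].
by rewrite -fgz.
Qed.

(** Replacing f by 1 at its zeros changes nothing near z and gives the zero-free function that
    [cderV] requires. *)
Lemma cderV1 S f z a : S z -> f z != 0 -> cder S f z a ->
  cder S (fun w => (f w)^-1) z (- a / f z ^+ 2).
Proof.
move=> Sz fz hf; pose g w := if f w == 0 then 1 else f w.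
have gz : g z = f z by rewrite /g (negbTE fz).
have nfg : near_in S z (fun w => f w = g w).
  apply: near_in_imp (ccont_neq0 (cder_cont hf) fz) => w _ hw.
  have : 0 < mc (f w) by apply: le_lt_trans hw; rewrite divr_ge0 // mc_ge0.
  by rewrite mc_gt0 /g => /negbTE ->.
have hg : cder S g z a by apply: cder_near hf => //; rewrite gz.
rewrite -gz; apply: cder_near (cderV Sz _ hg); last 2 first.
- by rewrite gz.
- by move=> w _; rewrite /g; case: ifP => [_|->//]; exact: oner_neq0.
- by apply: near_in_imp nfg => w _ ->.
Qed.

Lemma cder_uniq f z a b : cder setT f z a -> cder setT f z b -> a = b.
Proof.
move=> ha hb; apply/eqP; rewrite -subr_eq0 -mc_eq0; apply/negP => /negP ab.
have e0 : 0 < mc (a - b) by rewrite lt_def ab mc_ge0.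
have e1 : 0 < mc (a - b) / 4 by rewrite divr_gt0.
have [r r0 h] := near_in_and (cder_eps ha e1) (cder_eps hb e1).
have r20 : 0 < r / 2 by rewrite divr_gt0.
have hr : mc (z + (r / 2)%:C - z) = r / 2 by rewrite addrC addKr mcR gtr0_norm.
have [//|h1 h2] := h (z + (r / 2)%:C) I; first by rewrite hr ltr_pdivrMr //; lra.
have : mc ((a - b) * (r / 2)%:C) <= mc (a - b) / 2 * (r / 2).
  have -> : (a - b) * (r / 2)%:C =
    (f (z + (r / 2)%:C) - f z - b * (z + (r / 2)%:C - z)) -
    (f (z + (r / 2)%:C) - f z - a * (z + (r / 2)%:C - z)) by ring.
  by apply: le_trans (mcB _ _) _; move: h1 h2; rewrite hr; lra.
by rewrite mcM mcR gtr0_norm // ler_pM2r //; lra.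
Qed.

(** Bolzano-Weierstrass, from the compactness of a square in R * R. *)
Lemma bounded_cluster (a : nat -> C) (B : R) : (forall n, mc (a n) <= B) ->
  exists p, forall e N, 0 < e -> exists2 n, (N <= n)%N & mc (a n - p) < e.
Proof.
move=> aB.
pose q n : R * R := (complex.Re (a n), complex.Im (a n)).
have cK : compact (`[- B, B]%classic `*` `[- B, B]%classic : set (R * R)).
  by apply: compact_setX; exact: segment_compact.
have Kq : \forall n \near \oo, (`[- B, B]%classic `*` `[- B, B]%classic : set (R * R)) (q n).
  near=> n; split; rewrite /= in_itv /= -ler_norml.
    exact: le_trans (mc_re _) (aB _).
  exact: le_trans (mc_im _) (aB _).
have [[x y] [_ hc]] := cK (q @ \oo) _ Kq.
exists (x +i* y) => e N e0.
have e20 : 0 < e / 2 by rewrite divr_gt0.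
have hA : (q @ \oo) [set p | exists2 n, (N <= n)%N & p = q n].
  by exists N => // n /= Nn; exists n.
have hB : nbhs (x, y) (ball (x, y) (e / 2)) by exact: nbhsx_ballx.
have [_ [[n Nn ->] [h1 h2]]] := hc _ _ hA hB.
exists n => //; apply: le_lt_trans (mc_le _) _.
rewrite !cE /=; move: h1 h2; rewrite /ball /= (distrC x) (distrC y); lra.
Unshelve. all: by end_near.
Qed.

(** The field K is arbitrary so that real and complex derivatives are both covered. *)
Lemma is_deriveP (K : numFieldType) (f : K^o -> K^o) (x d : K) :
  (forall e, 0 < e -> exists2 r, 0 < r & forall y, `|y - x| < r ->
     `|f y - f x - d * (y - x)| <= e * `|y - x|) <-> is_derive (x : K^o) 1 f d.
Proof.
split => [h|h e e0].
  have hc : (fun t : K => t^-1 *: (f (t *: 1 + x) - f x)) @ 0^' --> (d : K^o).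
    apply/cvgrPdist_le => e e0; have [r r0 hr] := h e e0.
    exists r => //= t; rewrite /ball /= sub0r normrN => tr t0.
    have := hr (t *: 1 + x); rewrite addrK /GRing.scale /= mulr1 => /(_ tr) hh.
    have tn : 0 < `|t| by rewrite normr_gt0.
    rewrite distrC -(ler_pM2r tn) -normrM mulrBl mulrAC mulVf // mul1r.
    exact: hh.
  apply: DeriveDef; first by apply/cvg_ex; exists d.
  exact: (cvg_lim _ hc).
have hc : (fun t : K => t^-1 *: (f (t *: 1 + x) - f x)) @ 0^' --> (d : K^o).
  by have := @ex_derive _ _ _ _ _ _ _ h; rewrite /derivable -(@derive_val _ _ _ _ _ _ _ h).
move/cvgrPdist_le : hc => /(_ e e0) [r /= r0 hr]; exists r => // y yr.
have [->|yx] := eqVneq y x; first by rewrite !subrr mulr0 subrr !normr0 mulr0.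
have := hr (y - x); rewrite /ball /= sub0r normrN => /(_ yr).
rewrite subr_eq0 => /(_ yx); rewrite /GRing.scale /= mulr1 subrK => hh.
have tn : 0 < `|y - x| by rewrite normr_gt0 subr_eq0.
move: hh; rewrite distrC -(ler_pM2r tn) -normrM mulrBl mulrAC mulVf ?mul1r //.
by rewrite subr_eq0.
Qed.

Lemma is_derive_cderP f z d :
  is_derive (z : C^o) 1 (f : C^o -> C^o) d <-> cder setT f z d.
Proof.
have nE (u : C) : `|u| = (mc u)%:C by rewrite normc_def mcE.
split.
  move=> /is_deriveP h; apply: eps_cder => e e0.
  have [|r r0 hr] := h e%:C; first by rewrite ltcR.
  have := ltW r0; rewrite lecE => /andP[/eqP /= ri _].
  exists (complex.Re r); first by move: r0; rewrite ltcE => /andP[].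
  move=> w _ wr; have := hr w; rewrite !nE ltcE /= ri eqxx => /(_ wr).
  by rewrite -rmorphM /= lecR.
move=> h; apply/is_deriveP => e; rewrite ltcE => /andP[/eqP ei e0].
have [r r0 hr] := cder_eps h e0; exists r%:C; first by rewrite ltcR.
move=> y; rewrite !nE ltcR => yr; have := hr y I yr.
have -> : e = (complex.Re e)%:C by apply: complex_ext.
by rewrite -rmorphM /= lecR.
Qed.

(** Parameter intervals are embedded in C, so that [cder] relative to [seg a b] is the derivative in
    a real parameter, one-sided at the end points. *)
Definition seg (a b : R) : set C := [set z | exists2 t, a <= t <= b & z = t%:C].

Lemma segI a b t : a <= t <= b -> seg a b t%:C.
Proof. by exists t. Qed.

Lemma is_derive_re a b (f : C -> C) t d : a < t < b -> cder (seg a b) f t%:C d ->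
  is_derive t 1 (fun s : R => complex.Re (f s%:C)) (complex.Re d).
Proof.
move=> /andP[t1 t2] h; apply/(@is_deriveP R) => e e0; have [r r0 hr] := cder_eps h e0.
exists (Num.min r (Num.min (t - a) (b - t))); first by rewrite !lt_min r0 !subr_gt0 t1.
move=> y; rewrite !lt_min => /and3P[yr y1 y2].
have ys : seg a b y%:C by apply: segI; move: y1 y2; rewrite !ltr_norml; lra.
have := hr _ ys; rewrite mcBR => /(_ yr); apply: le_trans.
by apply: le_trans (mc_re _); rewrite !cE /= subrr mulr0 subr0.
Qed.

Lemma re_within_continuous a b (f : C -> C) :
  (forall t, a <= t <= b -> ccont (seg a b) f t%:C) ->
  {within `[a, b], continuous (fun s : R => complex.Re (f s%:C))}.
Proof.
move=> h; apply/subspace_continuousP => t; rewrite /= in_itv /= => tab.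
apply/cvgrPdist_lt => e e0; have [r r0 hr] := h t tab e e0.
rewrite near_withinE; exists r => //= y; rewrite /ball /= => yr.
rewrite in_itv /= => yab; rewrite -reB; apply: le_lt_trans (mc_re _) _.
rewrite mc_distC; apply: hr; first exact: segI.
by rewrite mcBR distrC.
Qed.

(** This stands in for |int g| <= int |g|, with U a primitive of a majorant. With D = G b - G a, the
    real mean value theorem is applied to Re (conj D * G) - |D| Re U, whose derivative is at most
    |D| (|g| - Re u) <= 0. *)
Lemma curve_mvt (a b : R) (G g U u : C -> C) : a <= b ->
  (forall t, a <= t <= b -> cder (seg a b) G t%:C (g t%:C)) ->
  (forall t, a <= t <= b -> cder (seg a b) U t%:C (u t%:C)) ->
  (forall t, a <= t <= b -> mc (g t%:C) <= complex.Re (u t%:C)) ->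
  mc (G b%:C - G a%:C) <= complex.Re (U b%:C) - complex.Re (U a%:C).
Proof.
move=> ab hG hU gu; case: (eqVneq a b) => [->|nab].
  by rewrite !subrr mc0.
have ltab : a < b by rewrite lt_def eq_sym nab.
set D := G b%:C - G a%:C; pose v := conjc D.
have [D0|D0] := eqVneq D 0.
  rewrite D0 mc0 subr_ge0.
  have hd t : t \in `]a, b[%R -> is_derive t 1 (fun s : R => complex.Re (U s%:C)) (complex.Re (u t%:C)).
    rewrite in_itv /= => tab; apply: (is_derive_re tab); apply: hU.
    by case/andP: tab => *; rewrite !ltW.
  have [|t tab] := MVT ltab hd.
    by apply: re_within_continuous => t /hU /cder_cont.
  move/(congr1 (fun x => x + complex.Re (U a%:C))); rewrite subrK => ->.
  rewrite lerDr mulr_ge0 ?subr_ge0 //.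
  move: tab; rewrite in_itv /= => /andP[t1 t2].
  by rewrite (le_trans (mc_ge0 (g t%:C))) // gu // !ltW.
pose H z := v * G z - (mc D)%:C * U z.
pose h z := (0 * G z + v * g z) - (0 * U z + (mc D)%:C * u z).
have hH t : a <= t <= b -> cder (seg a b) H t%:C (h t%:C).
  move=> tab; apply: cderB; apply: cderM; try exact: cder_cst; [exact: hG|exact: hU].
have hd t : t \in `]a, b[%R -> is_derive t 1 (fun s : R => complex.Re (H s%:C)) (complex.Re (h t%:C)).
  rewrite in_itv /= => tab; apply: (is_derive_re tab); apply: hH.
  by case/andP: tab => *; rewrite !ltW.
have [|t tab] := MVT ltab hd.
  by apply: re_within_continuous => t /hH /cder_cont.
have ht : complex.Re (h t%:C) <= 0.
  move: tab; rewrite in_itv /= => /andP[t1 t2].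
  have tb : a <= t <= b by rewrite !ltW.
  rewrite /h !mul0r !add0r reB subr_le0.
  have : complex.Re (v * g t%:C) <= mc D * mc (g t%:C).
    by rewrite -(mcJ D) -mcM (le_trans (ler_norm _)) // mc_re.
  move=> /le_trans; apply; rewrite !cE /= mul0r subr0.
  by rewrite ler_wpM2l ?mc_ge0 // gu.
move=> hE; have : complex.Re (H b%:C) - complex.Re (H a%:C) <= 0.
  by rewrite hE mulr_le0_ge0 // subr_ge0.
have -> : complex.Re (H b%:C) - complex.Re (H a%:C) =
  mc D * (mc D - (complex.Re (U b%:C) - complex.Re (U a%:C))).
  have -> : complex.Re (H b%:C) - complex.Re (H a%:C) =
    complex.Re (D * v) - mc D * (complex.Re (U b%:C) - complex.Re (U a%:C)).
    rewrite /H /D !cE /=; ring.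
  rewrite mulJ /=; ring.
by rewrite pmulr_rle0 ?mc_gt0 // subr_le0.
Qed.

Lemma curve_mvt_cst (a b M : R) (G g : C -> C) : a <= b ->
  (forall t, a <= t <= b -> cder (seg a b) G t%:C (g t%:C)) ->
  (forall t, a <= t <= b -> mc (g t%:C) <= M) ->
  mc (G b%:C - G a%:C) <= M * (b - a).
Proof.
move=> ab hG gM.
have := @curve_mvt a b G g (fun z => M%:C * z) (fun z => 0 * z + M%:C * 1) ab hG.
rewrite !cE /= !mul0r !subr0 -mulrBr; apply => t tab.
  by apply: cderM; [exact: cder_cst|exact: cder_id].
by apply: le_trans (gM t tab) _; lra.
Qed.

Lemma continuous_primitive (f : R -> R) : continuous f ->
  exists F : R -> R, forall x : R, 0 <= x <= 1 -> is_derive x 1 F (f x).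
Proof.
move=> cf.
(* Starting at -1 makes 0 an interior point, so that the derivative there is two-sided. *)
exists (fun x => \int[lebesgue_measure]_(t in [set` Interval (BLeft (-1)) (BRight x)]) f t)%R.
move=> x /andP[x0 x1].
have xu : x < 2 by lra.
have fi : lebesgue_measure.-integrable [set` Interval (BLeft (-1)) (BRight 2)] (EFin \o f).
  apply: continuous_compact_integrable; first exact: segment_compact.
  exact: continuous_subspaceT.
have [|d1 d2] := continuous_FTC1_closed xu fi _ (cf x); first by lra.
by apply: DeriveDef; [exact: d1|rewrite -derive1E].
Qed.

Lemma curve_primitive (c : C -> C) :
  (forall t, 0 <= t <= 1 -> ccont (seg 0 1) c t%:C) ->
  exists G, forall t, 0 <= t <= 1 -> cder (seg 0 1) G t%:C (c t%:C).
Proof.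
(* Clamping the parameter to [0, 1] extends c continuously to the whole line, since [cl] is
   1-Lipschitz. *)
move=> hc; pose cl (t : R) := Num.max 0 (Num.min t 1).
have cl01 t : 0 <= cl t <= 1.
  by rewrite /cl le_max lexx ge_max ler01 /= ge_min lexx orbT.
have clE t : 0 <= t <= 1 -> cl t = t.
  by move=> /andP[t0 t1]; rewrite /cl min_l // max_r.
have clL s t : `|cl s - cl t| <= `|s - t|.
  have h1 := ler_norm (s - t); have := ler_norm (t - s); rewrite (distrC t) => h2.
  rewrite /cl; case: (leP s 1) => s1; case: (leP t 1) => t1;
  rewrite ?(max_r ler01); try case: (leP 0 s) => s0; try case: (leP 0 t) => t0;
  rewrite ler_norml; lra.
have cont t e : 0 < e -> exists2 r, 0 < r & forall s, `|s - t| < r ->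
    mc (c (cl s)%:C - c (cl t)%:C) < e.
  move=> e0; have [r r0 hr] := hc _ (cl01 t) e e0; exists r => // s sr.
  apply: hr; first exact: segI.
  by rewrite mcBR (le_lt_trans (clL _ _)).
have cu : continuous (fun t : R => complex.Re (c (cl t)%:C)).
  move=> t; apply/cvgrPdist_lt => e e0; have [r r0 hr] := cont t e e0.
  exists r => //= s; rewrite /ball /= distrC => sr.
  rewrite distrC -reB; exact: le_lt_trans (mc_re _) (hr _ sr).
have cv : continuous (fun t : R => complex.Im (c (cl t)%:C)).
  move=> t; apply/cvgrPdist_lt => e e0; have [r r0 hr] := cont t e e0.
  exists r => //= s; rewrite /ball /= distrC => sr.
  rewrite distrC -imB; exact: le_lt_trans (mc_im _) (hr _ sr).
have [U hU] := continuous_primitive cu; have [V hV] := continuous_primitive cv.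
exists (fun z => U (complex.Re z) +i* V (complex.Re z)) => t t01.
apply: eps_cder => e e0; have e20 : 0 < e / 2 by rewrite divr_gt0.
have [r r0 hr] := (@is_deriveP R U t _).2 (hU t t01) _ e20.
have [s s0 hs] := (@is_deriveP R V t _).2 (hV t t01) _ e20.
exists (Num.min r s); first by rewrite lt_min r0.
move=> _ [y y01 ->]; rewrite mcBR lt_min => /andP[yr ys].
apply: le_trans (mc_le _) _; rewrite !cE /=.
have := hr y yr; have := hs y ys; rewrite clE // subrr !mulr0 subr0 add0r.
lra.
Qed.

End RealCurves.

(** * Goursat's lemma and primitives *)

Section Goursat.
Variable R : realType.
Local Notation C := R[i].
Implicit Types (S U : set C) (f g F G : C -> C) (a b c z w d p : C).

Definition holo f z := exists d, cder setT f z d.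

Lemma holo_cont f z : holo f z -> ccont setT f z.
Proof. by case=> d; exact: cder_cont. Qed.

Definition segprim f a b G := forall t : R, 0 <= t <= 1 ->
  cder (seg 0 1) G t%:C ((b - a) * f (a + t%:C * (b - a))).

(** The integral of f along the segment from a to b, as the increment of a chosen primitive of the
    parametrised integrand. For [segcont] integrands the choice is immaterial by [segintE]. *)
Definition segint f a b :=
  let G := xget (fun=> 0) [set G | segprim f a b G] in G 1%:C - G 0%:C.

Definition segcont f a b := forall t : R, 0 <= t <= 1 ->
  ccont setT f (a + t%:C * (b - a)).

Lemma cder_eq S f z d e : cder S f z d -> d = e -> cder S f z e.
Proof. by move=> h <-. Qed.

Lemma cder_lin S a b z : cder S (fun z => a + z * (b - a)) z (b - a).
Proof.
have := cderD (cder_cst S a z) (cderM (cder_id S z) (cder_cst S (b - a) z)).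
by rewrite mul1r mulr0 addr0 add0r.
Qed.

Lemma segprim_ex f a b : segcont f a b -> exists G, segprim f a b G.
Proof.
move=> fc; apply: (@curve_primitive _ (fun t => (b - a) * f (a + t * (b - a)))).
move=> t t01; apply: ccontM; first exact: ccont_cst.
apply: (@ccont_comp _ _ setT) => //; last exact: fc.
exact: cder_cont (cder_lin _ _ _ _).
Qed.

(** One estimate with three uses: q = 0 gives the length bound, q constant the derivative of an
    integral, and q the linear part of f the core of Goursat's argument. *)
Lemma segint_approx f q Q a b (M : R) : segcont f a b ->
  (forall t : R, 0 <= t <= 1 -> cder setT Q (a + t%:C * (b - a)) (q (a + t%:C * (b - a)))) ->
  (forall t : R, 0 <= t <= 1 ->
     mc (f (a + t%:C * (b - a)) - q (a + t%:C * (b - a))) <= M) ->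
  mc (segint f a b - (Q b - Q a)) <= M * mc (b - a).
Proof.
move=> fc Qq fM; rewrite /segint; set G := xget _ _.
have hG : segprim f a b G by rewrite /G; apply: xgetPex; exact: segprim_ex.
have := @curve_mvt_cst _ 0 1 (M * mc (b - a)) (fun z => G z - Q (a + z * (b - a)))
  (fun z => (b - a) * f (a + z * (b - a)) - q (a + z * (b - a)) * (b - a)) ler01.
rewrite subr0 mulr1 mul0r addr0 mul1r addrCA subrr addr0.
have -> : G 1%:C - Q b - (G 0%:C - Q a) = G 1%:C - G 0%:C - (Q b - Q a) by ring.
apply=> t t01.
  apply: cderB; first exact: hG.
  by apply: (@cder_comp _ _ setT) => //; [exact: cder_lin|exact: Qq].
by rewrite [q _ * _]mulrC -mulrBr mcM mulrC ler_wpM2r ?mc_ge0 // fM.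
Qed.

Lemma segint_le f a b (M : R) : segcont f a b ->
  (forall t : R, 0 <= t <= 1 -> mc (f (a + t%:C * (b - a))) <= M) ->
  mc (segint f a b) <= M * mc (b - a).
Proof.
move=> fc fM; have := @segint_approx f (fun=> 0) (fun=> 0) a b M fc.
rewrite subrr subr0; apply => t t01; first exact: cder_cst.
by rewrite subr0; exact: fM.
Qed.

Lemma segintE f a b G : segcont f a b -> segprim f a b G ->
  segint f a b = G 1%:C - G 0%:C.
Proof.
move=> fc hG; rewrite /segint; set H := xget _ _.
have hH : segprim f a b H by rewrite /H; apply: xgetPex; exists G.
have := @curve_mvt_cst _ 0 1 0 (fun z => H z - G z) (fun=> 0) ler01.
rewrite mul0r => h; apply/eqP; rewrite -subr_eq0 -mc_eq0 eq_le mc_ge0 andbT.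
have -> : H 1%:C - H 0%:C - (G 1%:C - G 0%:C) = H 1%:C - G 1%:C - (H 0%:C - G 0%:C).
  by ring.
apply: h => t t01; last by rewrite mc0.
by have := cderB (hH t t01) (hG t t01); rewrite subrr.
Qed.

(** The sign of r is free: subsegments come from r >= 0 and the reversed segment from s = 1, r =
    -1. *)
Lemma segprim_affine f a b G (s r : R) : 0 <= s <= 1 -> 0 <= s + r <= 1 ->
  segprim f a b G ->
  segprim f (a + s%:C * (b - a)) (a + (s + r)%:C * (b - a)) (fun z => G (s%:C + z * r%:C)).
Proof.
move=> s01 sr01 hG t t01.
have tE : s%:C + t%:C * r%:C = (s + t * r)%:C by rewrite rmorphD rmorphM.
have st01 : 0 <= s + t * r <= 1.
  by case/andP: s01 => ? ?; case/andP: sr01 => ? ?; case/andP: t01 => ? ?; nra.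
have bE : a + (s + r)%:C * (b - a) - (a + s%:C * (b - a)) = r%:C * (b - a).
  by rewrite rmorphD; ring.
rewrite bE.
have -> : a + s%:C * (b - a) + t%:C * (r%:C * (b - a)) = a + (s + t * r)%:C * (b - a).
  by rewrite -tE; ring.
rewrite -mulrA mulrC.
apply: (@cder_comp _ _ (seg 0 1) G (fun z => s%:C + z * r%:C)).
- move=> _ [u u01 ->]; rewrite -rmorphM -rmorphD; apply: segI.
  by case/andP: s01 => ? ?; case/andP: sr01 => ? ?; case/andP: u01 => ? ?; nra.
- have := cderD (cder_cst (seg 0 1) s%:C t%:C) (cderM (cder_id (seg 0 1) t%:C) (cder_cst (seg 0 1) r%:C t%:C)).
  by rewrite mul1r mulr0 addr0 add0r.
- by rewrite tE; exact: hG.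
Qed.

Lemma segcont_affine f a b (s r : R) : 0 <= s <= 1 -> 0 <= s + r <= 1 ->
  segcont f a b -> segcont f (a + s%:C * (b - a)) (a + (s + r)%:C * (b - a)).
Proof.
move=> s01 sr01 fc t t01.
have -> : a + s%:C * (b - a) + t%:C * (a + (s + r)%:C * (b - a) - (a + s%:C * (b - a))) =
  a + (s + t * r)%:C * (b - a) by rewrite !rmorphD rmorphM; ring.
apply: fc.
by case/andP: s01 => ? ?; case/andP: sr01 => ? ?; case/andP: t01 => ? ?; nra.
Qed.

Lemma segint_split f a b (s : R) : 0 <= s <= 1 -> segcont f a b ->
  segint f a b = segint f a (a + s%:C * (b - a)) + segint f (a + s%:C * (b - a)) b.
Proof.
move=> s01 fc; have [G hG] := segprim_ex fc.
have z01 : 0 <= (0 : R) <= 1 by lra.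
have o01 : 0 <= (1 : R) <= 1 by lra.
have h1 := @segprim_affine f a b G 0 s z01.
have h2 := @segprim_affine f a b G s (1 - s) s01.
have c1 := @segcont_affine f a b 0 s z01.
have c2 := @segcont_affine f a b s (1 - s) s01.
rewrite (segintE fc hG).
have e1 : s + (1 - s) = 1 by ring.
have e2 : a + 1%:C * (b - a) = b by ring.
have e3 : a + 0%:C * (b - a) = a by ring.
move: h1 h2 c1 c2; rewrite add0r e1 e2 e3 => h1 h2 c1 c2.
rewrite (segintE (c1 s01 fc) (h1 s01 hG)) (segintE (c2 o01 fc) (h2 o01 hG)).
have -> : 0%:C + 1%:C * s%:C = s%:C by ring.
have -> : s%:C + 1%:C * (1 - s)%:C = 1%:C by ring.
have -> : s%:C + 0%:C * (1 - s)%:C = s%:C by ring.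
have -> : 0%:C + 0%:C * s%:C = 0%:C :> C by ring.
ring.
Qed.

Lemma segint_rev f a b : segcont f a b -> segint f b a = - segint f a b.
Proof.
move=> fc; have [G hG] := segprim_ex fc.
have z01 : 0 <= (1 + -1 : R) <= 1 by rewrite subrr; lra.
have o01 : 0 <= (1 : R) <= 1 by lra.
have h1 := @segprim_affine f a b G 1 (-1) o01 z01 hG.
have c1 := @segcont_affine f a b 1 (-1) o01 z01 fc.
have e1 : 1 + -1 = 0 :> R by ring.
have e2 : a + 1%:C * (b - a) = b by ring.
have e3 : a + 0%:C * (b - a) = a by ring.
move: h1 c1; rewrite e1 e2 e3 => h1 c1.
rewrite (segintE c1 h1) (segintE fc hG).
have -> : 1%:C + 1%:C * (-1)%:C = 0%:C :> C by ring.
have -> : 1%:C + 0%:C * (-1)%:C = 1%:C :> C by ring.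
ring.
Qed.

Lemma segcont_rev f a b : segcont f a b -> segcont f b a.
Proof.
move=> fc t t01; have -> : b + t%:C * (a - b) = a + (1 - t)%:C * (b - a).
  by rewrite rmorphB; ring.
by apply: fc; lra.
Qed.

Definition hull a b c : set C := [set w | exists x y z : R,
  [/\ 0 <= x, 0 <= y, 0 <= z, x + y + z = 1 & w = x%:C * a + y%:C * b + z%:C * c]].

(** Two barycentric coordinates are packed into one complex number, so that [bounded_cluster] yields
    limiting coordinates for p. *)
Lemma hull_closed a b c p :
  (forall e : R, 0 < e -> exists2 w, hull a b c w & mc (w - p) < e) -> hull a b c p.
Proof.
move=> hp.
have /choice[W hW] : forall n, exists w : C * C, hull a b c w.1 /\
    mc (w.1 - p) < n.+1%:R^-1 /\
    [/\ 0 <= complex.Re w.2, 0 <= complex.Im w.2, complex.Re w.2 + complex.Im w.2 <= 1 &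
     w.1 = (complex.Re w.2)%:C * a + (complex.Im w.2)%:C * b +
       (1 - complex.Re w.2 - complex.Im w.2)%:C * c].
  move=> n; have [|w hw wp] := hp n.+1%:R^-1; first by rewrite invr_gt0.
  case: (hw) => x [y [z [x0 y0 z0 s1 wE]]]; exists (w, x +i* y); split => //; split => //=.
  by split => //; [lra|rewrite wE; congr (_ + _%:C * _); lra].
have [n|l hl] := @bounded_cluster R (fun n => (W n).2) 2.
  have [_ [_ [? ? ? _]]] := hW n.
  by apply: le_trans (mc_le _) _; rewrite !ger0_norm //; lra.
set x := complex.Re l; set y := complex.Im l.
have ap e : 0 < e -> exists n, [/\ n.+1%:R^-1 < e, `|complex.Re (W n).2 - x| < e &
   `|complex.Im (W n).2 - y| < e].
  move=> e0; have [n nn hn] := hl e (Num.truncn e^-1) e0.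
  exists n; split.
  - rewrite invf_plt ?posrE //.
    by apply: lt_le_trans (truncnS_gt _) _; rewrite ler_nat.
  - by rewrite /x -reB (le_lt_trans (mc_re _)).
  - by rewrite /y -imB (le_lt_trans (mc_im _)).
have x0 : 0 <= x.
  rewrite leNgt; apply/negP => x0; have [|n [_ + _]] := ap (- x); first by lra.
  by have [_ [_ [? ? ? _]]] := hW n; rewrite ltr_norml; lra.
have y0 : 0 <= y.
  rewrite leNgt; apply/negP => y0; have [|n [_ _ +]] := ap (- y); first by lra.
  by have [_ [_ [? ? ? _]]] := hW n; rewrite ltr_norml; lra.
have xy1 : x + y <= 1.
  rewrite leNgt; apply/negP => xy; have [|n [_ + +]] := ap ((x + y - 1) / 2); first by lra.
  by have [_ [_ [? ? ? _]]] := hW n; rewrite !ltr_norml; lra.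
exists x, y, (1 - x - y); split => //; [lra|ring|].
set q := (X in _ = X).
apply/eqP; rewrite -subr_eq0 -mc_eq0 eq_le mc_ge0 andbT.
apply/ler_addgt0Pl => e e0; rewrite addr0.
set K := 1 + mc a + mc b + 2 * mc c.
have K0 : 0 < K by rewrite /K; have := mc_ge0 a; have := mc_ge0 b; have := mc_ge0 c; lra.
have [|n [n1 n2 n3]] := ap (e / K); first by rewrite divr_gt0.
have [_ [h1 [_ _ _ wE]]] := hW n.
have -> : p - q = - ((W n).1 - p) + ((complex.Re (W n).2 - x)%:C * (a - c) +
   (complex.Im (W n).2 - y)%:C * (b - c)).
  by rewrite wE /q !rmorphB /=; ring.
apply: le_trans (mcD _ _) _; rewrite mcN.
have hx : mc ((complex.Re (W n).2 - x)%:C * (a - c)) <= e / K * (mc a + mc c).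
  by rewrite mcM mcR ler_pM ?mc_ge0 ?mcB // ltW.
have hy : mc ((complex.Im (W n).2 - y)%:C * (b - c)) <= e / K * (mc b + mc c).
  by rewrite mcM mcR ler_pM ?mc_ge0 ?mcB // ltW.
have := mcD ((complex.Re (W n).2 - x)%:C * (a - c)) ((complex.Im (W n).2 - y)%:C * (b - c)).
have -> : e = e / K * K by rewrite divfK // lt0r_neq0.
move: hx hy h1 n1; move: (e / K) => k; rewrite /K.
by move: (n.+1%:R^-1) => n1; lra.
Qed.

Definition tri f (T : C * C * C) :=
  segint f T.1.1 T.1.2 + segint f T.1.2 T.2 + segint f T.2 T.1.1.
Definition per (T : C * C * C) : R :=
  mc (T.1.2 - T.1.1) + mc (T.2 - T.1.2) + mc (T.1.1 - T.2).
Definition hull3 (T : C * C * C) := hull T.1.1 T.1.2 T.2.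

Lemma hull_conv a b c u v (t : R) : hull a b c u -> hull a b c v -> 0 <= t <= 1 ->
  hull a b c (u + t%:C * (v - u)).
Proof.
move=> [x [y [z [x0 y0 z0 s1 ->]]]] [x' [y' [z' [x0' y0' z0' s1' ->]]]] /andP[t0 t1].
exists (x + t * (x' - x)), (y + t * (y' - y)), (z + t * (z' - z)); split.
- have -> : x + t * (x' - x) = (1 - t) * x + t * x' by ring.
  by rewrite addr_ge0 // mulr_ge0 // subr_ge0.
- have -> : y + t * (y' - y) = (1 - t) * y + t * y' by ring.
  by rewrite addr_ge0 // mulr_ge0 // subr_ge0.
- have -> : z + t * (z' - z) = (1 - t) * z + t * z' by ring.
  by rewrite addr_ge0 // mulr_ge0 // subr_ge0.
- have -> : x + t * (x' - x) + (y + t * (y' - y)) + (z + t * (z' - z)) =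
    (1 - t) * (x + y + z) + t * (x' + y' + z') by ring.
  by rewrite s1 s1'; ring.
- by rewrite !(rmorphD, rmorphM, rmorphB) /=; ring.
Qed.

Lemma hull_sub a b c u v w : hull a b c u -> hull a b c v -> hull a b c w ->
  hull u v w `<=` hull a b c.
Proof.
move=> hu hv hw _ [x [y [z [x0 y0 z0 s1 ->]]]].
have [z1|z1] := eqVneq z 1.
  have -> : x = 0 by lra.
  have -> : y = 0 by lra.
  by rewrite z1 !mul0r !add0r mul1r.
have zlt : 0 < 1 - z by rewrite subr_gt0 lt_def eq_sym z1; lra.
have -> : x%:C * u + y%:C * v + z%:C * w =
  (u + (y / (1 - z))%:C * (v - u)) + z%:C * (w - (u + (y / (1 - z))%:C * (v - u))).
  have zE : (1 - z)%:C = 1 - z%:C by rewrite rmorphB.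
  have zC : 1 - z%:C != 0 :> C by rewrite -zE -mc_eq0 mcR gtr0_norm // lt0r_neq0.
  have -> : (y / (1 - z))%:C = y%:C / (1 - z%:C) by rewrite -zE rmorphM /= fmorphV.
  have -> : x%:C = 1 - z%:C - y%:C by rewrite -zE -rmorphB; congr (_%:C); lra.
  by field.
apply: hull_conv => //; last by lra.
apply: hull_conv => //; rewrite divr_ge0 ?(ltW zlt) //= ler_pdivrMr //; lra.
Qed.

Lemma hull_dist a b c w : hull a b c w -> mc (w - a) <= per (a, b, c).
Proof.
move=> [x [y [z [x0 y0 z0 s1 ->]]]].
have -> : x%:C * a + y%:C * b + z%:C * c - a = y%:C * (b - a) + z%:C * (c - a).
  have -> : x = 1 - y - z by lra.
  by rewrite !rmorphB /=; ring.
apply: le_trans (mcD _ _) _; rewrite !mcM !mcR !ger0_norm // /per /=.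
rewrite (mc_distC a c); have := mc_ge0 (b - a); have := mc_ge0 (c - a); have := mc_ge0 (c - b).
nra.
Qed.

Lemma hull_vert a b c : [/\ hull a b c a, hull a b c b & hull a b c c].
Proof.
by split; [exists 1, 0, 0|exists 0, 1, 0|exists 0, 0, 1];
  split => //; rewrite ?(mul1r, mul0r, addr0, add0r) //.
Qed.

Lemma hull_cont f a b c u v : (forall w, hull a b c w -> holo f w) ->
  hull a b c u -> hull a b c v -> segcont f u v.
Proof. by move=> hf hu hv t t01; apply/holo_cont/hf; exact: hull_conv. Qed.

(** In the medial subdivision the inner edges cancel, so the four integrals add up to that over T
    and one of them carries at least a quarter of its modulus. *)
Lemma tri_halve f (T : C * C * C) : (forall w, hull3 T w -> holo f w) ->
  exists T', [/\ hull3 T' `<=` hull3 T, per T' = per T / 2 &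
    mc (tri f T) <= 4 * mc (tri f T')].
Proof.
case: T => [[a b] c]; rewrite /hull3 /= => hf.
have [ha hb hc] := hull_vert a b c.
pose h : R := 2^-1; have h01 : 0 <= h <= 1 by rewrite /h; lra.
pose m u v := u + h%:C * (v - u).
have hab : hull a b c (m a b) by exact: hull_conv.
have hbc : hull a b c (m b c) by exact: hull_conv.
have hca : hull a b c (m c a) by exact: hull_conv.
have cc := hull_cont hf.
have E : tri f (a, b, c) = tri f (a, m a b, m c a) + tri f (m a b, b, m b c) +
   tri f (m c a, m b c, c) + tri f (m b c, m c a, m a b).
  rewrite /tri /=.
  rewrite (segint_split h01 (cc _ _ ha hb)) (segint_split h01 (cc _ _ hb hc)).
  rewrite (segint_split h01 (cc _ _ hc ha)) -!/(m _ _).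
  rewrite (segint_rev (cc _ _ hab hca)) (segint_rev (cc _ _ hca hbc)).
  rewrite (segint_rev (cc _ _ hbc hab)) (segint_rev (cc _ _ hab hbc)); ring.
have hC : h%:C = 2^-1 :> C by rewrite /h fmorphV rmorph_nat.
have p2 u v u' v' : v - u = (v' - u') * (h%:C : C) -> mc (v - u) = mc (v' - u') / 2.
  by move=> ->; rewrite mcM mcR ger0_norm // /h; lra.
have P1 : per (a, m a b, m c a) = per (a, b, c) / 2.
  rewrite /per /= (p2 a _ a b); last by rewrite /m; ring.
  rewrite (p2 (m a b) _ b c); last by rewrite /m hC; field.
  by rewrite (p2 (m c a) _ c a); [ring|rewrite /m hC; field].
have P2 : per (m a b, b, m b c) = per (a, b, c) / 2.
  rewrite /per /= (p2 (m a b) _ a b); last by rewrite /m hC; field.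
  rewrite (p2 b _ b c); last by rewrite /m hC; field.
  by rewrite (p2 (m b c) _ c a); [ring|rewrite /m hC; field].
have P3 : per (m c a, m b c, c) = per (a, b, c) / 2.
  rewrite /per /= (p2 (m c a) _ a b); last by rewrite /m hC; field.
  rewrite (p2 (m b c) _ b c); last by rewrite /m hC; field.
  by rewrite (p2 c _ c a); [ring|rewrite /m hC; field].
have P4 : per (m b c, m c a, m a b) = per (a, b, c) / 2.
  rewrite /per /= (p2 (m b c) _ b a); last by rewrite /m hC; field.
  rewrite (p2 (m c a) _ c b); last by rewrite /m hC; field.
  rewrite (p2 (m a b) _ a c); last by rewrite /m hC; field.
  by rewrite (mc_distC a b) (mc_distC b c) (mc_distC c a); ring.
have [h1|h1] := lerP (mc (tri f (a, b, c))) (4 * mc (tri f (a, m a b, m c a))).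
  by exists (a, m a b, m c a); split => //; exact: hull_sub.
have [h2|h2] := lerP (mc (tri f (a, b, c))) (4 * mc (tri f (m a b, b, m b c))).
  by exists (m a b, b, m b c); split => //; exact: hull_sub.
have [h3|h3] := lerP (mc (tri f (a, b, c))) (4 * mc (tri f (m c a, m b c, c))).
  by exists (m c a, m b c, c); split => //; exact: hull_sub.
exists (m b c, m c a, m a b); split => //; first exact: hull_sub.
have := mcD (tri f (a, m a b, m c a) + tri f (m a b, b, m b c) + tri f (m c a, m b c, c))
  (tri f (m b c, m c a, m a b)).
have := mcD (tri f (a, m a b, m c a) + tri f (m a b, b, m b c)) (tri f (m c a, m b c, c)).
have := mcD (tri f (a, m a b, m c a)) (tri f (m a b, b, m b c)).
rewrite -E; lra.
Qed.

Lemma goursat f a b c : (forall w, hull a b c w -> holo f w) -> tri f (a, b, c) = 0.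
Proof.
move=> hf; pose P (T : C * C * C) := forall w, hull3 T w -> holo f w.
have /choice[nx hnx] : forall T, exists T', P T ->
    [/\ hull3 T' `<=` hull3 T, per T' = per T / 2 & mc (tri f T) <= 4 * mc (tri f T')].
  move=> T; have [PT|nPT] := pselect (P T); last by exists T.
  by have [T' hT'] := tri_halve PT; exists T'.
pose T n := iter n nx (a, b, c).
have hT n : [/\ hull3 (T n) `<=` hull3 (a, b, c), P (T n), per (T n) = per (a, b, c) / 2 ^+ n &
    mc (tri f (a, b, c)) <= 4 ^+ n * mc (tri f (T n))].
  elim: n => [|n [h1 h2 h3 h4]]; first by rewrite divr1 mul1r; split.
  have [k1 k2 k3] := hnx _ h2; split.
  - exact: subset_trans k1 h1.
  - by move=> w /k1/h1/hf.
  - by rewrite /= -/(T n) k2 h3 exprS invfM mulrCA mulrA [in LHS]mulrC !mulrA.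
  - apply: le_trans h4 _; rewrite exprSr -mulrA ler_wpM2l // exprn_ge0 //.
have hnest n m : (n <= m)%N -> hull3 (T m) `<=` hull3 (T n).
  elim: m => [|m IH]; first by rewrite leqn0 => /eqP ->.
  rewrite leq_eqVlt => /predU1P[->//|]; rewrite ltnS => /IH hm.
  by have [_ h2 _ _] := hT m; have [k1 _ _] := hnx _ h2; exact: subset_trans k1 hm.
have vT n : hull3 (T n) (T n).1.1 by have [] := hull_vert (T n).1.1 (T n).1.2 (T n).2.
have dT n w : hull3 (T n) w -> mc (w - (T n).1.1) <= per (T n).
  by move=> /hull_dist; case: (T n) => [[]].
have per0 : 0 <= per (a, b, c) by rewrite /per !addr_ge0 // mc_ge0.
have [n|p hp] := @bounded_cluster R (fun n => (T n).1.1) (mc a + per (a, b, c)).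
  have [h1 _ _ _] := hT n; have := hull_dist (h1 _ (vT n)).
  by have := mc_dist (T n).1.1 a; rewrite /=; lra.
have pT n : mc ((T n).1.1 - p) <= per (T n).
  apply/ler_addgt0Pr => e e0; have [m nm hm] := hp e n e0.
  have := dT n _ (hnest _ _ nm _ (vT m)).
  by have := mc_tri (T n).1.1 (T m).1.1 p; rewrite (mc_distC (T n).1.1 (T m).1.1); lra.
have ph : hull a b c p.
  apply: hull_closed => e e0; have [m _ hm] := hp e 0%N e0.
  by exists (T m).1.1 => //; have [h1 _ _ _] := hT m; exact: h1.
have [d hd] := hf _ ph.
apply/eqP; rewrite -mc_eq0 eq_le mc_ge0 andbT; apply/ler_addgt0Pl => e e0; rewrite addr0.
(* The factor 4^n cancels against two perimeters of order 2^-n, which leaves e * 2 per^2 / K <=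
   e. *)
set K := 2 * per (a, b, c) ^+ 2 + 1.
have K0 : 0 < K by rewrite ltr_wpDl // mulr_ge0 // sqr_ge0.
have [r r0 hr] := cder_eps hd (divr_gt0 e0 K0).
have [n hn] : exists n, 2 * per (T n) < r.
  have h2 : `|2^-1 : R| < 1 by rewrite gtr0_norm ?invf_lt1; lra.
  have /cvgrPdist_lt /(_ (r / (2 * per (a, b, c) + 1))) := cvg_expr h2.
  case; first by rewrite divr_gt0 //; lra.
  move=> n _ /(_ n (leqnn n)) /=; rewrite sub0r normrN ger0_norm ?exprn_ge0 ?invr_ge0 //.
  move=> hn; exists n; have [_ _ -> _] := hT n; rewrite -exprVn.
  move: hn; rewrite ltr_pdivlMr; last by lra.
  have := exprn_ge0 n (_ : 0 <= 2^-1 :> R); rewrite invr_ge0 => /(_ (ler0n _ _)).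
  by move: (2^-1 ^+ n) => q; nra.
have [h1 h2 h3 h4] := hT n.
(* The linear part of f at p has the primitive Q, whose increments around a closed triangle add up
   to 0; only the error e / K * |w - p| is left. *)
pose q w := f p + d * (w - p).
pose Q w := f p * w + d * ((w - p) * (w - p)) / 2.
have hQ w : cder setT Q w (q w).
  have dp : cder setT (fun w => w - p) w (1 - 0) by apply: cderB; [exact: cder_id|exact: cder_cst].
  have := cderD (cderM (cder_cst setT (f p) w) (cder_id setT w))
    (cderM (cderM (cder_cst setT d w) (cderM dp dp)) (cder_cst setT 2^-1 w)).
  by move=> /cder_eq; apply; rewrite /q; field.
have key u v : hull3 (T n) u -> hull3 (T n) v ->
    mc (segint f u v - (Q v - Q u)) <= e / K * (2 * per (T n)) * mc (v - u).
  move=> hu hv; apply: (@segint_approx f q); first exact: hull_cont hu hv.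
    by move=> t _; exact: hQ.
  move=> t t01; set w := u + _.
  have hw : hull3 (T n) w by exact: hull_conv.
  have wp : mc (w - p) <= 2 * per (T n).
    by have := dT _ _ hw; have := pT n; have := mc_tri w (T n).1.1 p; lra.
  have := hr w I (le_lt_trans wp hn); rewrite /q opprD addrA => /le_trans; apply.
  by rewrite ler_wpM2l // ltW // divr_gt0.
have [va vb vc] := hull_vert (T n).1.1 (T n).1.2 (T n).2.
have k1 := key _ _ va vb; have k2 := key _ _ vb vc; have k3 := key _ _ vc va.
have ht : mc (tri f (T n)) <= e / K * (2 * per (T n)) * per (T n).
  move: k1 k2 k3; move: (e / K * (2 * per (T n))) => kp k1 k2 k3; rewrite /per !mulrDr.
  have -> : tri f (T n) = (segint f (T n).1.1 (T n).1.2 - (Q (T n).1.2 - Q (T n).1.1)) +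
    (segint f (T n).1.2 (T n).2 - (Q (T n).2 - Q (T n).1.2)) +
    (segint f (T n).2 (T n).1.1 - (Q (T n).1.1 - Q (T n).2)) by rewrite /tri; ring.
  apply: le_trans (mcD _ _) _; apply: lerD; last exact: k3.
  by apply: le_trans (mcD _ _) _; apply: lerD; [exact: k1|exact: k2].
apply: le_trans h4 _.
apply: (@le_trans _ _ (4 ^+ n * (e / K * (2 * per (T n)) * per (T n)))).
  by rewrite ler_wpM2l // exprn_ge0.
rewrite h3; have -> : (4 : R) = 2 * 2 by rewrite -natrM.
rewrite exprMn.
have n0 : (2 : R) ^+ n != 0 by rewrite expf_neq0.
have -> : 2 ^+ n * 2 ^+ n * (e / K * (2 * (per (a, b, c) / 2 ^+ n)) * (per (a, b, c) / 2 ^+ n)) =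
  e * ((2 * per (a, b, c) ^+ 2) / K) by field; rewrite n0 lt0r_neq0.
rewrite ler_piMr ?(ltW e0) // ler_pdivrMr // mul1r /K; lra.
Qed.

End Goursat.

Section StarPrimitive.
Variable R : realType.
Local Notation C := R[i].
Implicit Types (S U : set C) (f g F G : C -> C) (a b c z w d p : C).

Definition copen U := forall z, U z -> exists2 r : R, 0 < r & forall w, mc (w - z) < r -> U w.
Definition cstar U p := U p /\
  forall z (t : R), U z -> 0 <= t <= 1 -> U (p + t%:C * (z - p)).

Lemma convex_le (h x y m : R) : 0 <= h <= 1 -> x <= m -> y <= m ->
  (1 - h) * x + h * y <= m.
Proof.
move=> /andP[h0 h1] xm ym.
have := ler_wpM2l h0 ym; have : (1 - h) * x <= (1 - h) * m by rewrite ler_wpM2l // subr_ge0.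
lra.
Qed.

Lemma convex_ge0 (h x y : R) : 0 <= h <= 1 -> 0 <= x -> 0 <= y ->
  0 <= (1 - h) * x + h * y.
Proof. by move=> /andP[h0 h1] x0 y0; rewrite addr_ge0 // mulr_ge0 // subr_ge0. Qed.

(* The centre p of the star may be an exceptional point of g: a triangle with
   vertex p is cut at distance O(eta) from p, and the cut-off part contributes
   O(eta). *)
Lemma star_primitive U p g : copen U -> cstar U p ->
  (forall z, U z -> ccont setT g z) -> (forall z, U z -> z != p -> holo g z) ->
  exists F, forall z, U z -> cder setT F z (g z).
Proof.
move=> oU [Up sU] gc gh; exists (segint g p).
have sc z : U z -> segcont g p z by move=> Uz t t01; apply: gc; exact: sU.
have fp : segint g p p = 0.
  apply/eqP; rewrite -mc_eq0 eq_le mc_ge0 andbT.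
  have := @segint_le _ g p p (mc (g p)) (sc _ Up); rewrite subrr mc0 mulr0; apply.
  by move=> t _; rewrite mulr0 addr0.
suff key z : U z -> exists2 r : R, 0 < r & forall w, mc (w - z) < r ->
    segcont g z w /\ segint g p w - segint g p z = segint g z w.
  move=> z Uz; apply: eps_cder => e e0.
  have [r r0 hr] := key z Uz; have [s s0 hs] := gc z Uz e e0.
  exists (Num.min r s); first by rewrite lt_min r0.
  move=> w _; rewrite lt_min => /andP[wr ws]; have [cw ->] := hr w wr.
  have := @segint_approx _ g (fun=> g z) (fun w => g z * w) z w e cw.
  rewrite -mulrBr; apply => t t01.
    by have := cderM (cder_cst setT (g z) (z + t%:C * (w - z))) (cder_id setT (z + t%:C * (w - z)));
       rewrite mul0r add0r mulr1.
  apply/ltW/hs => //; rewrite addrAC subrr add0r mcM mcR ger0_norm; last by case/andP: t01.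
  by case/andP: t01 => ? ?; apply: le_lt_trans ws; rewrite ler_piMl // mc_ge0.
move=> Uz; have [r r0 hr] := oU z Uz.
have [zp|zp] := eqVneq z p.
  by exists r => // w /hr Uw; rewrite zp fp subr0; split => //; exact: sc.
have zp0 : 0 < mc (z - p) by rewrite mc_gt0 subr_eq0.
(* The second bound keeps p off the segment from z to w. *)
exists (Num.min r (mc (z - p))); first by rewrite lt_min r0.
move=> w; rewrite lt_min => /andP[wr wzp].
(* Coordinates on the triangle p, z, w: the points with 0 < s + t <= 1 lie in U and differ from p,
   so that [goursat] applies to triangles made of them. *)
pose P (s t : R) : C := p + s%:C * (z - p) + t%:C * (w - p).
have P00 : P 0 0 = p by rewrite /P; ring.
have P10 : P 1 0 = z by rewrite /P; ring.
have P01 : P 0 1 = w by rewrite /P; ring.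
have UP s t : 0 <= s -> 0 <= t -> s + t <= 1 -> U (P s t) /\ (0 < s + t -> P s t != p).
  move=> s0 t0 st1; have [st0|st0] := eqVneq (s + t) 0.
    have -> : s = 0 by lra.
    have -> : t = 0 by lra.
    by rewrite P00; split=> //; rewrite addr0 ltxx.
  have stp : 0 < s + t by rewrite lt_def st0 addr_ge0.
  set u := z + (t / (s + t))%:C * (w - z).
  have uE : P s t = p + (s + t)%:C * (u - p).
    have stC : s%:C + t%:C != 0 :> C by rewrite -rmorphD -mc_eq0 mcR normr_eq0.
    rewrite /u; have -> : (t / (s + t))%:C = t%:C / (s%:C + t%:C) :> C.
      by rewrite -rmorphD rmorphM /= fmorphV.
    by rewrite /P rmorphD; field.
  have uz : mc (u - z) <= mc (w - z).
    rewrite /u addrAC subrr add0r mcM mcR ger0_norm ?divr_ge0 ?(ltW stp) //.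
    by rewrite ler_piMl ?mc_ge0 // ler_pdivrMr // mul1r lerDr.
  split; first by rewrite uE; apply: sU; [apply/hr; lra|lra].
  move=> _; rewrite uE -subr_eq0 addrAC subrr add0r mulf_neq0 //.
    by rewrite -mc_eq0 mcR normr_eq0.
  rewrite -mc_eq0; apply/eqP => up0.
  by have := mc_tri z u p; rewrite (mc_distC z u) up0; lra.
have PC s t s' t' : 0 <= s -> 0 <= t -> s + t <= 1 -> 0 <= s' -> 0 <= t' -> s' + t' <= 1 ->
    segcont g (P s t) (P s' t').
  move=> s0 t0 st s0' t0' st' h h01.
  have -> : P s t + h%:C * (P s' t' - P s t) =
     P ((1 - h) * s + h * s') ((1 - h) * t + h * t').
    by rewrite /P; ring.
  apply: gc; have [|||//] := UP ((1 - h) * s + h * s') ((1 - h) * t + h * t').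
  - exact: convex_ge0.
  - exact: convex_ge0.
  - have := convex_le h01 st st'; lra.
have PT s t s' t' s'' t'' : 0 <= s -> 0 <= t -> 0 < s + t <= 1 -> 0 <= s' -> 0 <= t' ->
    0 < s' + t' <= 1 -> 0 <= s'' -> 0 <= t'' -> 0 < s'' + t'' <= 1 ->
    tri g (P s t, P s' t', P s'' t'') = 0.
  move=> s0 t0 /andP[st0 st1] s0' t0' /andP[st0' st1'] s0'' t0'' /andP[st0'' st1''].
  apply: goursat => _ [x [y [v [x0 y0 v0 xyv ->]]]].
  have -> : x%:C * P s t + y%:C * P s' t' + v%:C * P s'' t'' =
    P (x * s + y * s' + v * s'') (x * t + y * t' + v * t'').
    have -> : x = 1 - y - v by lra.
    by rewrite /P; ring.
  have [A0 B0] : 0 <= x * s + y * s' + v * s'' /\ 0 <= x * t + y * t' + v * t''.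
    by split; rewrite !addr_ge0 // mulr_ge0.
  have sumE : x * s + y * s' + v * s'' + (x * t + y * t' + v * t'') =
    x * (s + t) + y * (s' + t') + v * (s'' + t'') by ring.
  have le1 : x * s + y * s' + v * s'' + (x * t + y * t' + v * t'') <= 1.
    by rewrite sumE -xyv !lerD // ler_piMr.
  have [UU nU] := UP _ _ A0 B0 le1.
  apply: gh => //; apply: nU; rewrite sumE.
  have [x00|x00] := eqVneq x 0; last first.
    have : 0 < x by rewrite lt_def x00.
    by move=> xp; rewrite !ltr_wpDr ?mulr_ge0 ?mulr_gt0 // ltW.
  have [y00|y00] := eqVneq y 0; last first.
    have yp : 0 < y by rewrite lt_def y00.
    by rewrite x00 mul0r add0r ltr_wpDr ?mulr_ge0 ?mulr_gt0 // ltW.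
  have -> : v = 1 by lra.
  by rewrite x00 y00 !mul0r !add0r mul1r.
split.
  by rewrite -P10 -P01; apply: PC; lra.
apply/eqP; rewrite -subr_eq0 -mc_eq0 eq_le mc_ge0 andbT.
apply/ler_addgt0Pl => e e0; rewrite addr0.
have [rho rho0 hrho] := ccont_bnd (gc p Up).
set M := mc (g p) + 1 in hrho.
have M0 : 0 < M by rewrite /M; have := mc_ge0 (g p); lra.
set L := mc (z - p) + mc (w - p); have L0 : 0 < L.
  by rewrite /L; have := mc_ge0 (w - p); lra.
(* The second entry keeps the cut-off corner in the disc where |g| <= M; the third makes its three
   sides, of total length at most 2 eta L, contribute at most e. *)
pose eta := Num.min 1 (Num.min (rho / (2 * L)) (e / (2 * M * L))).
have eta0 : 0 < eta by rewrite !lt_min ltr01 !divr_gt0 // !mulr_gt0.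
have eta1 : eta <= 1 by rewrite ge_min lexx.
have etar : eta * L < rho.
  have : eta <= rho / (2 * L) by rewrite !ge_min lexx orbT.
  by rewrite ler_pdivlMr ?mulr_gt0 //; lra.
have etae : 2 * M * eta * L <= e.
  have : eta <= e / (2 * M * L) by rewrite !ge_min lexx !orbT.
  by rewrite ler_pdivlMr ?mulr_gt0 //; lra.
have T1 := PT eta 0 1 0 0 1; have T2 := PT eta 0 0 1 0 eta.
rewrite /tri /= in T1 T2.
have {}T1 := T1 (ltW eta0) (lexx _) _ ler01 (lexx _) _ (lexx _) ler01 _.
have {}T2 := T2 (ltW eta0) (lexx _) _ (lexx _) ler01 _ (lexx _) (ltW eta0) _.
rewrite !add0r !addr0 eta0 eta1 ltr01 lexx in T1 T2.
move: (T1 isT isT isT) (T2 isT isT isT) => {T1 T2} T1 T2.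
have eta01 : 0 <= eta <= 1 by rewrite ltW.
have S1 : segint g p z = segint g p (P eta 0) + segint g (P eta 0) z.
  rewrite (segint_split eta01 (sc _ Uz)).
  by have -> : p + eta%:C * (z - p) = P eta 0 by rewrite /P; ring.
have Uw : U w by apply: hr.
have S2 : segint g p w = segint g p (P 0 eta) + segint g (P 0 eta) w.
  rewrite (segint_split eta01 (sc _ Uw)).
  by have -> : p + eta%:C * (w - p) = P 0 eta by rewrite /P; ring.
have c1 : segcont g (P 0 1) (P eta 0) by apply: PC; rewrite ?addr0 ?add0r // ltW.
have c2 : segcont g (P 0 1) (P 0 eta) by apply: PC; rewrite ?addr0 ?add0r // ltW.
rewrite (segint_rev (segcont_rev c1)) in T1.
rewrite (segint_rev (segcont_rev c2)) in T2.
rewrite P10 P01 in T1 T2.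
have -> : segint g p w - segint g p z - segint g z w =
   segint g p (P 0 eta) - segint g p (P eta 0) + segint g (P 0 eta) (P eta 0).
  have -> : segint g z w = - segint g (P eta 0) z + segint g (P eta 0) w.
    by apply/eqP; rewrite -subr_eq0 -T1; apply/eqP; ring.
  have -> : segint g (P 0 eta) (P eta 0) = - segint g (P eta 0) w + segint g (P 0 eta) w.
    by apply/eqP; rewrite -subr_eq0 -T2; apply/eqP; ring.
  by rewrite S1 S2; ring.
have bnd s t s' t' : 0 <= s -> 0 <= t -> s + t <= eta -> 0 <= s' -> 0 <= t' -> s' + t' <= eta ->
    mc (segint g (P s t) (P s' t')) <= M * mc (P s' t' - P s t).
  move=> s0 t0 st s0' t0' st'; apply: segint_le.
    by apply: PC => //; [exact: le_trans st eta1|exact: le_trans st' eta1].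
  move=> h h01.
  have -> : P s t + h%:C * (P s' t' - P s t) =
     P ((1 - h) * s + h * s') ((1 - h) * t + h * t').
    by rewrite /P; ring.
  apply/ltW/hrho => //; apply: le_lt_trans etar.
  set A := (1 - h) * s + _; set B := (1 - h) * t + _.
  have A0 : 0 <= A by exact: convex_ge0.
  have B0 : 0 <= B by exact: convex_ge0.
  have AB : A + B <= eta.
    by have := convex_le h01 st st'; rewrite /A /B; clear; lra.
  have -> : P A B - p = A%:C * (z - p) + B%:C * (w - p) by rewrite /P; ring.
  apply: le_trans (mcD _ _) _; rewrite !mcM !mcR !ger0_norm // /L.
  have := mc_ge0 (w - p); nra.
apply: le_trans (mcD _ _) _.
have k4 := mcB (segint g p (P 0 eta)) (segint g p (P eta 0)).
have k1 : mc (segint g (P 0 eta) (P eta 0)) <= M * mc (P eta 0 - P 0 eta).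
  by apply: bnd; rewrite ?addr0 ?add0r // ltW.
have k2 : mc (segint g (P 0 0) (P eta 0)) <= M * mc (P eta 0 - P 0 0).
  by apply: bnd; rewrite ?addr0 ?add0r // ltW.
have k3 : mc (segint g (P 0 0) (P 0 eta)) <= M * mc (P 0 eta - P 0 0).
  by apply: bnd; rewrite ?addr0 ?add0r // ltW.
move: k1 k2 k3; rewrite P00.
have -> : P 0 eta - p = eta%:C * (w - p) by rewrite /P; ring.
have -> : P eta 0 - p = eta%:C * (z - p) by rewrite /P; ring.
have -> : P eta 0 - P 0 eta = eta%:C * ((z - p) - (w - p)) by rewrite /P; ring.
rewrite !mcM !mcR gtr0_norm // => k1 k2 k3.
have := mcB (z - p) (w - p) => k5.
have k6 : M * (eta * mc (z - p - (w - p))) <= M * (eta * L).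
  by rewrite !ler_pM2l.
apply: le_trans etae; rewrite /L in k6 *.
move: k1 k2 k3 k4 k6; move: (mc (z - p - _)) (mc (z - p)) (mc (w - p)) => x y t.
clear; lra.
Qed.

End StarPrimitive.

(** * Exponential and maximum principle *)

Section ComplexExp.
Variable R : realType.
Local Notation C := R[i].
Implicit Types (z w : C).

Definition cexp z : C := (expR (complex.Re z))%:C * (cos (complex.Im z) +i* sin (complex.Im z)).

Lemma cexpD z w : cexp (z + w) = cexp z * cexp w.
Proof.
rewrite /cexp !cE expRD sinD cosD; apply: complex_ext; rewrite !cE /=; ring.
Qed.
Lemma cexp0 : cexp 0 = 1.
Proof. by rewrite /cexp /= expR0 cos0 sin0 mul1r. Qed.
Lemma mc_cexp z : mc (cexp z) = expR (complex.Re z).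
Proof.
rewrite /cexp mcM mcR gtr0_norm ?expR_gt0 //.
by rewrite mcE /= cos2Dsin2 sqrtr1 mulr1.
Qed.
Lemma cexp_iR (t : R) : cexp ('i%C * t%:C) = cos t +i* sin t.
Proof.
rewrite /cexp (_ : 'i%C * t%:C = 0 +i* t) ?expR0 ?mul1r //.
by apply: complex_ext; rewrite !cE /=; ring.
Qed.
Lemma cexp_neq0 z : cexp z != 0.
Proof. by rewrite -mc_gt0 mc_cexp expR_gt0. Qed.
Lemma cexpN z : cexp (- z) = (cexp z)^-1.
Proof.
by apply: (mulfI (cexp_neq0 z)); rewrite -cexpD subrr cexp0 mulfV ?cexp_neq0.
Qed.

Lemma cder_cexp0 : cder setT cexp 0 1.
Proof.
(* The constant 9 is the sum 1 + 3 + 3 + 2 of the coefficients in [t1] and [t2]. *)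
apply: eps_cder => e e0; have [d [d0 d1 de]] : exists d : R, [/\ 0 < d, d <= 1 & 9 * d <= e].
  exists (Num.min 1 (e / 9)); split; first by rewrite lt_min ltr01 divr_gt0.
    by rewrite ge_min lexx.
  have : Num.min 1 (e / 9) <= e / 9 by rewrite ge_min lexx orbT.
  by rewrite ler_pdivlMr //; lra.
have [r1 r10 h1] := (@is_deriveP R expR 0 _).2 (is_derive_expR 0) _ d0.
have [r2 r20 h2] := (@is_deriveP R cos 0 _).2 (is_derive_cos 0) _ d0.
have [r3 r30 h3] := (@is_deriveP R sin 0 _).2 (is_derive_sin 0) _ d0.
exists (Num.min d (Num.min r1 (Num.min r2 r3))); first by rewrite !lt_min d0 r10 r20.
move=> w _; rewrite subr0 !lt_min => /and4P[wd w1 w2 w3].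
have xw := mc_re w; have yw := mc_im w; set x := complex.Re w in xw *; set y := complex.Im w in yw *.
have := h1 x; have := h2 y; have := h3 y.
rewrite !subr0 expR0 cos0 sin0 oppr0 mul0r !subr0 !mul1r cexp0.
move=> /(_ (le_lt_trans yw w3)) k3 /(_ (le_lt_trans yw w2)) k2 /(_ (le_lt_trans xw w1)) k1.
apply: le_trans (mc_le _) _; rewrite /cexp !cE /= -/x -/y !mul0r ?mul1r !subr0 ?addr0.
set X := expR x in k1 *; set c := cos y in k2 *; set s := sin y in k3 *.
rewrite addr0 in k3.
clearbody X c s x y; clear -d0 d1 de xw yw wd k1 k2 k3.
have X3 : `|X| <= 3.
  have := ler_normD (X - 1 - x) (1 + x); have := ler_normD 1 x; rewrite normr1.
  have -> : X - 1 - x + (1 + x) = X by ring.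
  have : d * `|x| <= 1 * 1 by rewrite ler_pM ?normr_ge0 //; lra.
  lra.
have X1 : `|X - 1| <= 2 * `|x|.
  have := ler_normD (X - 1 - x) x; rewrite subrK.
  have : d * `|x| <= 1 * `|x| by rewrite ler_wpM2r ?normr_ge0.
  lra.
have t1 : `|X * c - 1 - x| <= d * `|x| + 3 * (d * `|y|).
  have -> : X * c - 1 - x = (X - 1 - x) + X * (c - 1) by ring.
  apply: le_trans (ler_normD _ _) _; apply: lerD => //; rewrite normrM.
  by apply: ler_pM; rewrite ?normr_ge0.
have t2 : `|X * s - y| <= 3 * (d * `|y|) + 2 * (d * `|x|).
  have -> : X * s - y = X * (s - y) + (X - 1) * y by ring.
  apply: le_trans (ler_normD _ _) _; rewrite !normrM; apply: lerD.
    by apply: ler_pM; rewrite ?normr_ge0.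
  apply: (@le_trans _ _ (2 * `|x| * d)); last by rewrite -mulrA (mulrC `|x|).
  by apply: ler_pM; rewrite ?normr_ge0 ?mulr_ge0 //; lra.
apply: (@le_trans _ _ (9 * d * mc w)); last by rewrite ler_wpM2r ?mc_ge0.
have dx : d * `|x| <= d * mc w by rewrite ler_pM2l.
have dy : d * `|y| <= d * mc w by rewrite ler_pM2l.
by move: t1 t2; rewrite ?mulr0 ?oppr0 ?addr0 ?add0r; lra.
Qed.

Lemma cder_cexp z : cder setT cexp z (cexp z).
Proof.
have h0 : cder setT (fun w => w - z) z (1 - 0) by apply: cderB; [exact: cder_id|exact: cder_cst].
have h1 : cder setT cexp (z - z) 1 by rewrite subrr; exact: cder_cexp0.
have := cderM (cder_cst setT (cexp z) z) (@cder_comp _ _ setT _ _ _ _ _ (fun _ _ => I) h0 h1).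
rewrite mul0r add0r subr0 mulr1 mulr1; apply: cder_ext => // w _.
by rewrite -cexpD addrC subrK.
Qed.

End ComplexExp.

Section MaximumPrinciple.
Variable R : realType.
Local Notation C := R[i].
Implicit Types (f g : C -> C) (z w p a : C) (r M : R) (K : set C).

Lemma holo_cst c z : holo (fun=> c : C) z. Proof. by exists 0; exact: cder_cst. Qed.
Lemma holo_id z : holo (id : C -> C) z. Proof. by exists 1; exact: cder_id. Qed.
Lemma holoD f g z : holo f z -> holo g z -> holo (fun w => f w + g w) z.
Proof. by move=> [a ha] [b hb]; exists (a + b); exact: cderD. Qed.
Lemma holoB f g z : holo f z -> holo g z -> holo (fun w => f w - g w) z.
Proof. by move=> [a ha] [b hb]; exists (a - b); exact: cderB. Qed.
Lemma holoM f g z : holo f z -> holo g z -> holo (fun w => f w * g w) z.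
Proof. by move=> [a ha] [b hb]; eexists; exact: cderM ha hb. Qed.
Lemma holoV f z : f z != 0 -> holo f z -> holo (fun w => (f w)^-1) z.
Proof. by move=> fz [a ha]; eexists; exact: cderV1 fz ha. Qed.
Lemma holo_div f g z : g z != 0 -> holo f z -> holo g z -> holo (fun w => f w / g w) z.
Proof. by move=> gz hf hg; apply: holoM => //; exact: holoV. Qed.
Lemma holo_comp f g z : holo g z -> holo f (g z) -> holo (fun w => f (g w)) z.
Proof. by move=> [a ha] [b hb]; exists (b * a); exact: (@cder_comp _ _ setT). Qed.
Lemma holoX f z n : holo f z -> holo (fun w => f w ^+ n) z.
Proof.
move=> hf; elim: n => [|n IH]; first exact: holo_cst.
have [d hd] := holoM hf IH; exists d.
by apply: cder_ext hd => // w _; rewrite exprS.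
Qed.
Lemma holo_cexp z : holo (@cexp R) z.
Proof. by exists (cexp z); exact: cder_cexp. Qed.
Lemma holo_near f g z r : 0 < r -> (forall w, mc (w - z) < r -> f w = g w) ->
  holo f z -> holo g z.
Proof.
move=> r0 fg [d hd]; exists d; apply: cder_near hd; first by exists r => // w _; exact: fg.
by apply: fg; rewrite subrr mc0.
Qed.
Lemma holo_prod (I : Type) (s : seq I) (F : I -> C -> C) z :
  (forall i, holo (F i) z) -> holo (fun w => \prod_(i <- s) F i w) z.
Proof.
move=> hF; elim: s => [|i s [d IH]].
  by apply: (@holo_near (fun=> 1) _ _ 1) => //; [move=> w _; rewrite big_nil|exact: holo_cst].
have [e he] := holoM (hF i) (ex_intro _ d IH).
by exists e; apply: cder_ext he => // w _; rewrite big_cons.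
Qed.
Lemma holo_sum (I : Type) (s : seq I) (F : I -> C -> C) z :
  (forall i, holo (F i) z) -> holo (fun w => \sum_(i <- s) F i w) z.
Proof.
move=> hF; elim: s => [|i s [d IH]].
  by apply: (@holo_near (fun=> 0) _ _ 1) => //; [move=> w _; rewrite big_nil|exact: holo_cst].
have [e he] := holoD (hF i) (ex_intro _ d IH).
by exists e; apply: cder_ext he => // w _; rewrite big_cons.
Qed.

Lemma copen_ball a r : copen [set w | mc (w - a) < r].
Proof.
move=> z /= zr; exists (r - mc (z - a)); first by rewrite subr_gt0.
by move=> w wz; have := mc_tri w z a; lra.
Qed.
Lemma cstar_ball a r : 0 < r -> cstar [set w | mc (w - a) < r] a.
Proof.
move=> r0; split; first by rewrite /= subrr mc0.
move=> z t /= zr /andP[t0 t1]; rewrite addrAC subrr add0r mcM mcR ger0_norm //.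
by apply: le_lt_trans zr; rewrite ler_piMl ?mc_ge0.
Qed.

(* Apply Rolle's theorem on the circle to the primitive of
   (g z - g a) / (z - a). *)
Lemma mean_value g a r r' : 0 < r -> r < r' ->
  (forall w, mc (w - a) < r' -> holo g w) ->
  exists2 w, mc (w - a) = r & complex.Re (g w) = complex.Re (g a).
Proof.
move=> r0 rr hg; have r'0 : 0 < r' by lra.
have [|d [q [cq qa qE]]] := hg a; first by rewrite subrr mc0.
have qh z : z != a -> holo g z -> holo q z.
  move=> za hz; have za0 : 0 < mc (z - a) by rewrite mc_gt0 subr_eq0.
  apply: (@holo_near (fun w => (g w - g a) / (w - a)) _ _ _ za0).
    move=> w wz; rewrite qE //; apply: mulfK; rewrite -mc_eq0; apply/eqP => wa.
    by have := mc_tri z w a; rewrite wa (mc_distC z w); lra.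
  apply: holo_div; first by rewrite subr_eq0.
    by apply: holoB => //; exact: holo_cst.
  by apply: holoB; [exact: holo_id|exact: holo_cst].
(* So far q is only known to be continuous at a; this is the exceptional centre that
   [star_primitive] tolerates. *)
have [||||G hG] := @star_primitive R [set w | mc (w - a) < r'] a q.
- exact: copen_ball.
- exact: cstar_ball.
- move=> z zr; case: (eqVneq z a) => [->//|za]; exact/holo_cont/qh/hg.
- by move=> z zr za; exact/qh/hg.
pose Ga (t : C) := a + r%:C * cexp ('i%C * t).
have GaR (t : R) : mc (Ga t%:C - a) = r.
  by rewrite /Ga addrAC subrr add0r mcM mcR gtr0_norm // mc_cexp !cE /= mul0r mulr0 subrr expR0 mulr1.
have dGa t : cder setT Ga t (r%:C * (cexp ('i%C * t) * 'i%C)).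
  have h1 := cderM (cder_cst setT 'i%C t) (cder_id setT t).
  have h2 := @cder_comp _ _ setT _ _ _ _ _ (fun _ _ => I) h1 (cder_cexp _).
  have h3 := cderD (cder_cst setT a t) (cderM (cder_cst setT r%:C t) h2).
  by apply: cder_eq h3 _; rewrite /=; ring.
(* The factor - i cancels the i from differentiating the circle, and q z (z - a) = g z - g a, whence
   f' = g o Ga - g a. Periodicity of [Ga] provides the equal end values for Rolle's theorem. *)
pose f t := - 'i%C * G (Ga t).
have df (t : R) : cder setT f t%:C (g (Ga t%:C) - g a).
  have GU : mc (Ga t%:C - a) < r' by rewrite GaR.
  have h1 := @cder_comp _ _ setT _ _ _ _ _ (fun _ _ => I) (dGa t%:C) (hG _ GU).
  have := cderM (cder_cst setT (- 'i%C) t%:C) h1; move=> /cder_eq; apply.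
  rewrite qE // {3}/Ga mul0r add0r addrAC subrr add0r.
  have ii : 'i%C * 'i%C = -1 :> C by rewrite -expr2 sqr_i.
  rewrite (_ : - 'i%C * _ = - ('i%C * 'i%C) * (q (Ga t%:C) * (r%:C * cexp ('i%C * t%:C)))); last ring.
  by rewrite ii opprK mul1r.
have pi0 : 0 < 2 * pi :> R by rewrite mulr_gt0 // pi_gt0.
have dre (t : R) : t \in `]0, (2 * pi)[%R ->
    is_derive t 1 (fun s : R => complex.Re (f s%:C)) (complex.Re (g (Ga t%:C) - g a)).
  rewrite in_itv /= => tt; apply: (is_derive_re tt).
  by apply: cder_sub (df t).
have [|||t tt ht] := @Rolle R (fun s : R => complex.Re (f s%:C)) 0 (2 * pi) pi0.
- by move=> t tt; have := dre t tt => ?; exact: ex_derive.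
- apply: re_within_continuous => t tt; apply: ccont_sub (cder_cont (df t)) => //.
- rewrite /f /Ga !mulr0 cexp0; congr (complex.Re (_ * G (_ + _ * _))).
  by rewrite cexp_iR mulr_natl cos2pi sin2pi.
exists (Ga t%:C) => //; have := dre t tt => hd.
have := @derive_val _ _ _ _ _ _ _ hd; rewrite (@derive_val _ _ _ _ _ _ _ ht) reB => /esym/eqP.
by rewrite subr_eq0 => /eqP.
Qed.

Definition cclosed K := forall p, (forall e : R, 0 < e -> exists2 w, K w & mc (w - p) < e) -> K p.
Definition cbounded K := exists B : R, forall w, K w -> mc w <= B.
(** Continuity would be too strong: the auxiliary factor in [phragmen_lindelof] is discontinuous at
    boundary points, where the modulus of the product is still upper semicontinuous. *)
Definition usc_on K (u : C -> R) := forall z, K z -> forall e : R, 0 < e ->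
  near_in K z (fun w => u w < u z + e).

Lemma usc_max K (u : C -> R) z1 : K z1 -> cclosed K -> cbounded K -> usc_on K u ->
  exists2 z0, K z0 & forall w, K w -> u w <= u z0.
Proof.
move=> Kz1 cK [B KB] uK.
have cluster (W : nat -> C) : (forall n, K (W n)) ->
    exists2 p, K p & forall e N, 0 < e -> exists2 n, (N <= n)%N & u (W n) < u p + e.
  move=> KW; have [n|p hp] := @bounded_cluster R W B; first exact: KB.
  have Kp : K p.
    by apply: cK => e e0; have [n _ hn] := hp e 0%N e0; exists (W n).
  exists p => // e N e0; have [r r0 hr] := uK p Kp e e0.
  by have [n Nn hn] := hp r N r0; exists n => //; apply: hr.
have [[B' uB]|nB] := pselect (exists B', forall w, K w -> u w <= B'); last first.
  have /choice[W hW] : forall n : nat, exists w, K w /\ n%:R < u w.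
    move=> n; apply: contrapT => nh; apply: nB; exists n%:R => w Kw.
    by rewrite leNgt; apply/negP => h; apply: nh; exists w.
  have [p Kp hp] := cluster W (fun n => (hW n).1).
  have [n Nn hn] := hp 1 (Num.truncn (u p + 1)).+1 ltr01.
  have := (hW n).2; have : (Num.truncn (u p + 1)).+1%:R <= n%:R :> R by rewrite ler_nat.
  by have := truncnS_gt (u p + 1); lra.
pose A := [set u w | w in K].
have sA : has_sup A by split; [exists (u z1); exists z1|exists B' => _ [w Kw <-]; exact: uB].
have /choice[W hW] : forall n : nat, exists w, K w /\ sup A - n.+1%:R^-1 < u w.
  move=> n; have [|_ [w Kw <-] h] := sup_adherent (_ : 0 < n.+1%:R^-1) sA.
    by rewrite invr_gt0.
  by exists w.
have [p Kp hp] := cluster W (fun n => (hW n).1).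
exists p => // w Kw; have le1 : u w <= sup A by apply: sup_upper_bound => //; exists w.
apply: le_trans le1 _; apply/ler_addgt0Pr => e e0.
have e20 : 0 < e / 2 by rewrite divr_gt0.
have [n Nn hn] := hp (e / 2) (Num.truncn (e / 2)^-1) e20.
have h1 : n.+1%:R^-1 < e / 2.
  rewrite invf_plt ?posrE //.
  by apply: lt_le_trans (truncnS_gt _) _; rewrite ler_nat.
have := (hW n).2; move: h1; move: (n.+1%:R^-1) => y; lra.
Qed.

Lemma usc_mc K f : (forall z, K z -> ccont K f z) -> usc_on K (fun z => mc (f z)).
Proof.
move=> cf z Kz e e0; apply: near_in_imp (cf z Kz e e0) => w _.
by have := mc_dist (f w) (f z); lra.
Qed.

Lemma cclosed_disc a r : cclosed [set w | mc (w - a) <= r].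
Proof.
move=> p hp /=; apply/ler_addgt0Pr => e e0; have [w /= wr wp] := hp e e0.
by have := mc_tri p w a; rewrite (mc_distC p w); lra.
Qed.
Lemma cbounded_disc a r : cbounded [set w | mc (w - a) <= r].
Proof. by exists (mc a + r) => w /= wr; have := mc_dist w a; lra. Qed.

Lemma disc_bound f a r : 0 <= r -> (forall w, mc (w - a) <= r -> ccont setT f w) ->
  exists2 N, 0 < N & forall w, mc (w - a) <= r -> mc (f w) <= N.
Proof.
move=> r0 cf; have [||||z0 _ h] := @usc_max [set w | mc (w - a) <= r] (fun z => mc (f z)) a.
- by rewrite /= subrr mc0.
- exact: cclosed_disc.
- exact: cbounded_disc.
- by apply: usc_mc => z zr; apply: ccont_sub (cf z zr).
exists (mc (f z0) + 1); first by have := mc_ge0 (f z0); lra.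
by move=> w /h; lra.
Qed.

(* A maximum of |f|^2 + eps |z|^2 cannot be attained at an interior point, by
   mean_value applied to conj (f z0) * f z + eps * conj z0 * (z - z0). *)
Lemma max_principle K f M : 0 <= M -> cclosed K -> cbounded K ->
  usc_on K (fun z => mc (f z)) ->
  (forall z, K z -> mc (f z) <= M \/
     exists2 r, 0 < r & forall w, mc (w - z) < r -> K w /\ holo f w) ->
  forall z, K z -> mc (f z) <= M.
Proof.
move=> M0 cK bK uK hK z1 Kz1; rewrite leNgt; apply/negP => fM.
have [B KB] := bK.
have gap : 0 < mc (f z1) ^+ 2 - M ^+ 2.
  rewrite subr_gt0 ltr_pXn2r // nnegrE //; exact: mc_ge0.
(* This makes e |z|^2 < |f z1|^2 - M^2 on K, so that a maximum of u cannot occur where |f| <= M. *)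
pose e := (mc (f z1) ^+ 2 - M ^+ 2) / (2 * (B ^+ 2 + 1)).
have B1 : 0 < B ^+ 2 + 1 by rewrite ltr_wpDl // sqr_ge0.
have e0 : 0 < e by rewrite divr_gt0 // mulr_gt0.
have eB : e * B ^+ 2 < mc (f z1) ^+ 2 - M ^+ 2.
  have : e * (2 * (B ^+ 2 + 1)) = mc (f z1) ^+ 2 - M ^+ 2.
    by rewrite divfK // lt0r_neq0 // mulr_gt0.
  have : 0 <= e * B ^+ 2 by rewrite mulr_ge0 ?sqr_ge0 ?(ltW e0).
  lra.
pose u z := mc (f z) ^+ 2 + e * mc z ^+ 2.
have [//|//|//||z0 Kz0 hz0] := @usc_max K u z1 _ _ _ _.
  move=> z Kz d d0; set F := mc (f z); set Z := mc z.
  have F0 : 0 <= F by exact: mc_ge0.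
  have Z0 : 0 <= Z by exact: mc_ge0.
  pose s := Num.min 1 (d / (2 * (2 * F + 1 + e * (2 * Z + 1)))).
  have D0 : 0 < 2 * F + 1 + e * (2 * Z + 1).
    have : 0 <= e * (2 * Z + 1) by rewrite mulr_ge0 ?(ltW e0) //; lra.
    lra.
  have s0 : 0 < s by rewrite lt_min ltr01 divr_gt0 // mulr_gt0.
  have s1 : s <= 1 by rewrite ge_min lexx.
  have sd : s * (2 * F + 1 + e * (2 * Z + 1)) < d.
    have : s <= d / (2 * (2 * F + 1 + e * (2 * Z + 1))) by rewrite ge_min lexx orbT.
    rewrite ler_pdivlMr ?mulr_gt0 //; lra.
  have n2 : near_in K z (fun w => mc (w - z) < s) by exists s.
  apply: near_in_imp (near_in_and (uK z Kz s s0) n2) => w _ [h1 h2].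
  have wZ : mc w < Z + s by have := mc_dist w z; rewrite -/Z; lra.
  have sq (x y : R) : 0 <= x -> 0 <= y -> y < x + s -> y ^+ 2 <= x ^+ 2 + s * (2 * x + 1).
    clear -s0 s1; move=> x0 y0 xy; have : y ^+ 2 <= (x + s) ^+ 2 by rewrite ler_pXn2r ?nnegrE //; lra.
    have : s * s <= s * 1 by rewrite ler_pM2l.
    by rewrite sqrrD; lra.
  have := sq _ _ F0 (mc_ge0 (f w)) h1; have := sq _ _ Z0 (mc_ge0 w) wZ.
  rewrite /u -/F -/Z; have := ltW e0; move: sd; set a := mc w ^+ 2; set b := mc (f w) ^+ 2.
  move=> sd ee aa bb.
  have : e * a <= e * (Z ^+ 2 + s * (2 * Z + 1)) by rewrite ler_wpM2l.
  lra.
have Kz0B : e * mc z0 ^+ 2 <= e * B ^+ 2.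
  have zB := KB z0 Kz0; have z00 := mc_ge0 z0.
  by rewrite ler_pM2l // ler_pXn2r // nnegrE //; lra.
have uz01 : mc (f z1) ^+ 2 <= u z0.
  by apply: le_trans (hz0 _ Kz1); rewrite /u lerDl mulr_ge0 ?sqr_ge0 ?(ltW e0).
case: (hK z0 Kz0) => [fz0|[r r0 hr]].
  have : mc (f z0) ^+ 2 <= M ^+ 2 by rewrite ler_pXn2r // nnegrE // mc_ge0.
  by move: uz01; rewrite /u; lra.
pose ph z := conjc (f z0) * f z + (e%:C * conjc z0) * (z - z0).
have r20 : 0 < r / 2 by rewrite divr_gt0.
have rr : r / 2 < r by rewrite ltr_pdivrMr //; lra.
have [|w wr] := @mean_value ph z0 (r / 2) r r20 rr.
  move=> w wr; have [_ hw] := hr w wr; apply: holoD; apply: holoM => //; try exact: holo_cst.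
  by apply: holoB; [exact: holo_id|exact: holo_cst].
have [Kw _] : K w /\ holo f w by apply: hr; rewrite wr.
have uw := hz0 w Kw.
rewrite /ph subrr mulr0 addr0 [conjc _ * f z0]mulrC mulJ /= reD => hE.
have h1 : complex.Re (conjc (f z0) * f w) <= (mc (f z0) ^+ 2 + mc (f w) ^+ 2) / 2.
  apply: le_trans (ler_norm _) _; apply: le_trans (mc_re _) _; rewrite mcM mcJ.
  have := sqr_ge0 (mc (f z0) - mc (f w)); rewrite sqrrB; lra.
(* The term (r / 2)^2 = |w - z0|^2 is the strict gain that contradicts the maximality of z0. *)
have h2 : complex.Re (e%:C * conjc z0 * (w - z0)) = e * (mc w ^+ 2 - mc z0 ^+ 2 - (r / 2) ^+ 2) / 2.
  by rewrite -wr !mc_sqr !cE /=; field.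
have r2 : 0 < e * (r / 2) ^+ 2 by rewrite mulr_gt0 // exprn_gt0.
move: uw hE h1; rewrite /u h2; lra.
Qed.

Lemma disc_max f a r r' M : 0 < r -> r < r' -> (forall w, mc (w - a) < r' -> holo f w) ->
  (forall w, mc (w - a) = r -> mc (f w) <= M) ->
  forall w, mc (w - a) <= r -> mc (f w) <= M.
Proof.
move=> r0 rr hf fM w wr.
have M0 : 0 <= M.
  apply: le_trans (fM (a + r%:C) _); first exact: mc_ge0.
  by rewrite addrAC subrr add0r mcR gtr0_norm.
apply: (@max_principle [set w | mc (w - a) <= r] f M) => //.
- exact: cclosed_disc.
- exact: cbounded_disc.
- apply: usc_mc => z /= zr; have /holo_cont : holo f z by apply: hf; lra.
  exact: ccont_sub.
- move=> z /= zr; have [zE|nz] := eqVneq (mc (z - a)) r; last first.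
    have zlt : mc (z - a) < r by rewrite lt_def eq_sym nz.
    right; exists (r - mc (z - a)); first by rewrite subr_gt0.
    move=> v vz; have := mc_tri v z a => hv; split; first by rewrite /=; lra.
    by apply: hf; lra.
  by left; apply: fM.
Qed.

End MaximumPrinciple.

(** * Removable singularities *)

Section Removable.
Variable R : realType.
Local Notation C := R[i].
Implicit Types (f g q : C -> C) (z w p a : C) (r M : R).

Lemma pow_dominated (c L m x : R) : 0 < c -> 0 < m -> m < x ->
  (forall n, c * x ^+ n <= L * m ^+ n) -> False.
Proof.
move=> c0 m0 mx h; have x0 : 0 < x by lra.
have L1 : 0 < `|L| + 1 by rewrite ltr_wpDl.
have q1 : `|m / x| < 1 by rewrite gtr0_norm ?divr_gt0 // ltr_pdivrMr // mul1r.
have /cvgrPdist_lt /(_ (c / (`|L| + 1))) := cvg_expr q1.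
case; first by rewrite divr_gt0.
move=> n _ /(_ n (leqnn n)) /=; rewrite sub0r normrN ger0_norm; last first.
  by rewrite exprn_ge0 // divr_ge0 ?ltW.
rewrite ltr_pdivlMr // expr_div_n => h1.
have xn : 0 < x ^+ n by rewrite exprn_gt0.
have := h n; have mn : 0 < m ^+ n by rewrite exprn_gt0.
have h2 : m ^+ n * (`|L| + 1) < c * x ^+ n.
  by move: h1; rewrite mulrAC ltr_pdivrMr.
have : L * m ^+ n <= `|L| * m ^+ n by rewrite ler_pM2r // ler_norm.
lra.
Qed.

Lemma holo_shift p z : holo (fun w => w - p) z.
Proof. by apply: holoB; [exact: holo_id|exact: holo_cst]. Qed.

(** The product P^2 f^(n+1), with P vanishing on s, is holomorphic also at the exceptional points
    because f is bounded near them. The maximum principle gives |P|^2 |f|^(n+1) <= L M^(n+1) with L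
    independent of n, and letting n grow removes P and L. *)
Lemma disc_max_exc f a r r' M (s : seq C) : 0 < r -> r < r' -> 0 <= M ->
  (forall w, mc (w - a) < r' -> w \notin s -> holo f w) ->
  (forall p, p \in s -> exists B, near_in setT p (fun w => w \notin s -> mc (f w) <= B)) ->
  (forall w, mc (w - a) = r -> w \notin s -> mc (f w) <= M) ->
  forall w, mc (w - a) <= r -> w \notin s -> mc (f w) <= M.
Proof.
move=> r0 rr M0 hf bf fM w wr ws.
pose P z := \prod_(p <- s) (z - p).
have hP z : holo P z by apply: holo_prod => p; exact: holo_shift.
have P0 z : z \in s -> P z = 0.
  by move=> zs; rewrite /P (big_rem _ zs) /= subrr mul0r.
have PN z : z \notin s -> P z != 0.
  move=> zs; rewrite /P prodf_seq_neq0; apply/allP => p ps /=.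
  by rewrite subr_eq0; apply: contra zs => /eqP ->.
pose k n z := P z ^+ 2 * f z ^+ n.+1.
have k0 n z : z \in s -> k n z = 0 by move=> /P0; rewrite /k => ->; rewrite expr0n mul0r.
have hk n z : mc (z - a) < r' -> holo (k n) z.
  move=> zr; have [zs|zs] := boolP (z \in s); last first.
    by apply: holoM; apply: holoX => //; exact: hf.
  exists 0; apply: eps_cder => e e0.
  have [B hB] := bf z zs.
  pose Q u := \prod_(p <- rem z s) (u - p).
  have hQ : near_in setT z (fun w => mc (Q w) < mc (Q z) + 1).
    by apply: ccont_bnd; apply: holo_cont; apply: holo_prod => p; exact: holo_shift.
  set T := mc (Q z) + 1 in hQ; pose D := T ^+ 2 * (`|B| + 1) ^+ n.+1.
  have T0 : 0 < T by rewrite /T; have := mc_ge0 (Q z); lra.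
  have B0 : 0 < `|B| + 1 by rewrite ltr_wpDl.
  have D0 : 0 < D by rewrite mulr_gt0 // exprn_gt0.
  have n3 : near_in setT z (fun w => mc (w - z) < e / D) by exists (e / D); rewrite ?divr_gt0.
  apply: near_in_imp (near_in_and hB (near_in_and hQ n3)) => u _ [h1 [h2 h3]].
  rewrite mul0r subr0 (k0 n z zs) subr0.
  have [us|us] := boolP (u \in s); first by rewrite (k0 n u us) mc0 mulr_ge0 ?mc_ge0 // ltW.
  rewrite /k (_ : P u = (u - z) * Q u); last by rewrite /P (big_rem _ zs).
  rewrite mcM !mcX mcM exprMn -mulrA.
  apply: (@le_trans _ _ (mc (u - z) ^+ 2 * D)).
    rewrite ler_wpM2l ?sqr_ge0 // /D; apply: ler_pM; rewrite ?exprn_ge0 ?mc_ge0 //.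
      by rewrite ler_pXn2r ?nnegrE ?mc_ge0 ?(ltW T0) // ltW.
    rewrite ler_pXn2r ?nnegrE ?mc_ge0 ?(ltW B0) //.
    by apply: le_trans (h1 us) _; have := ler_norm B; lra.
  rewrite expr2 mulrAC ler_wpM2r ?mc_ge0 //.
  by move: h3; rewrite ltr_pdivlMr // => /ltW.
have [L L0 hL] : exists2 L, 0 < L & forall w, mc (w - a) <= r -> mc (P w ^+ 2) <= L.
  by apply: disc_bound (ltW r0) _ => v _; apply/holo_cont/holoX.
have key n : mc (k n w) <= L * M ^+ n.+1.
  apply: (disc_max r0 rr) wr => [v vr|v vr]; first exact: hk.
  have [vs|vs] := boolP (v \in s).
    by rewrite k0 // mc0 mulr_ge0 ?exprn_ge0 // ltW.
  rewrite /k mcM; apply: ler_pM; rewrite ?mc_ge0 ?hL ?vr //.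
  by rewrite mcX ler_pXn2r ?nnegrE ?mc_ge0 // fM.
rewrite leNgt; apply/negP => lt; set x := mc (f w) in lt.
have c0 : 0 < mc (P w ^+ 2) by rewrite mc_gt0 expf_neq0 // PN.
have [m [m0 mx Mm]] : exists m, [/\ 0 < m, m < x & M <= m].
  by exists ((M + x) / 2); split; lra.
apply: (@pow_dominated (mc (P w ^+ 2) * x) (L * m) _ _ _ m0 mx).
  by rewrite mulr_gt0 //; lra.
move=> n; rewrite -!mulrA -!exprS.
have : mc (P w ^+ 2) * x ^+ n.+1 <= L * M ^+ n.+1 by rewrite -mcX -mcM; exact: key.
move=> /le_trans; apply.
by rewrite ler_pM2l // ler_pXn2r ?nnegrE // ltW.
Qed.

Lemma dq_bounded g w : holo g w ->
  exists B, near_in setT w (fun z => z != w -> mc ((g z - g w) / (z - w)) <= B).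
Proof.
move=> [d [q [cq qd qE]]]; exists (mc (q w) + 1).
apply: near_in_imp (ccont_bnd cq) => z _ /ltW h zw.
by rewrite qE // mulfK // subr_eq0.
Qed.

Lemma ccont_bounded f w : ccont setT f w ->
  exists B, near_in setT w (fun z => mc (f z) <= B).
Proof.
move=> cf; exists (mc (f w) + 1).
by apply: near_in_imp (ccont_bnd cf) => z _ /ltW.
Qed.

Lemma ccont_le f p K : ccont setT f p ->
  near_in setT p (fun z => z != p -> mc (f z) <= K) -> mc (f p) <= K.
Proof.
move=> cf hK; apply/ler_addgt0Pr => e e0.
have [r r0 hr] := near_in_and (cf e e0) hK.
have r20 : 0 < r / 2 by rewrite divr_gt0.
have zE : p + (r / 2)%:C - p = (r / 2)%:C by rewrite addrAC subrr add0r.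
have [|h1 h2] := hr (p + (r / 2)%:C) I.
  by rewrite zE mcR gtr0_norm // ltr_pdivrMr //; lra.
have {}h2 : mc (f (p + (r / 2)%:C)) <= K.
  by apply: h2; rewrite -subr_eq0 zE -mc_eq0 mcR normr_eq0 lt0r_neq0.
by have := mc_dist (f p) (f (p + (r / 2)%:C)); rewrite mc_distC; lra.
Qed.

(** Every u w - K |w - p| lies below every u w' + K |w' - p|; the infimum of the latter separates
    the two families and is the limit. *)
Lemma lipschitz_limit (u : C -> R) (D : C -> Prop) p K : (exists w, D w) ->
  (forall w w', D w -> D w' -> u w - u w' <= K * (mc (w - p) + mc (w' - p))) ->
  exists l, forall w, D w -> `|u w - l| <= K * mc (w - p).
Proof.
move=> [w0 Dw0] hu; pose A := [set u w + K * mc (w - p) | w in D].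
have lbA w : D w -> lbound A (u w - K * mc (w - p)).
  by move=> Dw _ [v Dv <-]; have := hu w v Dw Dv; lra.
have iA : has_inf A.
  by split; [exists (u w0 + K * mc (w0 - p)); exists w0|exists (u w0 - K * mc (w0 - p)); exact: lbA].
exists (inf A) => w Dw; rewrite ler_norml.
have h1 : inf A <= u w + K * mc (w - p) by apply: ge_inf; [case: iA|exists w].
have h2 : u w - K * mc (w - p) <= inf A by apply: lb_le_inf; [case: iA|exact: lbA].
lra.
Qed.

(* Second-order divided differences of g are bounded by the maximum principle,
   so the difference quotient at p is Lipschitz and has a limit. *)
Lemma removable g p r : 0 < r -> (forall w, mc (w - p) < r -> w != p -> holo g w) ->
  ccont setT g p -> holo g p.
Proof.
move=> r0 hg cg; pose rho := r / 2.
have rho0 : 0 < rho by rewrite divr_gt0.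
have rhor : rho < r by rewrite ltr_pdivrMr //; lra.
have cga w : mc (w - p) < r -> ccont setT g w.
  by move=> wr; have [->//|wp] := eqVneq w p; apply/holo_cont/hg.
have [N N0 hN] : exists2 N, 0 < N & forall w, mc (w - p) <= rho -> mc (g w) <= N.
  by apply: disc_bound (ltW rho0) _ => w wr; apply: cga; lra.
(* Points of the circle |z - p| = rho have distance at least rho / 2 from D, so first differences
   are at most 2 N / (rho / 2) = K1 there and second ones at most 2 K1 / (rho / 2) = K. *)
pose K1 := 4 * N / rho; pose K := 4 * K1 / rho.
have K10 : 0 < K1 by rewrite divr_gt0 // mulr_gt0.
have K0 : 0 < K by rewrite divr_gt0 // mulr_gt0.
pose D w := w != p /\ mc (w - p) < rho / 2.
pose q w z := (g z - g w) / (z - w).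
have hq w z : mc (z - p) < r -> z != p -> z != w -> holo (q w) z.
  move=> zr zp zw; apply: holo_div; first by rewrite subr_eq0.
    by apply: holoB; [exact: hg|exact: holo_cst].
  exact: holo_shift.
have cq w : w != p -> ccont setT (q w) p.
  move=> wp; apply: ccontM; first by apply: ccontB => //; exact: ccont_cst.
  apply: ccontV; last by rewrite subr_eq0 eq_sym.
  by apply: ccontB; [exact: ccont_id|exact: ccont_cst].
have far w z : D w -> mc (z - p) = rho -> rho / 2 <= mc (z - w).
  by move=> [_ wp] zr; have := mc_tri z w p; lra.
have q1 w z : D w -> mc (z - p) <= rho -> z \notin [:: p; w] -> mc (q w z) <= K1.
  move=> Dw; have [wp wr] := Dw; apply: (@disc_max_exc (q w) p rho r K1 [:: p; w]) => //.
  - exact: ltW.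
  - by move=> v vr; rewrite !inE negb_or => /andP[? ?]; exact: hq.
  - move=> v; rewrite !inE => /orP[] /eqP ->.
      by have [B hB] := ccont_bounded (cq w wp); exists B; apply: near_in_imp hB.
    have [|B hB] := @dq_bounded g w; first by apply: hg => //; lra.
    exists B; apply: near_in_imp hB => u _ hu; rewrite !inE negb_or => /andP[_ uw].
    exact: hu.
  - move=> v vr _; rewrite /q mc_div ler_pdivrMr; last by have := far w v Dw vr; lra.
    apply: le_trans (mcB _ _) _.
    have g1 : mc (g v) <= N by apply: hN; lra.
    have g2 : mc (g w) <= N by apply: hN; lra.
    apply: (@le_trans _ _ (K1 * (rho / 2))); last by rewrite ler_pM2l //; exact: far.
    have -> : K1 * (rho / 2) = 2 * N by rewrite /K1; field; rewrite lt0r_neq0.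
    by lra.
have q2 w w' : D w -> D w' -> w != w' ->
   mc ((q w p - q w w') / (p - w')) <= K.
  move=> Dw Dw' ww; have [wp wr] := Dw; have [wp' wr'] := Dw'.
  pose F z := (q w z - q w w') / (z - w').
  have w's : w' \notin [:: p; w] by rewrite !inE negb_or wp' eq_sym.
  have cF : ccont setT F p.
    apply: ccontM; first by apply: ccontB; [exact: cq|exact: ccont_cst].
    apply: ccontV; last by rewrite subr_eq0 eq_sym.
    by apply: ccontB; [exact: ccont_id|exact: ccont_cst].
  have Fle z : mc (z - p) <= rho -> z \notin [:: p; w; w'] -> mc (F z) <= K.
    apply: (@disc_max_exc F p rho r K) => //.
    - exact: ltW.
    - move=> v vr; rewrite !inE !negb_or => /and3P[vp vw vw'].
      apply: holo_div; first by rewrite subr_eq0.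
        by apply: holoB; [exact: hq|exact: holo_cst].
      exact: holo_shift.
    - move=> v; rewrite !inE => /or3P[] /eqP ->.
      + by have [B hB] := ccont_bounded cF; exists B; apply: near_in_imp hB.
      + have [|B hB] := @dq_bounded g w; first by apply: hg => //; lra.
        have c1 : ccont setT (fun z => (z - w')^-1) w.
          apply: ccontV; last by rewrite subr_eq0.
          by apply: ccontB; [exact: ccont_id|exact: ccont_cst].
        have [B' hB'] := ccont_bounded c1.
        exists ((B + mc (q w w')) * B'); apply: near_in_imp (near_in_and hB hB') => u _ [h1 h2].
        rewrite !inE !negb_or => /and3P[up uw uw'].
        rewrite /F mcM; apply: ler_pM; rewrite ?mc_ge0 //.
        by apply: le_trans (mcB _ _) _; rewrite lerD2r; exact: h1.
      + have [|B hB] := @dq_bounded (q w) w'; first by apply: hq => //; [lra|rewrite eq_sym].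
        exists B; apply: near_in_imp hB => u _ hu; rewrite !inE !negb_or => /and3P[_ _ uw].
        exact: hu.
    - move=> v vr; rewrite !inE !negb_or => /and3P[vp vw vw'].
      rewrite /F mc_div ler_pdivrMr; last by have := far w' v Dw' vr; lra.
      apply: le_trans (mcB _ _) _.
      have h1 : mc (q w v) <= K1 by apply: q1 => //; [lra|rewrite !inE negb_or vp].
      have h2 : mc (q w w') <= K1 by apply: q1 => //; lra.
      apply: (@le_trans _ _ (K * (rho / 2))); last by rewrite ler_pM2l //; exact: far.
      have -> : K * (rho / 2) = 2 * K1 by rewrite /K; field; rewrite lt0r_neq0.
      by lra.
  apply: (ccont_le cF); exists (Num.min rho (Num.min (mc (w - p)) (mc (w' - p)))).
    by rewrite !lt_min rho0 !mc_gt0 !subr_eq0 wp wp'.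
  move=> z _; rewrite !lt_min => /and3P[z1 z2 z3] zp; apply: Fle; first exact: ltW.
  by rewrite !inE !negb_or zp /=; apply/andP; split; apply/eqP => E; move: z2 z3; rewrite E ltxx.
pose s w := (g w - g p) / (w - p).
have sL w w' : D w -> D w' -> mc (s w - s w') <= K * (mc (w - p) + mc (w' - p)).
  move=> Dw Dw'; have [->|ww] := eqVneq w w'.
    by rewrite subrr mc0 mulr_ge0 ?addr_ge0 ?mc_ge0 // ltW.
  (* Divided differences are symmetric in their nodes, so the second difference at w, w', p, bounded
     in [q2], also controls the increments of s. *)
  have -> : s w - s w' = (w - w') * ((q w p - q w w') / (p - w')).
    have [wp _] := Dw; have [wp' _] := Dw'; rewrite /s /q; field.
    have E (x y : C) : x != y -> (x - y != 0) * (y - x != 0).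
      by move=> xy; rewrite !subr_eq0 xy eq_sym xy.
    by rewrite !(E _ _ wp) !(E _ _ wp') !(E _ _ ww).
  rewrite mcM mulrC; apply: ler_pM; rewrite ?mc_ge0 ?q2 //.
  by have := mc_tri w p w'; rewrite (mc_distC p).
have exD : exists w, D w.
  exists (p + (rho / 4)%:C); rewrite /D -subr_eq0 addrAC subrr add0r.
  have r40 : 0 < rho / 4 by rewrite divr_gt0.
  by rewrite -mc_eq0 mcR gtr0_norm // lt0r_neq0 //; split => //; lra.
have [l1 hl1] : exists l, forall w, D w -> `|complex.Re (s w) - l| <= K * mc (w - p).
  apply: lipschitz_limit exD _ => w w' Dw Dw'; apply: le_trans (sL _ _ Dw Dw').
  by rewrite -reB (le_trans (ler_norm _)) // mc_re.
have [l2 hl2] : exists l, forall w, D w -> `|complex.Im (s w) - l| <= K * mc (w - p).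
  apply: lipschitz_limit exD _ => w w' Dw Dw'; apply: le_trans (sL _ _ Dw Dw').
  by rewrite -imB (le_trans (ler_norm _)) // mc_im.
exists (l1 +i* l2); apply: eps_cder => e e0.
exists (Num.min (rho / 2) (e / (2 * K))).
  by rewrite lt_min !divr_gt0 // mulr_gt0.
move=> w _; rewrite lt_min => /andP[w1 w2].
have [->|wp] := eqVneq w p; first by rewrite !subrr mulr0 subrr mc0 mulr0.
have -> : g w - g p - (l1 +i* l2) * (w - p) = (s w - (l1 +i* l2)) * (w - p).
  by rewrite /s mulrBl divfK // subr_eq0.
have h3 : mc (s w - (l1 +i* l2)) <= `|complex.Re (s w) - l1| + `|complex.Im (s w) - l2|.
  by apply: le_trans (mc_le _) _; rewrite reB imB.
rewrite mcM ler_wpM2r ?mc_ge0 //; apply: le_trans h3 _.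
have Dw : D w by [].
have K20 : 0 < 2 * K by rewrite mulr_gt0.
have := hl1 w Dw; have := hl2 w Dw; move: w2; rewrite ltr_pdivlMr //.
by clearbody K; move: (mc (w - p)) => m; lra.
Qed.

(** The Caratheodory quotient is continuous at p and holomorphic elsewhere where g is, so
    [removable] applies. Zeros can thus be divided out without power series. *)
Lemma quotient_holo g p r : 0 < r -> (forall w, mc (w - p) < r -> holo g w) ->
  exists q, [/\ cder setT g p (q p), (forall w, g w - g p = q w * (w - p)) &
    forall w, holo g w -> holo q w].
Proof.
move=> r0 hg; have [|d [q [cq qd qE]]] := hg p; first by rewrite subrr mc0.
have hqn w : w != p -> holo g w -> holo q w.
  move=> wp hw; have wp0 : 0 < mc (w - p) by rewrite mc_gt0 subr_eq0.
  apply: (@holo_near _ (fun u => (g u - g p) / (u - p)) _ _ _ wp0).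
    move=> v vw; rewrite qE //; apply: mulfK; rewrite -mc_eq0; apply/eqP => vp.
    by have := mc_tri w v p; rewrite vp (mc_distC w v); lra.
  apply: holo_div; [by rewrite subr_eq0| |exact: holo_shift].
  by apply: holoB => //; exact: holo_cst.
exists q; split; first by exists q.
  by move=> w; exact: qE.
move=> w hw; have [->|wp] := eqVneq w p; last exact: hqn.
apply: (@removable q p r) => // v vr vp; apply: hqn => //; exact: hg.
Qed.

Definition dv f z := xget 0 [set d | cder setT f z d].

Lemma dvP f z : holo f z -> cder setT f z (dv f z).
Proof. by case=> d hd; rewrite /dv; apply: (@xgetPex _ 0 [set d | cder setT f z d]); exists d. Qed.
Lemma dvE f z d : cder setT f z d -> dv f z = d.
Proof. by move=> hd; apply: cder_uniq (dvP (ex_intro _ _ hd)) hd. Qed.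

(** The holomorphic difference quotient at a takes the value f'(a) there and is at most 2 M / r on
    the circle. *)
Lemma cauchy_est f a r r' M d : 0 < r -> r < r' ->
  (forall w, mc (w - a) < r' -> holo f w) ->
  (forall w, mc (w - a) = r -> mc (f w) <= M) -> cder setT f a d ->
  mc d <= 2 * M / r.
Proof.
move=> r0 rr hf fM hd; have r'0 : 0 < r' by lra.
have [q [qd qE hq]] := quotient_holo r'0 hf.
rewrite (cder_uniq hd qd).
have fa : mc (f a) <= M by apply: (disc_max r0 rr hf fM); rewrite subrr mc0 ltW.
apply: (disc_max r0 rr (fun w wr => hq _ (hf _ wr))) => [w wr|]; last by rewrite subrr mc0 ltW.
have wa : w - a != 0 by rewrite -mc_gt0 wr.
have -> : q w = (f w - f a) / (w - a) by rewrite qE mulfK.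
rewrite mc_div wr ler_pM2r ?invr_gt0 //; apply: le_trans (mcB _ _) _.
by have := fM w wr; lra.
Qed.

(** Dividing twice gives f w = f p + (w - p) q0 p + (w - p)^2 q1 w. This makes [dv f] explicit near
    p, up to [dv q1], which only has to be bounded. *)
Lemma holo_dv f p r : 0 < r -> (forall w, mc (w - p) < r -> holo f w) -> holo (dv f) p.
Proof.
move=> r0 hf; have [q0 [dq0 E0 h0]] := quotient_holo r0 hf.
have [q1 [dq1 E1 h1]] := quotient_holo r0 (fun w wr => h0 _ (hf _ wr)).
have hq1 w : mc (w - p) < r -> holo q1 w by move=> /hf/h0/h1.
have dfE w : mc (w - p) < r ->
    dv f w = q0 p + 2 * (w - p) * q1 w + (w - p) ^+ 2 * dv q1 w.
  move=> wr; apply: dvE.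
  have dp : cder setT (fun u => u - p) w (1 - 0) by apply: cderB; [exact: cder_id|exact: cder_cst].
  have hD := cderD (cderD (cder_cst setT (f p) w) (cderM (cder_cst setT (q0 p) w) dp))
     (cderM (cderM dp dp) (dvP (hq1 w wr))).
  apply: cder_ext (cder_eq hD _) => //; last by ring.
  move=> u _; have -> : f u = (f u - f p) + f p by rewrite subrK.
  have := E1 u; rewrite E0 => /eqP; rewrite subr_eq => /eqP ->; ring.
pose rho := r / 4; have rho0 : 0 < rho by rewrite divr_gt0.
have [N N0 hN] : exists2 N, 0 < N & forall w, mc (w - p) <= r / 2 -> mc (q1 w) <= N.
  apply: disc_bound; first by lra.
  by move=> w wr; apply/holo_cont/hq1; lra.
pose B := 2 * N / rho; have B0 : 0 < B by rewrite divr_gt0 // mulr_gt0.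
have hB w : mc (w - p) < rho -> mc (dv q1 w) <= B.
  move=> wr; apply: (@cauchy_est q1 w rho (2 * rho)) => //; first by lra.
  - by move=> v vr; apply: hq1; have := mc_tri v w p; rewrite /rho in wr vr *; lra.
  - by move=> v vr; apply: hN; have := mc_tri v w p; rewrite /rho in wr vr *; lra.
  - by apply/dvP/hq1; rewrite /rho in wr; lra.
exists (2 * q1 p); apply: eps_cder => e e0; have e40 : 0 < e / 4 by rewrite divr_gt0.
have pr : mc (p - p) < r by rewrite subrr mc0.
have n1 : near_in setT p (fun w => mc (w - p) < Num.min rho (e / (2 * B))).
  by exists (Num.min rho (e / (2 * B))) => //; rewrite lt_min rho0 divr_gt0 // mulr_gt0.
apply: near_in_imp (near_in_and n1 (holo_cont (hq1 p pr) e40)) => w _ [+ h2].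
rewrite lt_min => /andP[w1 w2].
rewrite (dfE w) ?(dfE p) // ?subrr; last by rewrite /rho in w1; lra.
have -> : q0 p + 2 * (w - p) * q1 w + (w - p) ^+ 2 * dv q1 w -
   (q0 p + 2 * 0 * q1 p + 0 ^+ 2 * dv q1 p) - 2 * q1 p * (w - p) =
   (2 * (q1 w - q1 p) + (w - p) * dv q1 w) * (w - p) by ring.
rewrite mcM ler_wpM2r ?mc_ge0 //; apply: le_trans (mcD _ _) _; rewrite !mcM.
have -> : mc (2 : C) = 2 by rewrite -[2 : C](rmorph_nat (real_complex R)) mcR ger0_norm.
have : mc (w - p) * mc (dv q1 w) <= e / (2 * B) * B.
  by apply: ler_pM; rewrite ?mc_ge0 ?hB // ltW.
have -> : e / (2 * B) * B = e / 2 by field; rewrite lt0r_neq0.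
lra.
Qed.

End Removable.

(** * Growth in the disc *)

Section DiscGrowth.
Variable R : realType.
Local Notation C := R[i].
Implicit Types (f g q F G H L Phi : C -> C) (z w p a : C) (r rho M : R).

Lemma schwarz f r : 0 < r -> (forall w, mc w < r -> holo f w) -> f 0 = 0 ->
  (forall w, mc w < r -> mc (f w) <= 1) ->
  forall w, mc w < r -> r * mc (f w) <= mc w.
Proof.
move=> r0 hf f0 f1 w wr.
have hf' v : mc (v - 0) < r -> holo f v by rewrite subr0; exact: hf.
have [q [_ qE hq]] := quotient_holo r0 hf'.
have fE v : f v = q v * v by rewrite -[LHS]subr0 -f0 qE subr0.
have key s : mc w < s -> s < r -> s * mc (f w) <= mc w.
  move=> ws sr; have s0 : 0 < s by have := mc_ge0 w; lra.
  have : mc (q w) <= s^-1.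
    apply: (@disc_max _ q 0 s r) => //; last by rewrite subr0 ltW.
      by move=> v vr; apply/hq/hf'.
    move=> v; rewrite subr0 => vs; have v0 : mc v != 0 by rewrite vs lt0r_neq0.
    have := f1 v; rewrite vs fE mcM vs => /(_ sr).
    by rewrite -[s^-1]div1r ler_pdivlMr.
  rewrite fE mcM mulrA => h; apply: ler_piMl; rewrite ?mc_ge0 //.
  by rewrite mulrC -ler_pdivlMr // div1r.
apply/ler_addgt0Pr => e e0; set d := mc (f w).
have d0 : 0 <= d by exact: mc_ge0.
have d1 : 0 < d + 1 by lra.
set s := Num.max ((mc w + r) / 2) (r - e / (d + 1)).
have es : 0 < e / (d + 1) by rewrite divr_gt0.
have ws : mc w < s by rewrite lt_max; apply/orP; left; lra.
have sr : s < r by rewrite gt_max; apply/andP; split; lra.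
have := key s ws sr.
have : r - e / (d + 1) <= s by rewrite le_max lexx orbT.
have : e / (d + 1) * (d + 1) = e by rewrite divfK // lt0r_neq0.
rewrite -/d; clearbody s; move: (e / (d + 1)) es => k; nra.
Qed.

Lemma const_of_cder0 f a r : (forall w, mc (w - a) < r -> cder setT f w 0) ->
  forall w, mc (w - a) < r -> f w = f a.
Proof.
move=> hf w wr.
have := @curve_mvt_cst _ 0 1 0 (fun z => f (a + z * (w - a))) (fun=> 0 * (w - a)) ler01.
rewrite mul0r mul1r mul0r addr0 addrCA subrr addr0 => h.
apply/eqP; rewrite -subr_eq0 -mc_eq0 eq_le mc_ge0 andbT; apply: h => t /andP[t0 t1].
  apply: (@cder_eq _ _ _ _ (0 * (w - a))); last by rewrite mul0r.
  apply: (@cder_comp _ _ setT f) => //; first exact: cder_lin.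
  apply: hf; rewrite addrAC subrr add0r mcM mcR ger0_norm //.
  by apply: le_lt_trans wr; rewrite ler_piMl ?mc_ge0.
by rewrite ?mul0r mc0.
Qed.

(** For L a primitive of H' / H, the product H exp (- L) has derivative 0. *)
Lemma holo_log H r : 0 < r -> (forall w, mc w < r -> holo H w) ->
  (forall w, mc w < r -> H w != 0) ->
  exists L, [/\ (forall w, mc w < r -> holo L w), L 0 = 0 &
    forall w, mc w < r -> H w = H 0 * cexp (L w)].
Proof.
move=> r0 hH H0.
have hd w : mc w < r -> holo (dv H) w.
  move=> wr; apply: (@holo_dv _ _ _ (r - mc w)); first by rewrite subr_gt0.
  by move=> v vr; apply: hH; have := mc_dist v w; lra.
have hq w : mc w < r -> holo (fun z => dv H z / H z) w.
  by move=> wr; apply: holo_div; [exact: H0|exact: hd|exact: hH].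
have bE w : mc (w - 0) = mc w by rewrite subr0.
have [||||L hL] := @star_primitive R [set w | mc (w - 0) < r] 0 (fun z => dv H z / H z).
- exact: copen_ball.
- exact: cstar_ball.
- by move=> z /=; rewrite bE => /hq/holo_cont.
- by move=> z /=; rewrite bE => /hq.
have c0 w : mc (w - 0) < r -> cder setT (fun w => H w * cexp (- (L w - L 0))) w 0.
  move=> wr; have wr' : mc w < r by rewrite -bE.
  have h1 := cderN (cderB (hL w wr) (cder_cst setT (L 0) w)).
  have h2 := @cder_comp _ _ setT _ _ _ _ _ (fun _ _ => I) h1 (cder_cexp _).
  have := cderM (dvP (hH w wr')) h2 => /cder_eq; apply.
  by field; exact: H0.
exists (fun w => L w - L 0); split.
- move=> w wr; apply: holoB; last exact: holo_cst.
  by eexists; apply: hL; rewrite /= bE.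
- by rewrite subrr.
- move=> w wr; have := const_of_cder0 c0; move=> /(_ w); rewrite bE => /(_ wr).
  rewrite subrr oppr0 cexp0 mulr1 cexpN => <-.
  by rewrite divfK // cexp_neq0.
Qed.

(* Borel-Caratheodory: apply Schwarz' lemma to L / (2 P - L), L = log (H / H 0). *)
Lemma harnack H r : 0 < r -> (forall w, mc w < r -> holo H w) ->
  (forall w, mc w < r -> H w != 0) -> (forall w, mc w < r -> mc (H w) <= 1) ->
  forall w, mc w < r ->
   (r - mc w) * - ln (mc (H w)) <= (r + mc w) * - ln (mc (H 0)).
Proof.
move=> r0 hH H0 H1 w wr.
have [L [hL L0 HE]] := holo_log r0 hH H0.
have m0 : mc 0 < r :> R by rewrite mc0.
have HR v : mc v < r -> ln (mc (H v)) = ln (mc (H 0)) + complex.Re (L v).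
  move=> vr; rewrite (HE v vr) mcM mc_cexp lnM ?posrE ?expR_gt0 ?mc_gt0 ?H0 //.
  by rewrite expRK.
set p := - ln (mc (H 0)).
have p0 : 0 <= p by rewrite oppr_ge0 ln_le0 // H1.
have Lp v : mc v < r -> complex.Re (L v) <= p.
  move=> vr; have := HR v vr; have : ln (mc (H v)) <= 0 by rewrite ln_le0 // H1.
  by rewrite /p; lra.
suff key : forall e, 0 < e -> (r - mc w) * - complex.Re (L w) <= 2 * mc w * (p + e).
  have h : (r - mc w) * - complex.Re (L w) <= 2 * mc w * p.
    apply/ler_addgt0Pr => e e0.
    have d0 : 0 < 2 * mc w + 1 by have := mc_ge0 w; lra.
    have := key (e / (2 * mc w + 1)) (divr_gt0 e0 d0).
    have : e / (2 * mc w + 1) * (2 * mc w + 1) = e by rewrite divfK // lt0r_neq0.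
    have : 0 < e / (2 * mc w + 1) by rewrite divr_gt0.
    by move: (e / _) => k; nra.
  rewrite HR // -/p; move: h; rewrite /p; lra.
(* Since P exceeds every value of Re L strictly, 2 P - L has no zeros and |L| < |2 P - L|. *)
move=> e e0; set P := p + e; have P0 : 0 < P by rewrite /P; lra.
have D0 v : mc v < r -> mc (L v) < mc ((2 * P)%:C - L v).
  move=> vr; rewrite -(@ltr_pXn2r _ 2) ?nnegrE ?mc_ge0 // !mc_sqr !cE /=.
  have := Lp v vr; rewrite /P => h.
  have : 0 < 4 * (p + e) * (p + e - complex.Re (L v)) by rewrite !mulr_gt0 //; lra.
  lra.
have Dn v : mc v < r -> (2 * P)%:C - L v != 0.
  by move=> vr; rewrite -mc_gt0; apply: le_lt_trans (D0 v vr); exact: mc_ge0.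
have hS v : mc v < r -> holo (fun z => L z / ((2 * P)%:C - L z)) v.
  move=> vr; apply: holo_div; [exact: Dn|exact: hL|].
  by apply: holoB; [exact: holo_cst|exact: hL].
have S1 v : mc v < r -> mc (L v / ((2 * P)%:C - L v)) <= 1.
  by move=> vr; rewrite mc_div ler_pdivrMr ?mc_gt0 ?Dn // mul1r ltW // D0.
have := schwarz r0 hS _ S1 wr; rewrite L0 mul0r => /(_ erefl).
rewrite mc_div mulrA ler_pdivrMr ?mc_gt0 ?Dn // => h.
have h2 : mc ((2 * P)%:C - L w) <= 2 * P + mc (L w).
  by apply: le_trans (mcB _ _) _; rewrite mcR gtr0_norm // mulr_gt0.
have h3 : - complex.Re (L w) <= mc (L w).
  by apply: le_trans (mc_re _); rewrite -normrN ler_norm.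
have w0 := mc_ge0 w; have := ler_wpM2l w0 h2.
have : (r - mc w) * - complex.Re (L w) <= (r - mc w) * mc (L w).
  by rewrite ler_pM2l // subr_gt0.
lra.
Qed.

(** On a circle |v| = s < 1 the square |1 - conj z1 v|^2 exceeds |v - z1|^2 by (1 - s^2) (1 -
    |z1|^2), which is small for s near 1; so no boundary values on the unit circle are involved. *)
Lemma blaschke_quotient G q z1 : mc z1 < 1 -> (forall w, mc w < 1 -> holo q w) ->
  (forall w, G w = q w * (w - z1)) -> (forall w, mc w < 1 -> mc (G w) <= 1) ->
  forall w, mc w < 1 -> mc (q w * (1 - conjc z1 * w)) <= 1.
Proof.
move=> z11 hq GE G1 w w1; set X := mc _.
have X0 : 0 <= X by exact: mc_ge0.
suff : X ^+ 2 <= 1 ^+ 2 by rewrite ler_pXn2r ?nnegrE.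
rewrite expr1n; apply/ler_addgt0Pr => e e0.
pose m := Num.max (mc w) (mc z1); have m1 : m < 1 by rewrite gt_max w1.
have wm : mc w <= m by rewrite le_max lexx.
have zm : mc z1 <= m by rewrite le_max lexx orbT.
have m0 : 0 <= m by apply: le_trans wm; exact: mc_ge0.
clearbody m; pose u := (1 - m) / 2; have u0 : 0 < u by rewrite divr_gt0 // subr_gt0.
(* With s = 1 - t, the first bound keeps |v - z1| >= u on the circle, and the second makes the
   excess, at most 2 t, smaller than e |v - z1|^2. *)
have [t [t0 tu te]] : exists t, [/\ 0 < t, t <= u & 2 * t <= e * u ^+ 2].
  exists (Num.min u (e * u ^+ 2 / 2)); split.
  - by rewrite lt_min u0 divr_gt0 // mulr_gt0 // exprn_gt0.
  - by rewrite ge_min lexx.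
  - have : Num.min u (e * u ^+ 2 / 2) <= e * u ^+ 2 / 2 by rewrite ge_min lexx orbT.
    by rewrite ler_pdivlMr //; lra.
pose s := 1 - t; have s1 : s < 1 by rewrite /s; lra.
have s0 : 0 < s by rewrite /s /u in tu *; lra.
have sw : mc (w - 0) <= s by rewrite subr0 /s; rewrite /u in tu; lra.
have hB v : mc (v - 0) < 1 -> holo (fun v => q v * (1 - conjc z1 * v)) v.
  rewrite subr0 => v1; apply: holoM; first exact: hq.
  apply: holoB; first exact: holo_cst.
  by apply: holoM; [exact: holo_cst|exact: holo_id].
have Y0 : 0 <= 1 + e by lra.
have hX : X <= Num.sqrt (1 + e).
  apply: (disc_max s0 s1 hB) sw => v; rewrite subr0 => vs.
  have vz : u <= mc (v - z1) by have := mc_dist v z1; rewrite vs /s; rewrite /u in tu *; lra.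
  rewrite -[mc _](ger0_norm (mc_ge0 _)) -sqrtr_sqr ler_wsqrtr // mcM exprMn.
  have v1 : mc v < 1 by rewrite vs.
  have Gv : mc (q v) ^+ 2 * mc (v - z1) ^+ 2 <= 1.
    by rewrite -exprMn -mcM -GE expr_le1 ?mc_ge0 // G1.
  have ratio : mc (1 - conjc z1 * v) ^+ 2 <= (1 + e) * mc (v - z1) ^+ 2.
    have -> : mc (1 - conjc z1 * v) ^+ 2 = mc (v - z1) ^+ 2 + (1 - mc v ^+ 2) * (1 - mc z1 ^+ 2).
      rewrite !mc_sqr !cE /=; ring.
    have : (1 - mc v ^+ 2) * (1 - mc z1 ^+ 2) <= 2 * t.
      rewrite vs; have -> : 2 * t = (2 * t) * 1 by rewrite mulr1.
      have z0 : 0 <= mc z1 ^+ 2 by rewrite sqr_ge0.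
      have z1' : mc z1 ^+ 2 <= 1 by rewrite expr_le1 ?mc_ge0 // ltW.
      have s2 : s ^+ 2 <= 1 by rewrite expr_le1 // ltW.
      apply: ler_pM; rewrite ?subr_ge0 //; last lra.
      by rewrite /s; have := sqr_ge0 t; lra.
    have uv : u ^+ 2 <= mc (v - z1) ^+ 2 by rewrite ler_pXn2r ?nnegrE ?mc_ge0 // ltW.
    have := ler_wpM2l (ltW e0) uv; move: te.
    move: (u ^+ 2) (mc (v - z1) ^+ 2) ((1 - _) * (1 - _)) => a b c; lra.
  have q0 : 0 <= mc (q v) ^+ 2 by rewrite sqr_ge0.
  apply: le_trans (ler_wpM2l q0 ratio) _; rewrite mulrCA ler_piMr //.
have : X ^+ 2 <= Num.sqrt (1 + e) ^+ 2 by rewrite ler_pXn2r ?nnegrE ?sqrtr_ge0.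
by rewrite sqr_sqrtr.
Qed.

(* Induction on the number of zeros of H in the smaller disc: dividing out a
   zero by a Blaschke factor increases |H 0| by a factor at least 1 / rho. *)
Lemma disc_growth n rho H Phi : 0 < rho -> rho < 1 ->
  (forall w, mc w < 1 -> holo H w) -> (forall w, mc w < 1 -> holo Phi w) ->
  (forall w, mc w < 1 -> mc (H w) <= 1) ->
  (forall w, mc w < 1 -> mc (Phi w * H w) <= 1) -> rho ^+ n < mc (H 0) ->
  (forall w, mc w < rho ->
     mc (Phi w) <= expR ((rho + mc w) / (rho - mc w) * - ln (mc (H 0)))) /\
  exists s : seq C, forall w, mc w < rho -> H w = 0 -> w \in s.
Proof.
move=> rho0 rho1; elim: n H Phi => [|n IH] H Phi hH hP H1 PH1 Hn.
  have := H1 0; rewrite mc0 => /(_ ltr01); move: Hn; rewrite expr0; lra.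
have H00 : 0 < mc (H 0) by apply: lt_trans Hn; rewrite exprn_gt0.
have [nz|] := pselect (forall w, mc w < rho -> H w != 0).
  split; last by exists [::] => w /nz /negP h /eqP.
  move=> w wr; have w1 : mc w < 1 by lra.
  have d0 : 0 < rho - mc w by rewrite subr_gt0.
  have hw : 0 < mc (H w) by rewrite mc_gt0 nz.
  have hle : mc (Phi w) <= (mc (H w))^-1.
    by rewrite -[_^-1]div1r ler_pdivlMr // -mcM PH1.
  apply: le_trans hle _.
  rewrite -[X in X^-1](@lnK R) ?posrE // -expRN ler_expR mulrAC ler_pdivlMr // mulrC.
  by apply: harnack => // v vr; [apply: hH|apply: H1]; lra.
move=> /existsNP[z1 /not_implyP[z1r /negP/negPn/eqP Hz1]].
have z11 : mc z1 < 1 by lra.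
have [|v vr|q [_ qE hq]] := @quotient_holo R H z1 (1 - mc z1).
  by rewrite subr_gt0.
  by apply: hH; have := mc_dist v z1; lra.
have HE w : H w = q w * (w - z1) by rewrite -qE Hz1 subr0.
have z10 : 0 < mc z1.
  rewrite mc_gt0; apply/eqP => z10; move: H00.
  by rewrite -{1}z10 Hz1 mc0 ltxx.
pose H' w := q w * (1 - conjc z1 * w).
have hq1 w : mc w < 1 -> holo q w by move=> /hH/hq.
have hH' w : mc w < 1 -> holo H' w.
  move=> w1; apply: holoM; first exact: hq1.
  apply: holoB; first exact: holo_cst.
  by apply: holoM; [exact: holo_cst|exact: holo_id].
have H'1 := blaschke_quotient z11 hq1 HE H1.
(* The Blaschke factor is divided out of Phi * H as well, so that Phi itself stays unchanged in the
   induction. *)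
have PH'1 w : mc w < 1 -> mc (Phi w * H' w) <= 1.
  move=> w1; rewrite /H' mulrA.
  apply: (@blaschke_quotient (fun w => Phi w * H w) (fun w => Phi w * q w) z1 z11) => //.
    by move=> v v1; apply: holoM; [exact: hP|exact: hq1].
  by move=> v; rewrite HE mulrA.
have H'0 : mc (H 0) = mc z1 * mc (H' 0).
  by rewrite HE sub0r mcM mcN /H' mulr0 subr0 mulr1 mulrC.
have H'n : rho ^+ n < mc (H' 0).
  have : rho ^+ n.+1 < rho * mc (H' 0).
    by apply: lt_le_trans Hn _; rewrite H'0 ler_wpM2r ?mc_ge0 // ltW.
  by rewrite exprS ltr_pM2l.
have H'00 : 0 < mc (H' 0) by apply: lt_trans H'n; rewrite exprn_gt0.
have [h1 [s hs]] := IH H' Phi hH' hP H'1 PH'1 H'n.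
split; last first.
  exists (z1 :: s) => w wr; rewrite HE => /eqP; rewrite mulf_eq0 subr_eq0 inE.
  move=> /orP[/eqP q0|->//]; apply/orP; right; apply: hs => //.
  by rewrite /H' q0 mul0r.
move=> w wr; apply: le_trans (h1 w wr) _.
have c0 : 0 <= (rho + mc w) / (rho - mc w).
  have w0 := mc_ge0 w; apply: divr_ge0; lra.
rewrite ler_expR ler_wpM2l // lerN2 ler_ln ?posrE // H'0.
by rewrite ler_piMl ?(ltW H'00) // ltW.
Qed.

Lemma exists_pow_lt rho c : 0 < rho -> rho < 1 -> 0 < c -> exists n, rho ^+ n < c.
Proof.
move=> r0 r1 c0; have h : `|rho| < 1 by rewrite gtr0_norm.
have /cvgrPdist_lt /(_ _ c0) [n _ /(_ n (leqnn n))] := cvg_expr h.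
by rewrite /= sub0r normrN ger0_norm ?exprn_ge0 ?(ltW r0) // => ?; exists n.
Qed.

(** A disc slightly larger than the given one is rescaled to the unit disc, and [disc_growth] with
    Phi = 0 lists the zeros. *)
Lemma finite_zeros f a r r' : 0 < r -> r < r' -> (forall w, mc (w - a) < r' -> holo f w) ->
  f a != 0 -> exists s : seq C, forall w, mc (w - a) < r -> f w = 0 -> w \in s.
Proof.
move=> r0 rr hf fa; pose r1 := (r + r') / 2.
have r1r : r < r1 by rewrite /r1; lra.
have r1r' : r1 < r' by rewrite /r1; lra.
have r10 : 0 < r1 by lra.
clearbody r1.
have [N N0 hN] : exists2 N, 0 < N & forall w, mc (w - a) <= r1 -> mc (f w) <= N.
  by apply: disc_bound (ltW r10) _ => w wr; apply/holo_cont/hf; lra.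
pose H w := f (a + r1%:C * w) / N%:C.
have inb w : mc w < 1 -> mc (a + r1%:C * w - a) < r1.
  by move=> w1; rewrite addrAC subrr add0r mcM mcR gtr0_norm // gtr_pMr.
have NC : N%:C != 0 :> C by rewrite -mc_gt0 mcR gtr0_norm.
have RC : r1%:C != 0 :> C by rewrite -mc_gt0 mcR gtr0_norm.
have hH w : mc w < 1 -> holo H w.
  move=> w1; apply: holo_div; [exact: NC| |exact: holo_cst].
  apply: (@holo_comp _ f (fun w => a + r1%:C * w)).
    apply: holoD; first exact: holo_cst.
    by apply: holoM; [exact: holo_cst|exact: holo_id].
  by apply: hf; have := inb w w1; lra.
have H1 w : mc w < 1 -> mc (H w) <= 1.
  move=> w1; rewrite /H mc_div mcR gtr0_norm // ler_pdivrMr // mul1r hN //.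
  by apply: ltW; exact: inb.
have H0 : 0 < mc (H 0) by rewrite mc_gt0 /H mulr0 addr0 mulf_neq0 // invr_neq0.
have q0 : 0 < r / r1 by rewrite divr_gt0.
have q1 : r / r1 < 1 by rewrite ltr_pdivrMr // mul1r.
have [n hn] := exists_pow_lt q0 q1 H0.
have [||_ [s hs]] := @disc_growth n _ H (fun=> 0) q0 q1 hH _ H1 _ hn.
- by move=> w _; exact: holo_cst.
- by move=> w _; rewrite mul0r mc0.
exists [seq a + r1%:C * w | w <- s] => w wr fw.
have wE : w = a + r1%:C * ((w - a) / r1%:C) by field.
rewrite wE; apply: map_f; apply: hs; last by rewrite /H -wE fw mul0r.
by rewrite mc_div mcR gtr0_norm // ltr_pM2r // invr_gt0.
Qed.

Lemma finite_avoid (s : seq C) z1 : exists2 d : R, 0 < d &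
  forall z, z \in s -> z != z1 -> d <= mc (z - z1).
Proof.
elim: s => [|x s [d d0 hd]]; first by exists 1.
have [->|xz] := eqVneq x z1.
  by exists d => // z; rewrite inE => /predU1P[->|/hd//]; rewrite eqxx.
exists (Num.min d (mc (x - z1))); first by rewrite lt_min d0 mc_gt0 subr_eq0.
move=> z; rewrite inE ge_min => /predU1P[-> _|zs zz]; first by rewrite lexx orbT.
by rewrite hd.
Qed.

(** Zeros are finite in number in a disc about z0 that contains the unit disc about z1; this
    replaces the identity theorem. *)
Lemma isolated_zeros f z0 z1 : (forall w, holo f w) -> f z0 != 0 ->
  exists2 d : R, 0 < d & forall z, z != z1 -> mc (z - z1) < d -> f z != 0.
Proof.
move=> hf f0; have m0 := mc_ge0 (z1 - z0).
have [|||s hs] := @finite_zeros f z0 (mc (z1 - z0) + 1) (mc (z1 - z0) + 2) _ _ _ f0.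
- lra.
- lra.
- by move=> w _; exact: hf.
have [d d0 hd] := finite_avoid s z1.
exists (Num.min 1 d); first by rewrite lt_min ltr01.
move=> z zz; rewrite lt_min => /andP[h1 h2]; apply/eqP => fz.
have : z \in s by apply: hs => //; have := mc_tri z z1 z0; lra.
by move=> /hd /(_ zz); lra.
Qed.

End DiscGrowth.

(** * The upper half-plane *)

Section UpperHalfPlane.
Variable R : realType.
Local Notation C := R[i].
Implicit Types (f g h F phi : C -> C) (z w p a : C) (A M k : R).
Local Notation uhp := (@upper_half_plane R).

Lemma cdifferentiableP f z : cdifferentiable f z <-> holo f z.
Proof.
split => [h|[d /is_derive_cderP h]]; last first.
  by have := @ex_derive _ _ _ _ _ _ _ h.
by exists ('D_1 (f : C^o -> C^o) (z : C^o)); apply/is_derive_cderP; exact: derivableP.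
Qed.

Lemma inv_im z : complex.Im z^-1 = - complex.Im z / mc z ^+ 2.
Proof. by rewrite mc_sqr; case: z => a b /=; rewrite mulNr. Qed.
Lemma inv_re z : complex.Re z^-1 = complex.Re z / mc z ^+ 2.
Proof. by rewrite mc_sqr; case: z => a b /=. Qed.

Section Cayley.
Variable z0 : C.
Hypothesis z0u : uhp z0.
Let y0 : 0 < complex.Im z0. Proof. exact: z0u. Qed.
Definition cayley z : C := (z - z0) / (z - conjc z0).
Definition cayley_inv w : C := (z0 - conjc z0 * w) / (1 - w).

Lemma uhp_conj_neq z : uhp z -> z - conjc z0 != 0.
Proof.
move=> zu; apply/eqP => /(congr1 (@complex.Im R)); rewrite !cE /=.
by move: zu y0; rewrite /upper_half_plane /=; lra.
Qed.
Lemma cayleyK z : uhp z -> cayley_inv (cayley z) = z.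
Proof.
move=> zu; have := uhp_conj_neq zu; have := uhp_conj_neq z0u => h1 h2.
rewrite /cayley_inv /cayley; field; rewrite h2 /=.
by have -> : z - conjc z0 - (z - z0) = z0 - conjc z0 by ring.
Qed.
Lemma cayley_sqr z : uhp z ->
  1 - mc (cayley z) ^+ 2 = 4 * complex.Im z * complex.Im z0 / mc (z - conjc z0) ^+ 2.
Proof.
move=> zu; have d0 : 0 < mc (z - conjc z0) ^+ 2.
  by rewrite exprn_gt0 // mc_gt0 uhp_conj_neq.
rewrite /cayley mc_div expr_div_n; apply/eqP; rewrite eq_sym -(subr_eq0 _ (1 - _)).
rewrite -{2}(divff (lt0r_neq0 d0)) -mulrBl -mulrBl mulf_eq0; apply/orP; left.
by rewrite subr_eq0 !mc_sqr !cE /=; apply/eqP; ring.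
Qed.
Lemma cayley_lt1 z : uhp z -> mc (cayley z) < 1.
Proof.
move=> zu; have d0 : 0 < mc (z - conjc z0) ^+ 2.
  by rewrite exprn_gt0 // mc_gt0 uhp_conj_neq.
rewrite -(@ltr_pXn2r _ 2) ?nnegrE ?mc_ge0 // expr1n -subr_gt0 cayley_sqr //.
by rewrite divr_gt0 // !mulr_gt0.
Qed.
Lemma cayley_inv_uhp w : mc w < 1 -> uhp (cayley_inv w) /\ 1 - w != 0.
Proof.
move=> w1; have n1 : 1 - w != 0.
  by apply/eqP => /eqP; rewrite subr_eq0 => /eqP w1'; move: w1; rewrite -w1' mc1 ltxx.
split => //; have d0 : 0 < mc (1 - w) ^+ 2 by rewrite exprn_gt0 // mc_gt0.
rewrite /upper_half_plane /= /cayley_inv imM inv_im inv_re.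
have -> : complex.Re (z0 - conjc z0 * w) * (- complex.Im (1 - w) / mc (1 - w) ^+ 2) +
  complex.Im (z0 - conjc z0 * w) * (complex.Re (1 - w) / mc (1 - w) ^+ 2) =
  complex.Im z0 * (1 - mc w ^+ 2) / mc (1 - w) ^+ 2.
  by rewrite [mc w ^+ 2]mc_sqr !cE /=; ring.
by rewrite divr_gt0 // mulr_gt0 // subr_gt0 expr_lt1 ?mc_ge0.
Qed.
Lemma holo_cayley_inv w : mc w < 1 -> holo cayley_inv w.
Proof.
move=> /cayley_inv_uhp[_ n1]; apply: holo_div => //; apply: holoB; try exact: holo_cst.
  by apply: holoM; [exact: holo_cst|exact: holo_id].
exact: holo_id.
Qed.
Lemma cayley_cont z : uhp z -> ccont setT cayley z.
Proof.
move=> zu; apply/holo_cont; apply: holo_div; [exact: uhp_conj_neq| |];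
by apply: holoB; [exact: holo_id|exact: holo_cst].
Qed.
End Cayley.

Lemma uhp_isolated f z0 z1 : (forall z, uhp z -> holo f z) -> uhp z0 -> uhp z1 ->
  f z0 != 0 -> exists2 d : R, 0 < d &
    forall z, uhp z -> z != z1 -> mc (z - z1) < d -> f z != 0.
Proof.
move=> hf u0 u1 f0; have c1 := cayley_lt1 u0 u1; have c0 := mc_ge0 (cayley z0 z1).
set r := (1 + mc (cayley z0 z1)) / 2.
have r0 : 0 < r by rewrite /r; lra.
have r1 : r < 1 by rewrite /r; lra.
have cr : mc (cayley z0 z1) < r by rewrite /r; lra.
clearbody r.
have [||s hs] := @finite_zeros R (fun w => f (cayley_inv z0 w)) 0 r 1 r0 r1.
- move=> w; rewrite subr0 => w1; apply: holo_comp; first exact: holo_cayley_inv.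
  by apply: hf; have [] := cayley_inv_uhp u0 w1.
- by rewrite /cayley_inv mulr0 !subr0 divr1.
have gr0 : 0 < r - mc (cayley z0 z1) by rewrite subr_gt0.
have [e e0 he] := cayley_cont u0 u1 gr0.
have [d d0 hd] := finite_avoid [seq cayley_inv z0 w | w <- s] z1.
exists (Num.min e d); first by rewrite lt_min e0.
move=> z zu zz; rewrite lt_min => /andP[ze zd]; apply/eqP => fz.
have : z \in [seq cayley_inv z0 w | w <- s].
  rewrite -[z](cayleyK u0 zu); apply: map_f; apply: hs; last by rewrite cayleyK.
  by rewrite subr0; have := he z I ze; have := mc_dist (cayley z0 z) (cayley z0 z1); lra.
by move=> /hd /(_ zz); lra.
Qed.

(** Under the Cayley transform 1 / (1 - |zeta|^2) becomes O((1 + |z|^2) / Im z), which is the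
    exponent here. *)
Definition uhp_growth phi (A c : R) := forall z, uhp z ->
  mc (phi z) <= A * expR (c * (1 + mc z ^+ 2) / complex.Im z).

Lemma bounded_type_growth phi h (z0 : C) (Mg Mh : R) :
  (forall z, uhp z -> holo phi z) -> (forall z, uhp z -> holo h z) ->
  (forall z, uhp z -> mc (h z) <= Mh) -> (forall z, uhp z -> mc (phi z * h z) <= Mg) ->
  uhp z0 -> h z0 != 0 -> exists A c, [/\ 0 < A, 0 < c & uhp_growth phi A c].
Proof.
move=> hphi hh hMh hMg u0 h0.
have Mh0 : 0 < Mh by apply: lt_le_trans (hMh z0 u0); rewrite mc_gt0.
pose Mg' := `|Mg| + 1; have Mg'0 : 0 < Mg' by rewrite ltr_wpDl.
have MgE : Mg <= Mg' by rewrite /Mg'; have := ler_norm Mg; lra.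
have MhC : Mh%:C != 0 :> C by rewrite -mc_gt0 mcR gtr0_norm.
have MgC : Mg'%:C != 0 :> C by rewrite -mc_gt0 mcR gtr0_norm.
pose H w := h (cayley_inv z0 w) / Mh%:C.
pose Phi w := phi (cayley_inv z0 w) * (Mh / Mg')%:C.
have inu w : mc w < 1 -> uhp (cayley_inv z0 w) by move=> /(cayley_inv_uhp u0)[].
have hH w : mc w < 1 -> holo H w.
  move=> w1; apply: holo_div => //; last exact: holo_cst.
  by apply: holo_comp; [exact: holo_cayley_inv|exact/hh/inu].
have hP w : mc w < 1 -> holo Phi w.
  move=> w1; apply: holoM; last exact: holo_cst.
  by apply: holo_comp; [exact: holo_cayley_inv|exact/hphi/inu].
have H1 w : mc w < 1 -> mc (H w) <= 1.
  by move=> w1; rewrite /H mc_div mcR gtr0_norm // ler_pdivrMr // mul1r; exact/hMh/inu.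
have PH1 w : mc w < 1 -> mc (Phi w * H w) <= 1.
  move=> w1; have -> : Phi w * H w = phi (cayley_inv z0 w) * h (cayley_inv z0 w) / Mg'%:C.
    have E : (Mh / Mg')%:C = Mh%:C / Mg'%:C :> C by rewrite rmorphM /= fmorphV.
    by rewrite /Phi /H E; field; rewrite MhC MgC.
  rewrite mc_div mcR gtr0_norm // ler_pdivrMr // mul1r.
  by apply: le_trans MgE; exact/hMg/inu.
have ci0 : cayley_inv z0 0 = z0 by rewrite /cayley_inv mulr0 !subr0 divr1.
have H00 : 0 < mc (H 0) by rewrite mc_gt0 /H ci0 mulf_neq0 // invr_neq0.
set p := - ln (mc (H 0)).
have p0 : 0 <= p by rewrite oppr_ge0 ln_le0 // H1 // mc0.
have y0 : 0 < complex.Im z0 by exact: u0.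
have z00 := sqr_ge0 (mc z0).
pose c := 4 * (1 + mc z0 ^+ 2) / complex.Im z0 * p + 1.
have k0 : 0 <= 4 * (1 + mc z0 ^+ 2) / complex.Im z0 by rewrite divr_ge0 ?(ltW y0) //; lra.
exists (Mg' / Mh), c; split.
- by rewrite divr_gt0.
- by rewrite /c ltr_wpDl // mulr_ge0.
move=> z zu; set ze := cayley z0 z; have ze1 : mc ze < 1 by exact: cayley_lt1.
have ze0 := mc_ge0 ze.
(* The radius depends on z, and with it the number n of possible zeros; the bound of [disc_growth]
   does not involve n, so the constants A and c are uniform. *)
pose rho := (1 + mc ze) / 2.
have rho0 : 0 < rho by rewrite /rho; lra.
have rho1 : rho < 1 by rewrite /rho; lra.
have zer : mc ze < rho by rewrite /rho; lra.
have [n hn] := exists_pow_lt rho0 rho1 H00.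
have [hg _] := disc_growth rho0 rho1 hH hP H1 PH1 hn.
have := hg ze zer; rewrite /Phi cayleyK // mcM mcR gtr0_norm ?divr_gt0 // -/p => hle.
have -> : mc (phi z) = (Mg' / Mh) * (mc (phi z) * (Mh / Mg')).
  by field; rewrite !lt0r_neq0.
rewrite ler_pM2l ?divr_gt0 //; apply: le_trans hle _; rewrite ler_expR.
have y1 : 0 < complex.Im z by exact: zu.
have D0 : 0 < mc (z - conjc z0) ^+ 2 by rewrite exprn_gt0 // mc_gt0 uhp_conj_neq.
apply: (@le_trans _ _ (4 * (1 + mc z0 ^+ 2) / complex.Im z0 * ((1 + mc z ^+ 2) / complex.Im z) * p)); last first.
  have N0 : 0 <= (1 + mc z ^+ 2) / complex.Im z by rewrite divr_ge0 ?(ltW y1) // addr_ge0 // sqr_ge0.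
  rewrite /c -[leRHS]mulrA; move: N0; move: (_ / complex.Im z) (_ / complex.Im z0) => N' k; lra.
rewrite ler_wpM2r //.
have d1 : 0 < 1 - mc ze by lra.
have d2 : 0 < 1 - mc ze ^+ 2 by rewrite subr_gt0 expr_lt1.
apply: (@le_trans _ _ (8 / (1 - mc ze ^+ 2))).
  have -> : (rho + mc ze) / (rho - mc ze) = (1 + 3 * mc ze) / (1 - mc ze).
    by rewrite /rho; field; lra.
  rewrite ler_pdivrMr // mulrAC ler_pdivlMr //.
  by have := mulr_ge0 ze0 (ltW d1); nra.
have cz := cayley_sqr u0 zu; rewrite -/ze in cz; rewrite cz.
have -> : 8 / (4 * complex.Im z * complex.Im z0 / mc (z - conjc z0) ^+ 2) =
  2 * mc (z - conjc z0) ^+ 2 / (complex.Im z * complex.Im z0).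
  by field; rewrite !lt0r_neq0 // mc_gt0 uhp_conj_neq.
have -> : 4 * (1 + mc z0 ^+ 2) / complex.Im z0 * ((1 + mc z ^+ 2) / complex.Im z) =
  4 * (1 + mc z0 ^+ 2) * (1 + mc z ^+ 2) / (complex.Im z * complex.Im z0).
  by field; rewrite !lt0r_neq0.
rewrite ler_pM2r ?invr_gt0 ?mulr_gt0 //.
have h1 : mc (z - conjc z0) <= mc z + mc z0 by rewrite -(mcJ z0) mcB.
have h2 : mc (z - conjc z0) ^+ 2 <= (mc z + mc z0) ^+ 2.
  by rewrite ler_pXn2r ?nnegrE ?addr_ge0 ?mc_ge0.
have h3 := sqr_ge0 (mc z - mc z0); have := mulr_ge0 z00 (sqr_ge0 (mc z)).
move: h2 h3; rewrite sqrrD sqrrB; lra.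
Qed.

End UpperHalfPlane.

(** * A Phragmen-Lindelof principle on half discs *)

Section PhragmenLindelof.
Variable R : realType.
Local Notation C := R[i].
Implicit Types (f g h F : C -> C) (z w p a : C) (M k S : R) (K : set C).
Local Notation uhp := (@upper_half_plane R).

(* S^2 * halfdisc_fun S u is harmonic in u on the upper half disc of radius S,
   vanishes on the diameter and equals S^2 / Im u on the half circle. *)
Definition halfdisc_fun S (u : C) : R :=
  complex.Im u / mc (S%:C - u) ^+ 2 + complex.Im u / mc (S%:C + u) ^+ 2.

Lemma halfdisc_funE S u : complex.Im ((S%:C - u)^-1 - (S%:C + u)^-1) = halfdisc_fun S u.
Proof. by rewrite imB !inv_im /halfdisc_fun !cE /=; ring. Qed.

Lemma halfdisc_fun_ge0 S u : 0 <= complex.Im u -> 0 <= halfdisc_fun S u.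
Proof. by move=> u0; rewrite addr_ge0 // divr_ge0 // sqr_ge0. Qed.

Lemma halfdisc_fun_circle S u : 0 < S -> mc u = S -> 0 < complex.Im u ->
  halfdisc_fun S u = (complex.Im u)^-1.
Proof.
move=> S0 uS u0; have E := mc_sqr u; rewrite uS in E.
have h1 : mc (S%:C - u) ^+ 2 = 2 * S * (S - complex.Re u) by rewrite mc_sqr !cE /=; lra.
have h2 : mc (S%:C + u) ^+ 2 = 2 * S * (S + complex.Re u) by rewrite mc_sqr !cE /=; lra.
have P : (S - complex.Re u) * (S + complex.Re u) = complex.Im u ^+ 2 by lra.
have P0 : (S - complex.Re u) * (S + complex.Re u) != 0 by rewrite P expf_neq0 // lt0r_neq0.
move: P0; rewrite mulf_eq0 negb_or => /andP[n1 n2].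
rewrite /halfdisc_fun h1 h2.
have -> : complex.Im u / (2 * S * (S - complex.Re u)) + complex.Im u / (2 * S * (S + complex.Re u)) =
  complex.Im u / ((S - complex.Re u) * (S + complex.Re u)).
  by field; rewrite n1 n2 lt0r_neq0.
by rewrite P expr2; field; rewrite lt0r_neq0.
Qed.

Lemma halfdisc_fun_le S u : 0 <= complex.Im u -> mc u < S ->
  halfdisc_fun S u <= 2 * complex.Im u / (S - mc u) ^+ 2.
Proof.
move=> u0 uS; have d0 : 0 < S - mc u by rewrite subr_gt0.
have S0 : 0 < S by have := mc_ge0 u; lra.
have b v : S - mc u <= mc v -> complex.Im u / mc v ^+ 2 <= complex.Im u / (S - mc u) ^+ 2.
  move=> h; rewrite ler_wpM2l // lef_pV2 ?posrE ?exprn_gt0 //; last by lra.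
  by rewrite ler_pXn2r ?nnegrE ?mc_ge0 // ltW.
have h1 : S - mc u <= mc (S%:C - u) by have := mc_dist S%:C u; rewrite mcR gtr0_norm.
have h2 : S - mc u <= mc (S%:C + u).
  by have := mc_dist S%:C (- u); rewrite mcR gtr0_norm // mcN opprK.
by have := b _ h1; have := b _ h2; rewrite /halfdisc_fun; lra.
Qed.

(* The factor cexp is bounded by 1 and has essential singularities only where
   om w = S or om w = - S; with division by 0 returning 0 its modulus there is
   1, so that the product with F stays upper semicontinuous. *)
Lemma phragmen_lindelof K (om F : C -> C) M S k : 0 < S -> 0 <= k -> 0 <= M ->
  cclosed [set w | K w /\ mc (om w) <= S] -> cbounded [set w | K w /\ mc (om w) <= S] ->
  (forall w, K w -> ccont K F w) -> (forall w, holo om w) ->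
  (forall w, K w -> 0 <= complex.Im (om w)) ->
  (forall w, K w -> mc (om w) < S -> mc (F w) <= M \/
     0 < complex.Im (om w) /\ exists2 r : R, 0 < r & forall v, mc (v - w) < r -> K v /\ holo F v) ->
  (forall w, K w -> mc (om w) = S -> mc (F w) <= M \/
     0 < complex.Im (om w) /\ mc (F w) <= M * expR (k * S ^+ 2 / complex.Im (om w))) ->
  forall w, K w -> mc (om w) < S ->
    mc (F w) <= M * expR (k * S ^+ 2 * halfdisc_fun S (om w)).
Proof.
move=> S0 k0 M0 clK bK cF hom omK hin harc.
(* The map [om] is the identity for the half-plane and squaring for the quadrant; it carries the
   region to an upper half disc of radius S. *)
pose X w := cexp ('i%C * (k * S ^+ 2)%:C * ((S%:C - om w)^-1 - (S%:C + om w)^-1)).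
have mX w : mc (X w) = expR (- (k * S ^+ 2 * halfdisc_fun S (om w))).
  by rewrite /X mc_cexp -halfdisc_funE !cE /=; congr expR; ring.
have X1 w : K w -> mc (X w) <= 1.
  move=> Kw; rewrite mX -expR0 ler_expR oppr_le0.
  by rewrite mulr_ge0 ?halfdisc_fun_ge0 ?omK // mulr_ge0 // sqr_ge0.
have hX w : S%:C - om w != 0 -> S%:C + om w != 0 -> holo X w.
  move=> n1 n2; apply: holo_comp; last exact: holo_cexp.
  apply: holoM; first exact: holo_cst.
  apply: holoB; apply: holoV => //; [apply: holoB|apply: holoD] => //; exact: holo_cst.
have FX w : K w -> mc (F w * X w) <= mc (F w).
  by move=> Kw; rewrite mcM ler_piMr ?mc_ge0 // X1.
have main : forall w, [set w | K w /\ mc (om w) <= S] w -> mc (F w * X w) <= M.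
  apply: max_principle => //.
  - move=> w [Kw wS] e e0.
    have subK : [set w | K w /\ mc (om w) <= S] `<=` K by move=> v [].
    have [/andP[n1 n2]|nn] := boolP ((S%:C - om w != 0) && (S%:C + om w != 0)).
      have cFX : ccont K (fun w => F w * X w) w.
        apply: ccontM; first exact: cF.
        by apply: (@ccont_sub _ _ setT) => //; exact/holo_cont/hX.
      apply: near_in_sub subK _; apply: near_in_imp (cFX e e0) => v _.
      by have := mc_dist (F v * X v) (F w * X w); lra.
    have i0 : complex.Im (om w) = 0.
      move: nn; rewrite negb_and !negbK subr_eq0 addr_eq0 => /orP[/eqP <-//|/eqP E].
      by rewrite -[om w]opprK -E /= oppr0.
    have XE : mc (X w) = 1 by rewrite mX /halfdisc_fun i0 !mul0r addr0 mulr0 oppr0 expR0.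
    apply: near_in_sub subK _; apply: near_in_imp (cF w Kw e e0) => v Kv h.
    rewrite [mc (F w * X w)]mcM XE mulr1; apply: le_lt_trans (FX v Kv) _.
    by have := mc_dist (F v) (F w); lra.
  - move=> w [Kw wS]; have [wE|wn] := eqVneq (mc (om w)) S.
      left; case: (harc w Kw wE) => [h|[i0 h]]; first exact: le_trans (FX w Kw) h.
      rewrite mcM mX halfdisc_fun_circle // -ler_pdivlMr ?expR_gt0 //.
      by rewrite -expRN opprK.
    have wlt : mc (om w) < S by rewrite lt_def eq_sym wn.
    case: (hin w Kw wlt) => [h|[i0 [r r0 hr]]]; first by left; exact: le_trans (FX w Kw) h.
    right; have gap : 0 < S - mc (om w) by rewrite subr_gt0.
    have [s s0 hs] := holo_cont (hom w) gap.
    exists (Num.min r s); first by rewrite lt_min r0.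
    move=> v; rewrite lt_min => /andP[vr vs]; have [Kv hv] := hr v vr.
    have vS : mc (om v) < S by have := hs v I vs; have := mc_dist (om v) (om w); lra.
    split; first by split => //; exact: ltW.
    apply: holoM => //; apply: hX; apply/eqP => /(congr1 (@mc R)); rewrite mc0.
      by have := mc_dist S%:C (om v); rewrite mcR gtr0_norm //; lra.
    by have := mc_dist S%:C (- om v); rewrite mcR gtr0_norm // mcN opprK; lra.
move=> w Kw wS; have := main w (conj Kw (ltW wS)).
by rewrite mcM mX -ler_pdivlMr ?expR_gt0 // -expRN opprK.
Qed.

End PhragmenLindelof.

(** * Phragmen-Lindelof for the half-plane, the quadrant and non-positive mean type *)

Section PLHalfPlane.
Variable R : realType.
Local Notation C := R[i].
Implicit Types (f g h F : C -> C) (z w p a : C) (A c M k S : R) (K : set C).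
Local Notation uhp := (@upper_half_plane R).

Definition cuhp : set C := [set z | 0 <= complex.Im z].

Lemma le_of_le_expR (X M D : R) : 0 < M -> 0 <= D ->
  (forall k, 0 < k -> X <= M * expR (k * D)) -> X <= M.
Proof.
move=> M0 D0 h; rewrite leNgt; apply/negP => MX.
have X0 : 0 < X by lra.
have l0 : 0 < ln (X / M) by rewrite ln_gt0 // ltr_pdivlMr // mul1r.
have D1 : 0 < 2 * (D + 1) by lra.
(* For this k the exponent k D is smaller than ln (X / M). *)
have := h (ln (X / M) / (2 * (D + 1))) (divr_gt0 l0 D1).
rewrite -ler_pdivrMl // mulrC -{1}[X / M](@lnK R) ?posrE ?divr_gt0 // ler_expR.
rewrite mulrAC ler_pdivlMr //; nra.
Qed.

Lemma cclosed_cuhp_ball S : cclosed [set w : C | cuhp w /\ mc w <= S].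
Proof.
move=> p hp; split.
  rewrite /cuhp /= leNgt; apply/negP => p0; have [|w [w0 _] wp] := hp (- complex.Im p); first by lra.
  have := mc_im (w - p); rewrite imB; move: w0; rewrite /cuhp /= => w0.
  by have := ler_norm (complex.Im w - complex.Im p); lra.
apply/ler_addgt0Pr => e e0; have [w [_ ws] wp] := hp e e0.
by have := mc_dist p w; rewrite mc_distC; lra.
Qed.

Lemma exists_large (I : R) : exists2 S, 1 <= S & I <= S.
Proof. by exists (Num.max 1 I); rewrite le_max lexx // orbT. Qed.

Lemma cuhp_real z : complex.Im z = 0 -> z = (complex.Re z)%:C.
Proof. by case: z => a b /= ->. Qed.

(** As S grows, S^2 [halfdisc_fun] S z tends to 2 Im z. An exponent k1 strictly between c and k
    dominates the growth of F on the half circle and leaves room for this limit. *)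
Lemma pl_halfplane F A c M k : 0 < A -> 0 <= c -> 0 < M -> c < k ->
  (forall w, cuhp w -> ccont cuhp F w) -> (forall w, uhp w -> holo F w) ->
  uhp_growth F A c -> (forall x : R, mc (F x%:C) <= M) ->
  forall z, uhp z -> mc (F z) <= M * expR (2 * k * complex.Im z).
Proof.
move=> A0 c0 M0 ck cF hF gF FM z zu.
pose k1 := (k + c) / 2.
have [ck1 k1k] : c < k1 /\ k1 < k by rewrite /k1; lra.
pose b := `|ln A - ln M|.
have z0 := mc_ge0 z.
(* The first term lets M exp (k1 S^2 / Im w) dominate the growth bound on |w| = S, the second
   absorbs the factor (S / (S - |z|))^2 in passing from k1 to k, and the rest puts z inside. *)
have [S S1 HS] := exists_large ((b + c) / (k1 - c) + 2 * k * mc z / (k - k1) + mc z + 1).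
have d1 : 0 < k1 - c by lra.
have d2 : 0 < k - k1 by lra.
have b0 : 0 <= b by rewrite normr_ge0.
have i1 : 0 <= (b + c) / (k1 - c) by rewrite divr_ge0 ?(ltW d1) // addr_ge0.
have i2 : 0 <= 2 * k * mc z / (k - k1).
  by rewrite divr_ge0 ?(ltW d2) // !mulr_ge0 //; lra.
have H1 : b + c <= S * (k1 - c) by rewrite -ler_pdivrMr //; lra.
have H2 : 2 * k * mc z <= S * (k - k1) by rewrite -ler_pdivrMr //; lra.
have H3 : mc z < S by lra.
have S0 : 0 < S by lra.
have zy : 0 < complex.Im z by exact: zu.
have := @phragmen_lindelof R cuhp id F M S k1 S0 _ (ltW M0) (@cclosed_cuhp_ball S) _ cF.
move=> /(_ _ _ _ _ _ _ z (ltW zy) H3) -h.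
apply: le_trans (h _ _ _ _ _ _) _.
- by lra.
- by exists S => w [].
- by move=> w; exact: holo_id.
- by move=> w.
- move=> w w0 ws; have [i0|i0] := eqVneq (complex.Im w) 0.
    by left; rewrite (cuhp_real i0).
  have ip : 0 < complex.Im w by rewrite lt_def i0.
  right; split => //; exists (complex.Im w) => // v vw.
  have : 0 < complex.Im v.
    by have := mc_im (w - v); rewrite imB mc_distC; have := ler_norm (complex.Im w - complex.Im v); clear -vw; lra.
  by move=> vi; split; [exact: ltW|exact: hF].
- move=> w w0 wS; have [i0|i0] := eqVneq (complex.Im w) 0.
    by left; rewrite (cuhp_real i0).
  have ip : 0 < complex.Im w by rewrite lt_def i0.
  right; split => //; apply: le_trans (gF w ip) _; rewrite wS.
  rewrite -{1}[A](@lnK R) ?posrE // -{1}[M](@lnK R) ?posrE // -!expRD ler_expR.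
  rewrite -(ler_pM2r ip) ![(ln _ + _) * _]mulrDl !divfK ?lt0r_neq0 //.
  have iS : complex.Im w <= S by rewrite -wS (le_trans (ler_norm _)) // mc_im.
  have t1 : (ln A - ln M) * complex.Im w <= b * S.
    by apply: (@le_trans _ _ (b * complex.Im w)); [rewrite ler_wpM2r ?(ltW ip) // ler_norm|rewrite ler_wpM2l].
  have t2 : c <= c * S by rewrite ler_peMr.
  have t3 : (b + c) * S <= S * (k1 - c) * S by rewrite ler_wpM2r // ltW.
  by clear -t1 t2 t3; lra.
- rewrite ler_pM2l // ler_expR.
  have dz : 0 < S - mc z by rewrite subr_gt0.
  apply: (@le_trans _ _ (k1 * S ^+ 2 * (2 * complex.Im z / (S - mc z) ^+ 2))).
    apply: ler_wpM2l; last by apply: halfdisc_fun_le => //; exact: ltW.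
    by rewrite mulr_ge0 ?sqr_ge0 //; lra.
  have dz2 : 0 < (S - mc z) ^+ 2 by rewrite exprn_gt0.
  rewrite mulrA ler_pdivrMr //.
  have -> : 2 * k * complex.Im z * (S - mc z) ^+ 2 = (k * (S - mc z) ^+ 2) * (2 * complex.Im z) by ring.
  rewrite ler_wpM2r ?mulr_ge0 ?(ltW zy) //.
  have : 2 * k * mc z * S <= S * (k - k1) * S by rewrite ler_wpM2r // ltW.
  have : 0 <= k * mc z ^+ 2 by rewrite mulr_ge0 ?sqr_ge0 //; lra.
  by rewrite sqrrB; lra.
Qed.

Definition quadrant : set C := [set z | 0 <= complex.Re z /\ 0 <= complex.Im z].

(** Squaring turns exponential growth into growth of order 1/2 in the half-plane, which every k > 0
    dominates; then k tends to 0. *)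
Lemma pl_quadrant F A c M : 0 < A -> 0 <= c -> 0 < M ->
  (forall w, quadrant w -> ccont quadrant F w) ->
  (forall w, 0 < complex.Re w -> 0 < complex.Im w -> holo F w) ->
  (forall w, 0 < complex.Re w -> 0 < complex.Im w -> mc (F w) <= A * expR (c * mc w)) ->
  (forall w, quadrant w -> complex.Re w = 0 \/ complex.Im w = 0 -> mc (F w) <= M) ->
  forall z, 0 < complex.Re z -> 0 < complex.Im z -> mc (F z) <= M.
Proof.
move=> A0 c0 M0 cF hF gF FM z zr zi.
apply: (@le_of_le_expR _ _ (8 * mc z ^+ 2)) => // [|k k0].
  by rewrite mulr_ge0 ?sqr_ge0.
pose b := `|ln A - ln M|; have z0 := mc_ge0 z.
have [T T1 HT] := exists_large ((b + c) / k + 2 * mc z).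
have b0 : 0 <= b by rewrite normr_ge0.
have i1 : 0 <= (b + c) / k by rewrite divr_ge0 ?(ltW k0) // addr_ge0.
have H1 : b + c <= T * k by rewrite -ler_pdivrMr //; lra.
have T0 : 0 < T by lra.
have S0 : 0 < T ^+ 2 by rewrite exprn_gt0.
have mw w : mc (w * w) = mc w ^+ 2 by rewrite mcM expr2.
have wT w : (mc (w * w) <= T ^+ 2) = (mc w <= T).
  by rewrite mw ler_pXn2r ?nnegrE ?mc_ge0 // ltW.
have H2 : mc (z * z) < T ^+ 2 by rewrite mw ltr_pXn2r ?nnegrE ?(ltW T0) //; lra.
have imw w : complex.Im (w * w) = 2 * (complex.Re w * complex.Im w) by rewrite !cE; ring.
have Qz : quadrant z by split; exact: ltW.
have inner w : quadrant w -> mc (F w) <= M \/ 0 < complex.Re w /\ 0 < complex.Im w.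
  move=> Qw; have [a0 a1] := Qw.
  have [i0|i0] := eqVneq (complex.Im w) 0; first by left; apply: FM => //; right.
  have [r0|r0] := eqVneq (complex.Re w) 0; first by left; apply: FM => //; left.
  by right; rewrite !lt_def i0 r0.
have := @phragmen_lindelof R quadrant (fun w => w * w) F M (T ^+ 2) k S0 (ltW k0) (ltW M0) _ _ cF.
move=> /(_ _ _ _ _ _ _ z Qz H2) h.
apply: le_trans (h _ _ _ _ _ _) _.
- move=> p hp.
  have lim (u : C -> R) : (forall v w, u v - u w <= mc (v - w)) ->
      (forall w, quadrant w -> 0 <= u w) -> 0 <= u p.
    move=> ul uq; rewrite leNgt; apply/negP => up; have [|w [Qw _] wp] := hp (- u p); first by rewrite oppr_gt0.
    by have := ul w p; have := uq w Qw; clear -wp; lra.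
  split; first split.
  + apply: (lim (@complex.Re R)); last by move=> w [].
    by move=> v w; rewrite -reB (le_trans (ler_norm _)) // mc_re.
  + apply: (lim (@complex.Im R)); last by move=> w [].
    by move=> v w; rewrite -imB (le_trans (ler_norm _)) // mc_im.
  + rewrite wT; apply/ler_addgt0Pr => e e0; have [w [_]] := hp e e0; rewrite wT => ws wp.
    by have := mc_dist p w; rewrite mc_distC; clear -ws wp; lra.
- by exists T => w [_]; rewrite wT.
- by move=> w; apply: holoM; exact: holo_id.
- by move=> w [w1 w2]; rewrite imw mulr_ge0 // mulr_ge0.
- move=> w Qw _; case: (inner w Qw) => [h1|[w1 w2]]; first by left.
  right; rewrite imw !mulr_gt0 //; split => //.
  exists (Num.min (complex.Re w) (complex.Im w)); first by rewrite lt_min w1.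
  move=> v; rewrite lt_min => /andP[v1 v2].
  have h1 : 0 < complex.Re v.
    by have := mc_re (w - v); rewrite reB mc_distC; have := ler_norm (complex.Re w - complex.Re v); clear -v1; lra.
  have h2 : 0 < complex.Im v.
    by have := mc_im (w - v); rewrite imB mc_distC; have := ler_norm (complex.Im w - complex.Im v); clear -v2; lra.
  by split; [split; exact: ltW|exact: hF].
- move=> w Qw; rewrite mw => wS; case: (inner w Qw) => [h1|[w1 w2]]; first by left.
  have wT' : mc w = T by apply/eqP; rewrite -(@eqrXn2 _ 2) ?mc_ge0 ?(ltW T0) // wS.
  have ip : 0 < complex.Im (w * w) by rewrite imw !mulr_gt0.
  right; split => //; apply: le_trans (gF w w1 w2) _; rewrite wT'.
  rewrite -{1}[A](@lnK R) ?posrE // -{1}[M](@lnK R) ?posrE // -!expRD ler_expR.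
  have iS : complex.Im (w * w) <= T ^+ 2 by rewrite -wS -mw (le_trans (ler_norm _)) // mc_im.
  have t1 : k * T ^+ 2 <= k * (T ^+ 2) ^+ 2 / complex.Im (w * w).
    by rewrite -mulrA ler_pM2l // ler_pdivlMr // [leRHS]expr2 ler_pM2l.
  have t2 : ln A - ln M <= b by rewrite ler_norm.
  have t3 : b <= b * T by rewrite ler_peMr.
  have t4 : (b + c) * T <= T * k * T by rewrite ler_wpM2r // ltW.
  by clear -t1 t2 t3 t4; lra.
- rewrite ler_pM2l // ler_expR -mulrA ler_pM2l //.
  have zT : 4 * mc z ^+ 2 <= T ^+ 2.
    have : (2 * mc z) ^+ 2 <= T ^+ 2 by rewrite ler_pXn2r ?nnegrE ?mulr_ge0 ?(ltW T0) //; lra.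
    by rewrite exprMn; lra.
  have dz : 0 < T ^+ 2 - mc (z * z) by rewrite subr_gt0.
  have zz : 0 <= complex.Im (z * z) by rewrite imw !mulr_ge0 // ltW.
  apply: (@le_trans _ _ ((T ^+ 2) ^+ 2 * (2 * complex.Im (z * z) / (T ^+ 2 - mc (z * z)) ^+ 2))).
    apply: ler_wpM2l; first by rewrite sqr_ge0.
    by apply: halfdisc_fun_le.
  rewrite mulrA ler_pdivrMr ?exprn_gt0 // mw.
  have iz : complex.Im (z * z) <= mc z ^+ 2 by rewrite -mw (le_trans (ler_norm _)) // mc_im.
  move: zT iz zz S0; move: (T ^+ 2) (mc z ^+ 2) (complex.Im (z * z)) => S a i Sa ia i0 S0; clear -Sa ia i0 S0.
  have h1 : S ^+ 2 <= 4 * (S - a) ^+ 2.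
    have : 0 <= (S - 2 * a) * (3 * S - 2 * a) by rewrite mulr_ge0; lra.
    by rewrite sqrrB; lra.
  have : S ^+ 2 * (2 * i) <= 4 * (S - a) ^+ 2 * (2 * a).
    by apply: ler_pM => //; rewrite ?sqr_ge0 ?mulr_ge0 //; lra.
  lra.
Qed.

(** Non-positive mean type without logarithms, see [mean_type_le0]. *)
Definition subexp_imaginary F := forall e : R, 0 < e ->
  exists Y : R, forall y, Y < y -> mc (F (0 +i* y)) <= expR (e * y).

(** The factor exp (i e z) makes F bounded on the positive imaginary axis. The two quadrants then
    give some bound N on the half-plane, [pl_halfplane] with growth constant 0 lowers N to M, and e
    tends to 0. *)
Lemma pl_mean_type F A c M : 0 < A -> 0 <= c -> 0 < M ->
  (forall w, cuhp w -> ccont cuhp F w) -> (forall w, uhp w -> holo F w) ->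
  (forall w, uhp w -> mc (F w) <= A * expR (c * mc w)) ->
  (forall x : R, mc (F x%:C) <= M) -> subexp_imaginary F ->
  forall z, uhp z -> mc (F z) <= M.
Proof.
move=> A0 c0 M0 cF hF gF FM sF z zu.
apply: (@le_of_le_expR _ _ (complex.Im z)) => // [|e e0]; first exact: ltW.
pose G w := F w * cexp ('i%C * e%:C * w).
have mG w : mc (G w) = mc (F w) * expR (- (e * complex.Im w)).
  by rewrite /G mcM mc_cexp !cE /=; congr (_ * expR _); ring.
have GF w : cuhp w -> mc (G w) <= mc (F w).
  move=> w0; rewrite mG ler_piMr ?mc_ge0 // -expR0 ler_expR oppr_le0.
  by rewrite mulr_ge0 // ltW.
suff Gz : mc (G z) <= M.
  by move: Gz; rewrite mG -ler_pdivlMr ?expR_gt0 // -expRN opprK.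
have hexp w : holo (fun w => cexp ('i%C * e%:C * w)) w.
  apply: holo_comp; last exact: holo_cexp.
  by apply: holoM; [exact: holo_cst|exact: holo_id].
have cG w : cuhp w -> ccont cuhp G w.
  move=> w0; apply: ccontM; first exact: cF.
  by apply: (@ccont_sub _ _ setT) => //; exact: holo_cont.
have hG w : uhp w -> holo G w by move=> /hF h; exact: holoM.
have [Y hY] := sF e e0.
pose N := M + 1 + A * expR (c * `|Y|).
have AY : 0 < A * expR (c * `|Y|) by rewrite mulr_gt0 // expR_gt0.
have N0 : 0 < N by rewrite /N; lra.
have Gim y : 0 <= y -> mc (G (0 +i* y)) <= N.
  move=> y0; have [->|yn] := eqVneq y 0.
    apply: le_trans (GF _ _) _; first by rewrite /cuhp /=.
    by have := FM 0; rewrite /N; lra.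
  have yp : 0 < y by rewrite lt_def yn.
  have [Yy|yY] := ltP Y y.
    have : mc (G (0 +i* y)) <= 1.
      rewrite mG /= -ler_pdivlMr ?expR_gt0 // -expRN opprK mul1r; exact: hY.
    by rewrite /N; lra.
  apply: le_trans (GF _ _) _; first by rewrite /cuhp /=.
  apply: le_trans (gF _ _) _; first by rewrite /upper_half_plane /=.
  have : A * expR (c * mc (0 +i* y)) <= A * expR (c * `|Y|).
    rewrite ler_pM2l // ler_expR ler_wpM2l //.
    by rewrite mcE /= expr0n add0r sqrtr_sqr ger0_norm // (le_trans yY) // ler_norm.
  by rewrite /N; lra.
have Gre (x : R) : mc (G x%:C) <= M.
  by apply: le_trans (GF _ _) (FM x); rewrite /cuhp /=.
have Gg w : uhp w -> mc (G w) <= A * expR (c * mc w).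
  by move=> wu; apply: le_trans (GF _ _) (gF w wu); exact: ltW.
have imE w : complex.Re w = 0 -> w = 0 +i* complex.Im w by case: w => a b /= ->.
have GN w : uhp w -> mc (G w) <= N.
  move=> wu; have wi : 0 < complex.Im w by exact: wu.
  have MN : M <= N by rewrite /N; lra.
  have [r0|r0|r0] := ltrgt0P (complex.Re w); last by rewrite (imE _ r0); apply: Gim; exact: ltW.
    apply: (@pl_quadrant G A c N) => //.
    - by move=> v [v1 v2]; apply: ccont_sub (cG v v2) => u [].
    - by move=> v v1 v2; exact: hG.
    - by move=> v v1 v2; exact: Gg.
    - move=> v [v1 v2] [v0|v0]; first by rewrite (imE _ v0); exact: Gim.
      by rewrite (cuhp_real v0); exact: le_trans (Gre _) MN.
  (* The second quadrant is i times the first. *)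
  have -> : w = 'i%C * (- 'i%C * w).
    by rewrite mulrA mulrN -expr2 sqr_i opprK mul1r.
  apply: (@pl_quadrant (fun v => G ('i%C * v)) A c N) => //.
  - move=> v [v1 v2]; apply: (@ccont_comp _ quadrant cuhp G (fun v => 'i%C * v)).
    + by move=> u [u1 u2]; rewrite /cuhp /= !cE /= mul0r add0r mul1r.
    + by apply: ccontM; [exact: ccont_cst|exact: ccont_id].
    + by apply: cG; rewrite /cuhp /= !cE /= mul0r add0r mul1r.
  - move=> v v1 v2; apply: holo_comp; first by apply: holoM; [exact: holo_cst|exact: holo_id].
    by apply: hG; rewrite /upper_half_plane /= !cE /= mul0r add0r mul1r.
  - move=> v v1 v2; have := Gg ('i%C * v); rewrite mcM mc_i mul1r; apply.
    by rewrite /upper_half_plane /= !cE /= mul0r add0r mul1r.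
  - move=> v [v1 v2] [v0|v0].
      apply: le_trans MN; rewrite (_ : 'i%C * v = (- complex.Im v)%:C) //.
      by apply: complex_ext; rewrite !cE /= ?v0; ring.
    rewrite (_ : 'i%C * v = 0 +i* complex.Re v); first exact: Gim.
    by apply: complex_ext; rewrite !cE /= ?v0; ring.
  - by rewrite !cE /=; lra.
  - by rewrite !cE /=; lra.
apply: (@le_of_le_expR _ _ (2 * complex.Im z)) => // [|k k0].
  by rewrite mulr_ge0 // ltW.
have := @pl_halfplane G N 0 M k N0 (lexx _) M0 k0 cG hG _ Gre z zu.
rewrite mulrCA mulrA; apply => w wu.
by rewrite !mul0r expR0 mulr1; exact: GN.
Qed.

End PLHalfPlane.

(** * Square integrable boundary values *)

Section HardyBound.
Variable R : realType.
Local Notation C := R[i].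
Implicit Types (f g h F : C -> C) (z w p a : C) (A c M k S : R) (K : set C).
Local Notation uhp := (@upper_half_plane R).
Local Notation uhpc := (@cuhp R).

Variables (O : set C) (phi : C -> C).
Hypotheses (oO : copen O) (cO : uhpc `<=` O) (hphi : forall z, O z -> holo phi z).

(** O need not be star-shaped; this part of it is star-shaped about i, still open, and still
    contains the closed half-plane. *)
Definition star_part : set C :=
  [set z | forall t : R, 0 <= t <= 1 -> O ('i%C + t%:C * (z - 'i%C))].

Lemma star_part_cuhp : uhpc `<=` star_part.
Proof.
move=> z z0 t /andP[t0 t1]; apply: cO; rewrite /cuhp /= !cE /= mul0r addr0.
have : 0 <= t * complex.Im z by rewrite mulr_ge0.
lra.
Qed.

Lemma star_part_cstar : cstar star_part 'i%C.
Proof.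
split; first by apply: star_part_cuhp; rewrite /cuhp /=.
move=> z s zs s01 t t01; have -> : 'i%C + t%:C * ('i%C + s%:C * (z - 'i%C) - 'i%C) =
  'i%C + (t * s)%:C * (z - 'i%C) by rewrite rmorphM /=; ring.
apply: zs; case/andP: s01 => s0 s1; case/andP: t01 => t0 t1.
by rewrite mulr_ge0 //= mulr_ile1.
Qed.

(** If it were not open at z, points of nearby segments outside O would have parameters clustering
    at some t in [0, 1], where O contains a disc. *)
Lemma star_part_open : copen star_part.
Proof.
move=> z zN; apply: contrapT => nz.
have /choice[W hW] : forall n : nat, exists wt : C * R, [/\ mc (wt.1 - z) < n.+1%:R^-1,
    0 <= wt.2 <= 1 & ~ O ('i%C + wt.2%:C * (wt.1 - 'i%C))].
  move=> n; apply: contrapT => nh; apply: nz; exists n.+1%:R^-1; first by rewrite invr_gt0.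
  move=> w wz t t01; apply: contrapT => nO; apply: nh; by exists (w, t).
have [n|tl htl] := @bounded_cluster R (fun n => ((W n).2)%:C) 1.
  by have [_ /andP[t0 t1] _] := hW n; rewrite mcR ger0_norm.
set t := complex.Re tl.
have ap e : 0 < e -> exists n, [/\ n.+1%:R^-1 < e & `|(W n).2 - t| < e].
  move=> e0; have [n nn hn] := htl e (Num.truncn e^-1) e0.
  exists n; split.
  - rewrite invf_plt ?posrE //.
    by apply: lt_le_trans (truncnS_gt _) _; rewrite ler_nat.
  - by apply: le_lt_trans hn; apply: le_trans (mc_re _); rewrite reB.
have t01 : 0 <= t <= 1.
  apply/andP; split; rewrite leNgt; apply/negP => h.
    have [|n [_]] := ap (- t); first by lra.
    by have [_ /andP[? ?] _] := hW n; rewrite ltr_norml; lra.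
  have [|n [_]] := ap (t - 1); first by lra.
  by have [_ /andP[? ?] _] := hW n; rewrite ltr_norml; lra.
have [r r0 hr] := oO (zN t t01).
set D := 1 + mc (z - 'i%C); have D0 : 0 < D by rewrite /D; have := mc_ge0 (z - 'i%C); lra.
have [|n [n1 n2]] := ap (r / D); first by rewrite divr_gt0.
have [h1 /andP[h2 h3] h4] := hW n; apply: h4; apply: hr.
have -> : 'i%C + (W n).2%:C * ((W n).1 - 'i%C) - ('i%C + t%:C * (z - 'i%C)) =
  (W n).2%:C * ((W n).1 - z) + ((W n).2 - t)%:C * (z - 'i%C) by rewrite rmorphB /=; ring.
apply: le_lt_trans (mcD _ _) _; rewrite !mcM !mcR ger0_norm //.
have -> : r = r / D + r / D * mc (z - 'i%C).
  by rewrite -{1}[r / D]mulr1 -mulrDr divfK // lt0r_neq0.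
apply: ltr_leD; last by rewrite ler_wpM2r ?mc_ge0 // ltW.
by apply: le_lt_trans (lt_trans h1 n1); rewrite ler_piMl ?mc_ge0.
Qed.

Lemma star_part_sub : star_part `<=` O.
Proof. by move=> z /(_ 1); rewrite mul1r addrC subrK; apply; rewrite ler01 lexx. Qed.

Lemma uhp_primitive f : (forall z, O z -> holo f z) ->
  exists Psi, forall z, star_part z -> cder setT Psi z (f z).
Proof.
move=> hf; apply: star_primitive star_part_open star_part_cstar _ _.
  by move=> z /star_part_sub/hf/holo_cont.
by move=> z /star_part_sub/hf.
Qed.

(* The integral of |phi|^2 over every segment, expressed by a primitive U, is at
   most B. *)
Definition l2_bound B := forall a b : R, a < b -> exists U : C -> C,
  (forall t : R, a <= t <= b -> cder (seg a b) U t%:C (mc (phi t%:C) ^+ 2)%:C) /\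
  complex.Re (U b%:C) - complex.Re (U a%:C) <= B.

Hypothesis (A c : R) (A0 : 0 < A) (c0 : 0 <= c) (gphi : uhp_growth phi A c).
Hypothesis (sphi : subexp_imaginary phi).
Variable B : R.
Hypotheses (B0 : 0 < B) (l2phi : l2_bound B).

(* F d z = Psi (z + d) - Psi z, the integral of phi over [z, z + d], is bounded
   on the real line by sqrt (d B), hence on the upper half-plane. *)
Lemma hardy_bound z : uhp z -> mc (phi z) ^+ 2 * complex.Im z <= 25 * B.
Proof.
have [Psi hPsi] := uhp_primitive hphi.
have shift w (t : R) : 0 <= t -> complex.Im (w + t%:C) = complex.Im w by rewrite !cE /= addr0.
have uc w : uhp w -> uhpc w by move=> /ltW.
have hP w : uhpc w -> cder setT Psi w (phi w) by move=> /star_part_cuhp/hPsi.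
pose F (d : R) w := Psi (w + d%:C) - Psi w.
have dsh (d : R) w : cder setT (fun v => v + d%:C) w 1.
  by have := cderD (cder_id setT w) (cder_cst setT d%:C w); rewrite addr0.
have dF d w : 0 <= d -> uhpc w -> cder setT (F d) w (phi (w + d%:C) - phi w).
  move=> d0 wu; apply: cderB; last exact: hP.
  rewrite -[phi (w + _)]mulr1; apply: (@cder_comp _ _ setT) => //.
  by apply: hP; rewrite /cuhp /= shift.
have cF d w : 0 <= d -> uhpc w -> ccont uhpc (F d) w.
  by move=> d0 wu; apply: (@ccont_sub _ _ setT) => //; exact: cder_cont (dF d w d0 wu).
have hF d w : 0 <= d -> uhp w -> holo (F d) w.
  by move=> d0 /uc wu; eexists; exact: dF.
have Freal d (x : R) : 0 < d -> mc (F d x%:C) <= Num.sqrt (d * B).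
  move=> d0; have sd : 0 < Num.sqrt d by rewrite sqrtr_gt0.
  have sB : 0 < Num.sqrt B by rewrite sqrtr_gt0.
  (* Cauchy-Schwarz is obtained from |phi| <= (e / 2) |phi|^2 + 1 / (2 e); this e minimises (e / 2)
     B + d / (2 e), with value sqrt (d B). *)
  pose e := Num.sqrt d / Num.sqrt B; have e0 : 0 < e by rewrite divr_gt0.
  have xd' : x < x + d by lra.
  have xd := ltW xd'; have [U [dU h1]] := l2phi xd'.
  have := @curve_mvt R x (x + d) Psi phi (fun z => (e / 2)%:C * U z + (2 * e)^-1%:C * z)
    (fun z => (0 * U z + (e / 2)%:C * (mc (phi z) ^+ 2)%:C) + (0 * z + (2 * e)^-1%:C * 1)) xd.
  have -> : Psi (x + d)%:C - Psi x%:C = F d x%:C by rewrite /F rmorphD.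
  move=> h; apply: le_trans (h _ _ _) _.
  - move=> t _; have t0 : uhpc t%:C by rewrite /cuhp /=.
    by apply: cder_sub (hP _ t0).
  - move=> t tt; apply: cderD; apply: cderM; try exact: cder_cst; last exact: cder_id.
    exact: dU.
  - move=> t _; rewrite !mul0r !add0r mulr1 -rmorphM -rmorphD /= invfM.
    set y := mc _; have : 0 <= (e * y - 1) ^+ 2 / (2 * e).
      by rewrite divr_ge0 ?sqr_ge0 // mulr_ge0 // ltW.
    have -> : (e * y - 1) ^+ 2 / (2 * e) = e / 2 * y ^+ 2 + 2^-1 / e - y.
      by field; rewrite lt0r_neq0.
    lra.
  - rewrite !cE /= !mul0r !subr0.
    apply: (@le_trans _ _ (e / 2 * B + (2 * e)^-1 * d)).
      have : e / 2 * (complex.Re (U (x + d)%:C) - complex.Re (U x%:C)) <= e / 2 * B.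
        by rewrite ler_wpM2l // divr_ge0 // ltW.
      lra.
    rewrite sqrtrM ?(ltW d0) //.
    have -> : e / 2 * B = Num.sqrt d * Num.sqrt B / 2.
      by rewrite -{1}[B]sqr_sqrtr ?(ltW B0) // /e; field; rewrite lt0r_neq0.
    have -> : (2 * e)^-1 * d = Num.sqrt d * Num.sqrt B / 2.
      by rewrite -{1}[d]sqr_sqrtr ?(ltW d0) // /e; field; rewrite !lt0r_neq0.
    lra.
have Fseg d w M v : 0 <= d -> uhpc w -> (forall t, 0 <= t <= d -> mc (phi (w + t%:C) - v) <= M) ->
    mc (F d w - d%:C * v) <= M * d.
  move=> d0 wu hM.
  have := @curve_mvt_cst R 0 d M (fun t => Psi (w + t) - t * v) (fun t => phi (w + t) - v) d0.
  rewrite mul0r subr0 addr0 subr0 addrAC => h; apply: h => t t0d; last exact: hM.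
  apply: cderB; last first.
    by have := cderM (cder_id (seg 0 d) t%:C) (cder_cst _ v t%:C); rewrite mul1r mulr0 addr0.
  rewrite -[phi (w + _)]mulr1; apply: (@cder_comp _ _ setT) => //.
    by have := cderD (cder_cst (seg 0 d) w t%:C) (cder_id _ t%:C); rewrite add0r.
  by apply: hP; rewrite /cuhp /= shift //; case/andP: t0d.
have Fseg0 d w M : 0 <= d -> uhpc w -> (forall t, 0 <= t <= d -> mc (phi (w + t%:C)) <= M) ->
    mc (F d w) <= M * d.
  move=> d0 wu hM; rewrite -[F d w]subr0 -(mulr0 d%:C); apply: Fseg => // t t0.
  by rewrite subr0; exact: hM.
have gF d : 0 < d -> uhp_growth (F d) (A * d) (c * (2 + 2 * d ^+ 2)).
  move=> d0 w wu; have wi : 0 < complex.Im w by exact: wu.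
  set X := expR _; rewrite [A * d * X]mulrAC.
  apply: Fseg0; [exact: ltW|exact: uc|move=> t /andP[t0 td]; rewrite /X].
  apply: le_trans (gphi _) _; first by rewrite /upper_half_plane /= shift.
  rewrite shift // ler_pM2l // ler_expR ler_pM2r ?invr_gt0 // -[leRHS]mulrA ler_wpM2l //.
  have h1 : mc (w + t%:C) <= mc w + d.
    by apply: le_trans (mcD _ _) _; rewrite mcR ger0_norm // lerD2l.
  have h2 : mc (w + t%:C) ^+ 2 <= (mc w + d) ^+ 2.
    by rewrite ler_pXn2r ?nnegrE ?addr_ge0 ?mc_ge0 // ltW.
  have h3 := sqr_ge0 (mc w - d); have := mulr_ge0 (sqr_ge0 d) (sqr_ge0 (mc w)).
  by have := sqr_ge0 (mc w); move: h2 h3; rewrite sqrrD sqrrB; lra.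
have kpos d : 0 <= c * (2 + 2 * d ^+ 2).
  by rewrite mulr_ge0 // addr_ge0 // mulr_ge0 // sqr_ge0.
have sdB d : 0 < d -> 0 < Num.sqrt (d * B) by move=> d0; rewrite sqrtr_gt0 mulr_gt0.
have F1 d w k : 0 < d -> c * (2 + 2 * d ^+ 2) < k -> uhp w ->
    mc (F d w) <= Num.sqrt (d * B) * expR (2 * k * complex.Im w).
  move=> d0 hk wu; apply: (@pl_halfplane R (F d) (A * d) (c * (2 + 2 * d ^+ 2))) => //.
  - exact: mulr_gt0.
  - exact: sdB.
  - by move=> v vu; apply: cF => //; exact: ltW.
  - by move=> v vu; apply: hF => //; exact: ltW.
  - exact: gF.
  - by move=> x; exact: Freal.
(* The derivative of F t is phi (w + t) - phi w; Cauchy's estimate on the disc of radius Im w / 2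
   bounds it. *)
have diff t w M k : 0 < t -> 0 <= k -> 0 <= M -> uhp w ->
    (forall v, uhp v -> mc (F t v) <= M * expR (k * complex.Im v)) ->
    mc (phi (w + t%:C) - phi w) <= 4 * M * expR (2 * k * complex.Im w) / complex.Im w.
  move=> t0 k0 M0 wu hM; have wi : 0 < complex.Im w by exact: wu.
  have near v : mc (v - w) < complex.Im w -> uhp v.
    move=> vw; have := mc_im (w - v); rewrite imB mc_distC /upper_half_plane /=.
    by have := ler_norm (complex.Im w - complex.Im v); lra.
  have := @cauchy_est R (F t) w (complex.Im w / 2) (complex.Im w)
    (M * expR (2 * k * complex.Im w)) (phi (w + t%:C) - phi w).
  have -> : 2 * (M * expR (2 * k * complex.Im w)) / (complex.Im w / 2) =
    4 * M * expR (2 * k * complex.Im w) / complex.Im w.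
    by field; rewrite lt0r_neq0.
  apply; [lra|lra| | |by apply: dF; [exact: ltW|exact: uc]].
    by move=> v /near vu; apply: hF => //; exact: ltW.
  move=> v vw; have vu : uhp v by apply: near; rewrite vw; lra.
  apply: le_trans (hM v vu) _; rewrite ler_wpM2l // ler_expR.
  have : complex.Im v <= 2 * complex.Im w.
    have := mc_im (v - w); rewrite imB vw; have := ler_norm (complex.Im v - complex.Im w); lra.
  by move=> h; have := ler_wpM2l k0 h; lra.
(* For d <= 1 the growth constant c (2 + 2 d^2) is at most 4 c, so [F1] applies with k = 4 c + 1. *)
pose K := 2 * (4 * c + 1); have K0 : 0 < K by rewrite /K mulr_gt0 // ltr_wpDl // mulr_ge0.
pose sB := Num.sqrt B; have sB0 : 0 < sB by rewrite sqrtr_gt0.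
(* Away from the real line phi itself is controlled: it is the average F 1 w up to the differences
   in [diff], whence 5 = 1 + 4. *)
have phiK w : 1 <= complex.Im w -> mc (phi w) <= 5 * sB * expR (2 * K * complex.Im w).
  move=> w1; have wu : uhp w by rewrite /upper_half_plane /=; lra.
  have F1t t v : 0 < t -> t <= 1 -> uhp v -> mc (F t v) <= sB * expR (K * complex.Im v).
    move=> t0 t1 vu; have vi : 0 < complex.Im v by exact: vu.
    apply: le_trans (@F1 t v (4 * c + 1) t0 _ vu) _.
      have : t ^+ 2 <= 1 by rewrite expr_le1 // ltW.
      by move=> t2; have := ler_wpM2l c0 t2; lra.
    rewrite -/K ler_pM2r ?expR_gt0 // ler_wsqrtr // ler_piMl // ltW //.
  have h1 : mc (F 1 w - 1%:C * phi w) <= 4 * sB * expR (2 * K * complex.Im w) * 1.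
    apply: Fseg => // [|t /andP[t0 t1]]; first exact: uc.
    have [->|tn] := eqVneq t 0.
      by rewrite addr0 subrr mc0 !mulr_ge0 ?expR_ge0 // ltW.
    have tp : 0 < t by rewrite lt_def tn.
    apply: le_trans (@diff t w sB K tp (ltW K0) (ltW sB0) wu _) _.
      by move=> v vu; exact: F1t.
    have i1 : (complex.Im w)^-1 <= 1 by rewrite invf_le1 //; lra.
    by rewrite ler_piMr // !mulr_ge0 ?expR_ge0 // ltW.
  have h2 := F1t 1 w ltr01 (lexx _) wu.
  have h3 : expR (K * complex.Im w) <= expR (2 * K * complex.Im w).
    by rewrite ler_expR; have := mulr_ge0 (ltW K0) (ltW (lt_le_trans ltr01 w1)); lra.
  have h4 := ler_wpM2l (ltW sB0) h3.
  have : mc (phi w) <= mc (F 1 w) + mc (F 1 w - 1%:C * phi w).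
    have {1}-> : phi w = F 1 w - (F 1 w - 1%:C * phi w) by ring.
    exact: mcB.
  by move: h1 h2 h4; rewrite !mulr1; lra.
pose A1 := 5 * sB * expR (2 * K); have A10 : 0 < A1 by rewrite !mulr_gt0 ?expR_gt0.
(* Here non-positive mean type enters: [phiK] is the exponential growth from which [pl_mean_type],
   applied to phi (v + i), deduces boundedness. *)
have phib w : 1 <= complex.Im w -> mc (phi w) <= A1.
  move=> w1; pose p1 v := phi (v + 'i%C).
  have up v : uhpc v -> 1 <= complex.Im (v + 'i%C).
    by rewrite /cuhp /= !cE /=; lra.
  have hp1 v : uhpc v -> holo p1 v.
    move=> /up v1; apply: holo_comp.
      by apply: holoD; [exact: holo_id|exact: holo_cst].
    by apply/hphi/cO; rewrite /cuhp /=; lra.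
  have p1r (x : R) : mc (p1 x%:C) <= A1.
    by have := phiK (x%:C + 'i%C); rewrite !cE /= add0r mulr1; apply.
  have [wE|wn] := eqVneq (complex.Im w) 1.
    have -> : w = (complex.Re w)%:C + 'i%C by apply: complex_ext; rewrite !cE /= ?wE; ring.
    exact: p1r.
  have -> : w = (w - 'i%C) + 'i%C by rewrite subrK.
  apply: (@pl_mean_type R p1 A1 (2 * K) A1) => //.
  - by rewrite mulr_ge0 // ltW.
  - by move=> v /hp1/holo_cont; exact: ccont_sub.
  - by move=> v /uc/hp1.
  - move=> v vu; apply: le_trans (phiK _ (up _ (uc _ vu))) _.
    rewrite /A1 -[leRHS]mulrA -expRD ler_pM2l ?mulr_gt0 // ler_expR !cE /=.
    by have h := le_trans (ler_norm _) (mc_im v); have := ler_wpM2l (ltW K0) h; lra.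
  - move=> e e0; have e20 : 0 < e / 2 by rewrite divr_gt0.
    have [Y hY] := sphi e20; exists (Num.max 1 Y) => y; rewrite gt_max => /andP[y1 yY].
    rewrite /p1 (_ : _ + 'i%C = 0 +i* (y + 1)); last by apply: complex_ext; rewrite /= ?addr0.
    apply: le_trans (hY _ _) _; first by lra.
    rewrite ler_expR; have : 0 < e * (y - 1) by rewrite mulr_gt0 // subr_gt0.
    lra.
  - by rewrite /upper_half_plane /= imB /= subr_gt0 lt_def wn.
(* F d is now bounded on the half-plane, by [phib] for Im v >= 1 and by [F1] below; growth constant
   0 in [pl_halfplane] removes the exponential factor. *)
have Fb d w : 0 < d -> uhp w -> mc (F d w) <= Num.sqrt (d * B).
  move=> d0 wu; have wi : 0 < complex.Im w by exact: wu.
  pose k := c * (2 + 2 * d ^+ 2) + 1.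
  have k0 : 0 < k by rewrite /k; have := kpos d; lra.
  pose A2 := A1 * d + Num.sqrt (d * B) * expR (2 * k).
  have A20 : 0 < A2 by rewrite addr_gt0 // mulr_gt0 // ?expR_gt0 // sdB.
  apply: (@le_of_le_expR _ _ _ (2 * complex.Im w)) => [||j j0].
  - exact: sdB.
  - by rewrite mulr_ge0 // ltW.
  have := @pl_halfplane R (F d) A2 0 (Num.sqrt (d * B)) j A20 (lexx _) (sdB d d0) j0.
  rewrite mulrCA mulrA; apply => //.
  - by move=> v vu; apply: cF => //; exact: ltW.
  - by move=> v vu; apply: hF => //; exact: ltW.
  - move=> v vu; rewrite !mul0r expR0 mulr1; have vi : 0 < complex.Im v by exact: vu.
    have [v1|v1] := lerP 1 (complex.Im v).
      apply: (@le_trans _ _ (A1 * d)); last by rewrite lerDl mulr_ge0 ?expR_ge0 // sqrtr_ge0.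
      apply: Fseg0; [exact: ltW|exact: uc|move=> t /andP[t0 _]].
      by apply: phib; rewrite shift.
    apply: le_trans (@F1 d v k d0 _ vu) _; first by rewrite /k; lra.
    apply: (@le_trans _ _ (Num.sqrt (d * B) * expR (2 * k))); last by rewrite lerDr mulr_ge0 // ltW.
    rewrite ler_wpM2l ?sqrtr_ge0 // ler_expR -[leRHS]mulr1 ler_wpM2l //; last exact: ltW.
    by rewrite mulr_ge0 // ltW.
  - by move=> x; exact: Freal.
(* The segment length d = y balances both errors: with s = sqrt (y B), |F y z| <= s and |F y z - y
   phi z| <= 4 s, so y |phi z| <= 5 s, the origin of 25. *)
move=> zu; set y := complex.Im z; have y0 : 0 < y by exact: zu.
pose s := Num.sqrt (y * B); have s0 : 0 < s by exact: sdB.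
have h1 : mc (F y z - y%:C * phi z) <= 4 * s / y * y.
  apply: Fseg => [||t /andP[t0 ty]]; [exact: ltW|exact: uc|].
  have [->|tn] := eqVneq t 0.
    by rewrite addr0 subrr mc0 divr_ge0 ?mulr_ge0 // ltW.
  have tp : 0 < t by rewrite lt_def tn.
  have := @diff t z s 0 tp (lexx _) (ltW s0) zu; rewrite mulr0 mul0r expR0 mulr1; apply.
  move=> v vu; rewrite mul0r expR0 mulr1; apply: le_trans (Fb t v tp vu) _.
  by rewrite ler_wsqrtr // ler_wpM2r // ltW.
have h2 := Fb y z y0 zu; rewrite -/s in h2.
rewrite divfK ?lt0r_neq0 // in h1.
have h3 : y * mc (phi z) <= 5 * s.
  have : mc (y%:C * phi z) <= mc (F y z) + mc (F y z - y%:C * phi z).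
    have {1}-> : y%:C * phi z = F y z - (F y z - y%:C * phi z) by ring.
    exact: mcB.
  by rewrite mcM mcR gtr0_norm //; lra.
have h4 : (y * mc (phi z)) ^+ 2 <= (5 * s) ^+ 2.
  by rewrite ler_pXn2r ?nnegrE ?mulr_ge0 ?mc_ge0 // ltW.
move: h4; rewrite !exprMn sqr_sqrtr ?mulr_ge0 ?(ltW y0) ?(ltW B0) //.
have -> : 5 ^+ 2 = 25 :> R by rewrite -natrX.
move=> h4; rewrite -(ler_pM2l y0); move: h4.
by clearbody y; move: (mc (phi z) ^+ 2) => m; lra.
Qed.

End HardyBound.

(** * Lebesgue integrals on the real line *)

Section RealIntegrals.
Variable R : realType.
Local Notation C := R[i].
Local Notation mu := (@lebesgue_measure R).
Implicit Types (u v w : R -> R) (f g : C -> C) (a b : R).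

Definition rintegrable u := mu.-integrable setT (EFin \o u).

Lemma continuous_re f : (forall x : R, ccont setT f x%:C) ->
  continuous (fun x : R => complex.Re (f x%:C)).
Proof.
move=> cf x; apply/cvgrPdist_lt => e e0; have [r r0 hr] := cf x e e0.
exists r => //= y; rewrite /ball /= => yr; rewrite -reB.
apply: le_lt_trans (mc_re _) _; rewrite mc_distC; apply: hr => //.
by rewrite mcBR distrC.
Qed.

Lemma continuous_measurable_EFin u : continuous u -> measurable_fun [set: R] (EFin \o u).
Proof. by move=> cu; apply/measurable_EFinP; exact: continuous_measurable_fun. Qed.

Lemma cder_is_derive (V : R -> R) (S : set C) (t d : R) : is_derive t 1 V d ->
  (forall z, S z -> complex.Im z = 0) ->
  cder S (fun z => (V (complex.Re z))%:C) t%:C d%:C.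
Proof.
move=> hV S0; apply: eps_cder => e e0.
have [r r0 hr] := (@is_deriveP R V t d).2 hV e e0; exists r => // z Sz.
have -> : z = (complex.Re z)%:C by apply: complex_ext => //=; exact: S0.
move: (complex.Re z) => y; rewrite mcBR => yr.
change (mc ((V y)%:C - (V t)%:C - d%:C * (y%:C - t%:C)) <= e * `|y - t|).
have -> : (V y)%:C - (V t)%:C - d%:C * (y%:C - t%:C) = (V y - V t - d * (y - t))%:C :> C.
  by rewrite !(rmorphB, rmorphM).
by rewrite mcR; exact: hr.
Qed.

Lemma seg_primitive u a b : continuous u -> a < b -> exists V : R -> R,
  (forall x : R, a <= x <= b -> is_derive x 1 V (u x)) /\
  V b - V a = \int[mu]_(x in `[a, b]) u x.
Proof.
move=> cu ab.
pose V x := \int[mu]_(t in [set` `[a - 1, x]]) u t.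
have fi : mu.-integrable [set` `[a - 1, b + 1]] (EFin \o u).
  apply: continuous_compact_integrable; first exact: segment_compact.
  exact: continuous_subspaceT.
have dV x : a <= x <= b -> is_derive x 1 V (u x).
  move=> /andP[ax xb]; have xu : x < b + 1 by lra.
  have [|d1 d2] := continuous_FTC1_closed xu fi _ (cu x); first by lra.
  by apply: DeriveDef; [exact: d1|rewrite -derive1E].
exists V; split => //.
have cV x : a <= x <= b -> {for x, continuous V}.
  by move=> /dV h; apply/differentiable_continuous/derivable1_diffP; exact: ex_derive.
have := @continuous_FTC2 R u V a b ab.
rewrite /Rintegral => ->; first by [].
- exact: continuous_subspaceT.
- split; first by move=> x; rewrite in_itv /= => /andP[h1 h2]; apply: (@ex_derive _ _ _ _ _ _ (u x)); apply: dV; rewrite !ltW.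
    by apply: cvg_at_right_filter; apply: cV; rewrite lexx ltW.
  by apply: cvg_at_left_filter; apply: cV; rewrite lexx ltW.
- move=> x; rewrite in_itv /= => /andP[h1 h2]; rewrite derive1E.
  by apply: (@derive_val _ _ _ _ _ _ (u x)); apply: dV; rewrite !ltW.
Qed.

Lemma primitive_diff u a b (V : R -> R) : continuous u -> a < b ->
  (forall x : R, a <= x <= b -> is_derive x 1 V (u x)) ->
  V b - V a = \int[mu]_(x in `[a, b]) u x.
Proof.
move=> cu ab dV; have [W [dW <-]] := seg_primitive cu ab.
have S0 (z : C) : seg a b z -> complex.Im z = 0 by move=> [t _ ->].
have : mc ((V b)%:C - (W b)%:C - ((V a)%:C - (W a)%:C)) <= 0 * (b - a).
  apply: (@curve_mvt_cst R a b 0 (fun z => (V (complex.Re z))%:C - (W (complex.Re z))%:C)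
    (fun z => (u (complex.Re z))%:C - (u (complex.Re z))%:C) (ltW ab)) => t tt.
    by apply: cderB; apply: cder_is_derive => //; [exact: dV|exact: dW].
  by rewrite subrr mc0.
rewrite (_ : _ - _ = (V b - W b - (V a - W a))%:C); last by rewrite !rmorphB.
by rewrite mcR mul0r normr_le0 => /eqP; lra.
Qed.

Lemma Rintegral_seg_le u a b : continuous u -> (forall x, 0 <= u x) -> rintegrable u ->
  \int[mu]_(x in `[a, b]) u x <= \int[mu]_x u x.
Proof.
move=> cu u0 iu; rewrite /Rintegral fine_le //.
- by apply: integrable_fin_num => //; apply: integrableS iu.
- exact: integrable_fin_num.
- apply: ge0_subset_integral => //; first exact: continuous_measurable_EFin.
  by move=> x _ /=; rewrite lee_fin.
Qed.

Lemma rintegrable_le u v : continuous u -> (forall x, `|u x| <= v x) -> rintegrable v ->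
  rintegrable u.
Proof.
move=> cu uv; apply: le_integrable => //; first exact: continuous_measurable_EFin.
by move=> x _ /=; rewrite lee_fin; apply: le_trans (uv x) _; exact: ler_norm.
Qed.
Lemma rintegrableD u v : rintegrable u -> rintegrable v -> rintegrable (fun x => u x + v x).
Proof. by move=> iu iv; have := integrableD measurableT iu iv; apply. Qed.
Lemma rintegrableB u v : rintegrable u -> rintegrable v -> rintegrable (fun x => u x - v x).
Proof. by move=> iu iv; have := integrableB measurableT iu iv; apply. Qed.
Lemma rintegrableZ (k : R) u : rintegrable u -> rintegrable (fun x => k * u x).
Proof. by move=> iu; have := integrableZl measurableT k iu; apply. Qed.
Lemma rintD u v : rintegrable u -> rintegrable v ->
  \int[mu]_x (u x + v x) = \int[mu]_x u x + \int[mu]_x v x.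
Proof. by move=> iu iv; rewrite RintegralD. Qed.
Lemma rintB u v : rintegrable u -> rintegrable v ->
  \int[mu]_x (u x - v x) = \int[mu]_x u x - \int[mu]_x v x.
Proof. by move=> iu iv; rewrite RintegralB. Qed.
Lemma rintZ (k : R) u : rintegrable u -> \int[mu]_x (k * u x) = k * \int[mu]_x u x.
Proof. by move=> iu; rewrite RintegralZl. Qed.
Lemma rint_le u v : rintegrable u -> rintegrable v -> (forall x, u x <= v x) ->
  \int[mu]_x u x <= \int[mu]_x v x.
Proof. by move=> iu iv h; apply: le_Rintegral. Qed.

Lemma rintegrable_oneDsqr : rintegrable (fun x => (1 + x ^+ 2)^-1).
Proof.
have h0 x : 0 <= (oneDsqr x)^-1 :> R by rewrite invr_ge0 addr_ge0 // sqr_ge0.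
apply/integrableP; split.
  by apply: continuous_measurable_EFin; exact: continuous_oneDsqrV.
under eq_integral => x _ do rewrite /= ger0_norm ?(h0 x) //.
rewrite (@ge0_symfun_integralT R (fun x => (oneDsqr x)^-1)) //; last 2 first.
  exact: continuous_oneDsqrV.
  by move=> x; rewrite /oneDsqr /= sqrrN.
by rewrite -set_itvcy integral0y_oneDsqr -EFinM ltry.
Qed.

(** The weights are the restriction to the real line of the factor 1 - (z / r)^2 used on the half
    circle. On the intervals they lie in [0, 1] and they tend to 1, so dominated convergence
    applies. *)
Lemma rint_vanish v : continuous v -> rintegrable v ->
  (fun n : nat => \int[mu]_(x in `[- n.+1%:R, n.+1%:R]) (v x * (1 - x ^+ 2 / n.+1%:R ^+ 2))) @ \oo --> (0 : R) ->
  \int[mu]_x v x = 0.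
Proof.
move=> cv iv hlim.
pose q n x : R := v x * (1 - x ^+ 2 / n.+1%:R ^+ 2).
have cq n : continuous (q n).
  move=> x; apply: cvgM; first exact: cv.
  apply: cvgB; first exact: cvg_cst.
  by apply: cvgMl; exact: exprn_continuous.
pose D n : set R := `[- n.+1%:R, n.+1%:R]%classic.
pose f_ n : R -> \bar R := (EFin \o q n) \_ (D n).
have mf_ n : measurable_fun setT (f_ n).
  have mD : measurable (D n) by exact: measurable_itv.
  by have /(measurable_restrictT _ mD) := measurable_funTS (D := D n) (continuous_measurable_EFin (cq n)).
have [] := @dominated_convergence _ _ R mu setT measurableT f_ (EFin \o v) (fun x => `|(v x)%:E|%E).
- exact: mf_.
- exact: continuous_measurable_EFin.
- apply: aeW => x _.
  have : (fun n => q n x) @ \oo --> v x.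
    have -> : v x = v x * (1 - x ^+ 2 * (0 * 0)) by ring.
    apply: cvgM; first exact: cvg_cst.
    apply: cvgB; first exact: cvg_cst.
    apply: cvgM; first exact: cvg_cst.
    under eq_fun do rewrite expr2 invfM.
    by apply: cvgM; exact: cvg_harmonic.
  move=> hq; apply: (@cvg_trans _ ((fun n => (q n x)%:E) @ \oo)); last first.
    by apply: cvg_EFin => //; exact: nearW.
  apply: near_eq_cvg; near=> n; rewrite /f_ patchE ifT //.
  apply/mem_set; rewrite /D /= in_itv /= -ler_norml.
  have : `|x| < (Num.truncn `|x|).+1%:R by exact: truncnS_gt.
  move=> /ltW/le_trans; apply; rewrite ler_nat ltnS; near: n; exact: nbhs_infty_ge.
- by have := integrable_abse iv.
- apply: aeW => x n _; rewrite /f_ patchE; case: ifPn => [|_]; last first.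
    by rewrite abse0.
  move=> /set_mem; rewrite /D /= in_itv /= -ler_norml => xn.
  rewrite lee_fin /q normrM ler_piMr // ler_norml.
  have n0 : 0 < n.+1%:R ^+ 2 :> R by rewrite exprn_gt0.
  have : x ^+ 2 / n.+1%:R ^+ 2 <= 1.
    by rewrite ler_pdivrMr // mul1r -real_normK ?num_real // ler_pXn2r ?nnegrE.
  have : 0 <= x ^+ 2 / n.+1%:R ^+ 2 by rewrite divr_ge0 ?sqr_ge0 // ltW.
  by move: (_ / _) => t; lra.
move=> _ _ hc.
have hc2 : (fun n => \int[mu]_(x in D n) (q n x)%:E)%E @ \oo --> (\int[mu]_x (v x)%:E)%E.
  by under eq_fun do rewrite integral_mkcond; exact: hc.
have fn n : (\int[mu]_(x in D n) (q n x)%:E)%E = (\int[mu]_(x in D n) q n x)%:E.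
  have iq : mu.-integrable (D n) (EFin \o q n).
    apply: continuous_compact_integrable; first exact: segment_compact.
    exact: continuous_subspaceT.
  by rewrite /Rintegral fineK //; apply: integrable_fin_num iq; exact: measurable_itv.
have hc3 : (fun n => (\int[mu]_(x in D n) q n x)%:E) @ \oo --> (0 : R)%:E.
  by apply: cvg_EFin => //; exact: nearW.
rewrite /Rintegral -(cvg_lim _ hc2) //.
have -> : (fun n => \int[mu]_(x in D n) (q n x)%:E)%E = (fun n => (\int[mu]_(x in D n) q n x)%:E).
  by apply/funext.
by rewrite (cvg_lim _ hc3).
Unshelve. all: by end_near.
Qed.

End RealIntegrals.

(** * Closing the contour by a half circle *)

Section Contour.
Variable R : realType.
Local Notation C := R[i].
Local Notation uhp := (@upper_half_plane R).
Local Notation uhpc := (@cuhp R).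
Local Notation mu := (@lebesgue_measure R).

(* On the half circle |z| = r the factor 1 - (z / r)^2 has modulus 2 Im z / r,
   which absorbs the singularity of phi at the real line. *)
Lemma contour_bound (phi P : C -> C) (r K : R) : 0 < r -> 0 <= K ->
  (forall z, uhpc z -> cder setT P z (phi z * (1 - (z / r%:C) ^+ 2))) ->
  (forall z, uhp z -> mc (phi z) ^+ 2 * complex.Im z * mc z ^+ 2 <= K ^+ 2) ->
  mc (P r%:C - P (- r)%:C) <= 2 * K / Num.sqrt r * pi.
Proof.
move=> r0 K0 dP hK.
pose Ga (t : C) := r%:C * cexp ('i%C * t).
have GaE (t : R) : Ga t%:C = r%:C * (cos t +i* sin t) by rewrite /Ga cexp_iR.
have Gr (t : R) : mc (Ga t%:C) = r.
  by rewrite GaE mcM mcR gtr0_norm // mcE /= cos2Dsin2 sqrtr1 mulr1.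
have Gi (t : R) : complex.Im (Ga t%:C) = r * sin t.
  by rewrite GaE !cE /= mul0r addr0.
have dGa t : cder setT Ga t (r%:C * (cexp ('i%C * t) * 'i%C)).
  have h1 := cderM (cder_cst setT 'i%C t) (cder_id setT t).
  have h2 := @cder_comp _ _ setT _ _ _ _ _ (fun _ _ => I) h1 (cder_cexp _).
  have h3 := cderM (cder_cst setT r%:C t) h2.
  by apply: cder_eq h3 _; rewrite /=; ring.
have rC : r%:C != 0 :> C by rewrite -mc_gt0 mcR gtr0_norm.
have s0 (t : R) : 0 <= t <= pi -> 0 <= sin t by move=> tt; apply: sin_ge0_pi.
have Gu (t : R) : 0 <= t <= pi -> uhpc (Ga t%:C).
  by move=> tt; change (0 <= complex.Im (Ga t%:C)); rewrite Gi mulr_ge0 ?(ltW r0) // s0.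
have := @curve_mvt_cst R 0 pi (2 * K / Num.sqrt r) (fun t => P (Ga t))
  (fun t => phi (Ga t) * (1 - (Ga t / r%:C) ^+ 2) * (r%:C * (cexp ('i%C * t) * 'i%C))) (pi_ge0 _).
have -> : Ga 0%:C = r%:C by rewrite /Ga mulr0 cexp0 mulr1.
have -> : Ga pi%:C = (- r)%:C.
  by rewrite GaE sinpi cospi; apply: complex_ext; rewrite !cE /=; ring.
rewrite subr0 mc_distC; apply => t tt.
  apply: (@cder_comp _ _ setT P Ga) => //; first exact: cder_sub (dGa t%:C).
  by apply: dP; exact: Gu.
have E : mc (1 - (Ga t%:C / r%:C) ^+ 2) = 2 * sin t.
  have -> : Ga t%:C / r%:C = cos t +i* sin t by rewrite GaE mulrC mulKf.
  have cs := cos2Dsin2 t.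
  have -> : 1 - (cos t +i* sin t) ^+ 2 = (2 * sin t)%:C * (sin t -i* cos t).
    apply: complex_ext; rewrite expr2 !cE /=; last by ring.
    by move: cs; rewrite !expr2; lra.
  rewrite mcM mcR ger0_norm ?mulr_ge0 ?s0 //.
  by rewrite mcE /= sqrrN addrC cs sqrtr1 mulr1.
have D : mc (r%:C * (cexp ('i%C * t%:C) * 'i%C)) = r.
  by rewrite mcM mcR gtr0_norm // (mcM (cexp _)) mc_i mulr1 cexp_iR mcE /= cos2Dsin2 sqrtr1 mulr1.
rewrite mcM (mcM (phi _)) E D.
(* At the two end points [hK] says nothing about phi, but the weight vanishes there. *)
have [st0|st0] := eqVneq (sin t) 0.
  by rewrite st0 !mulr0 mul0r divr_ge0 ?mulr_ge0 ?sqrtr_ge0.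
have stp : 0 < sin t by rewrite lt_def st0 s0.
have st1 := sin_le1 t.
have sr0 : 0 < Num.sqrt r by rewrite sqrtr_gt0.
have zu : uhp (Ga t%:C).
  by change (0 < complex.Im (Ga t%:C)); rewrite Gi mulr_gt0.
have := hK _ zu; rewrite Gi Gr; set m := mc (phi _) => hm.
have m0 : 0 <= m by exact: mc_ge0.
rewrite ler_pdivlMr //.
rewrite -(@ler_pXn2r _ 2) ?nnegrE ?mulr_ge0 ?(ltW sr0) ?(ltW r0) ?(ltW stp) //.
rewrite !exprMn sqr_sqrtr ?(ltW r0) //.
have -> : m ^+ 2 * (2 ^+ 2 * sin t ^+ 2) * r ^+ 2 * r = 2 ^+ 2 * sin t * (m ^+ 2 * (r * sin t) * r ^+ 2).
  by ring.
have hX0 : 0 <= m ^+ 2 * (r * sin t) * r ^+ 2 by rewrite !mulr_ge0 ?sqr_ge0 ?(ltW r0) ?(ltW stp).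
rewrite -mulrA ler_wpM2l ?exprn_ge0 //.
by apply: le_trans hm; rewrite ler_piMl.
Qed.

(** The weighted integral over [- r, r] is the increment of a primitive, which [contour_bound]
    estimates along the half circle as O(r^(-1/2)). *)
Lemma contour_vanish (O : set C) (phi : C -> C) (K : R) : copen O -> uhpc `<=` O ->
  (forall z, O z -> holo phi z) -> 0 <= K ->
  (forall z, uhp z -> mc (phi z) ^+ 2 * complex.Im z * mc z ^+ 2 <= K ^+ 2) ->
  rintegrable (fun x : R => complex.Re (phi x%:C)) ->
  \int[mu]_x complex.Re (phi x%:C) = 0.
Proof.
move=> oO cO hphi K0 hK iphi.
have xO (x : R) : O x%:C by apply: cO; rewrite /cuhp /=.
apply: rint_vanish => //.
  by apply: continuous_re => x; exact/holo_cont/hphi.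
have key n : `|\int[mu]_(x in `[- n.+1%:R, n.+1%:R])
    (complex.Re (phi x%:C) * (1 - x ^+ 2 / n.+1%:R ^+ 2))| <=
    2 * K / Num.sqrt n.+1%:R * pi.
  set r : R := n.+1%:R; have r0 : 0 < r by rewrite ltr0n.
  pose f z := phi z * (1 - (z / r%:C) ^+ 2).
  have hf z : O z -> holo f z.
    move=> Oz; apply: holoM; first exact: hphi.
    apply: holoB; first exact: holo_cst.
    by apply: holoX; apply: holoM; [exact: holo_id|exact: holo_cst].
  have fE (x : R) : complex.Re (f x%:C) = complex.Re (phi x%:C) * (1 - x ^+ 2 / r ^+ 2).
    have -> : f x%:C = phi x%:C * (1 - x ^+ 2 / r ^+ 2)%:C.
      by rewrite /f !(rmorphB, rmorphM, fmorphV, rmorphXn) /= exprMn exprVn.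
    by rewrite reM /= mulr0 subr0.
  have [P hP] := uhp_primitive oO cO hf.
  have dP z : uhpc z -> cder setT P z (f z) by move=> /(star_part_cuhp cO)/hP.
  have rr : - r < r by lra.
  have <- : complex.Re (P r%:C) - complex.Re (P (- r)%:C) =
     \int[mu]_(x in `[- r, r]) (complex.Re (phi x%:C) * (1 - x ^+ 2 / r ^+ 2)).
    under eq_Rintegral do rewrite -fE.
    apply: (@primitive_diff R _ _ _ (fun x => complex.Re (P x%:C))) => //.
      by apply: continuous_re => x; exact/holo_cont/hf.
    move=> x /andP[x1 x2]; apply: (@is_derive_re R (- r - 1) (r + 1)).
      by apply/andP; split; lra.
    by apply: cder_sub (dP x%:C _) => //; rewrite /cuhp /=.
  by rewrite -reB; apply: le_trans (mc_re _) _; apply: (@contour_bound phi P r K).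
apply/cvgrPdist_lt => e e0; near=> n; rewrite sub0r normrN.
apply: le_lt_trans (key n) _.
have c0 : 0 <= 2 * K * pi by rewrite !mulr_ge0 // pi_ge0.
rewrite mulrAC ltr_pdivrMr ?sqrtr_gt0 // -ltr_pdivrMl //.
have q0 : 0 <= 2 * K * pi / e by rewrite divr_ge0 // ltW.
rewrite mulrC -(ger0_norm q0) -sqrtr_sqr ltr_sqrt ?ltr0n //.
apply: lt_le_trans (truncnS_gt _) _; rewrite ler_nat ltnS; near: n; exact: nbhs_infty_ge.
Unshelve. all: by end_near.
Qed.

End Contour.

(** * Functions of bounded type *)

Section BoundedType.
Variable R : realType.
Local Notation C := R[i].
Local Notation uhp := (@upper_half_plane R).
Implicit Types (f g h phi psi : C -> C) (z w : C).

Lemma mean_type_le0 f : (mean_type f <= 0)%E <-> subexp_imaginary f.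
Proof.
split=> [m0 e e0|sf].
  have : (mean_type f < e%:E)%E by apply: le_lt_trans m0 _; rewrite lte_fin.
  move=> /ereal_inf_lt[s [V [Y [Yr YV]]] <- sV].
  exists (Num.max Y 0) => y; rewrite gt_max => /andP[Yy y0].
  have : ((y^-1)%:E * lne (mc (f (0 +i* y)))%:E < e%:E)%E.
    by apply: le_lt_trans sV; apply: ereal_sup_ubound; exists y => //; exact: YV.
  have [m1|m1] := lerP (mc (f (0 +i* y))) 0.
    by move=> _; apply: le_trans m1 (expR_ge0 _).
  rewrite lne_EFin // lte_fin mulrC ltr_pdivrMr // => h.
  by rewrite -ler_ln ?posrE ?expR_gt0 // expRK ltW.
apply/lee_addgt0Pr => e e0; rewrite add0e.
have [Y hY] := sf e e0.
have VY : pinfty_nbhs R [set y | Num.max Y 0 < y].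
  by exists (Num.max Y 0); split => //; rewrite num_real.
apply: le_trans (ereal_inf_lbound _) _; first by exists [set y | Num.max Y 0 < y].
apply: ge_ereal_sup => _ [y yY <-].
have : Num.max Y 0 < y by exact: yY.
rewrite gt_max => /andP[Yy y0].
(* At a zero of f the term is -oo, and the bound holds trivially. *)
rewrite -/(mc (f (0 +i* y))); have [m1|m1] := lerP (mc (f (0 +i* y))) 0.
  by rewrite le0_lneNy ?lee_fin // gt0_muleNy ?leNye // lte_fin invr_gt0.
rewrite lne_EFin // lee_fin mulrC ler_pdivrMr //.
rewrite -ler_expR lnK ?posrE //; exact: hY.
Qed.

(** The numerator of the quotient is eliminated as phi * h, so that sums and products only have to
    combine the denominators. *)
Definition nt phi :=
  [/\ forall z, uhp z -> holo phi z,
      exists h z0 Mg Mh, [/\ forall z, uhp z -> holo h z, uhp z0 /\ h z0 != 0,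
        forall z, uhp z -> mc (h z) <= Mh & forall z, uhp z -> mc (phi z * h z) <= Mg] &
      subexp_imaginary phi].

Lemma ntP phi : bounded_type_nonpos phi <-> nt phi.
Proof.
split=> [[[aphi [g [h [[ag [Mg bg]] [ah [Mh bh]] [z0 u0 h0] gh]]]] /mean_type_le0 mphi]|].
  split=> //; first by move=> z /aphi/cdifferentiableP.
  exists h, z0, Mg, Mh; split => // z uz; first exact/cdifferentiableP/ah.
  by rewrite gh //; exact: bg.
case=> hphi [h [z0 [Mg [Mh [hh [u0 h0] bh bg]]]]] mphi.
split; last exact/mean_type_le0.
split; first by move=> z /hphi/cdifferentiableP.
exists (fun z => phi z * h z), h; split => //.
- split; last by exists Mg.
  by move=> z uz; apply/cdifferentiableP; apply: holoM; [exact: hphi|exact: hh].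
- by split; [move=> z /hh/cdifferentiableP|exists Mh].
- by exists z0.
Qed.

(** The product of two denominators must again not vanish identically: near z1 the factor g is
    nonzero and the zeros of h are isolated. *)
Lemma uhp_mul_neq0 g h z1 z2 : (forall z, uhp z -> holo g z) -> (forall z, uhp z -> holo h z) ->
  uhp z1 -> g z1 != 0 -> uhp z2 -> h z2 != 0 -> exists2 z, uhp z & g z * h z != 0.
Proof.
move=> hg hh u1 g1 u2 h2.
have [d d0 hd] := uhp_isolated hh u2 u1 h2.
have [e e0 he] := ccont_neq0 (holo_cont (hg _ u1)) g1.
pose r := Num.min d e / 2.
have m0 : 0 < Num.min d e by rewrite lt_min d0 e0.
have r0 : 0 < r by rewrite divr_gt0.
pose z : C := z1 + 'i%C * r%:C.
have zz : mc (z - z1) = r by rewrite /z addrAC subrr add0r mcM mc_i mul1r mcR gtr0_norm.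
have rm : r < Num.min d e by rewrite /r ltr_pdivrMr //; lra.
have [rd re] : r < d /\ r < e by move: rm; rewrite lt_min => /andP.
have uz : uhp z.
  by move: u1; rewrite /upper_half_plane /= /z !cE /= => u1; lra.
exists z => //; rewrite mulf_neq0 //.
  rewrite -mc_gt0; apply: le_lt_trans (he z I _); last by rewrite zz.
  by rewrite divr_ge0 // mc_ge0.
apply: hd => //; last by rewrite zz.
by rewrite -subr_eq0 -mc_gt0 zz.
Qed.

Lemma subexpD f g : subexp_imaginary f -> subexp_imaginary g ->
  subexp_imaginary (fun z => f z + g z).
Proof.
move=> sf sg e e0; have e2 : 0 < e / 2 by rewrite divr_gt0.
have [Y1 h1] := sf _ e2; have [Y2 h2] := sg _ e2.
(* Beyond 2 / e one has exp (e y / 2) >= 2, which absorbs the factor 2 of the sum. *)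
exists (Num.max (Num.max Y1 Y2) (2 / e)) => y.
rewrite !gt_max => /andP[/andP[y1 y2] y3].
have ey : 1 < e / 2 * y by move: y3; rewrite ltr_pdivrMr //; lra.
apply: le_trans (mcD _ _) _; have := h1 y y1; have := h2 y y2.
have -> : e * y = e / 2 * y + e / 2 * y by lra.
rewrite expRD; move: (expR_ge1Dx (e / 2 * y)); set X := expR _ => hX a b.
have : X * 2 <= X * X by rewrite ler_wpM2l ?expR_ge0 //; lra.
lra.
Qed.

Lemma subexpM f g : subexp_imaginary f -> subexp_imaginary g ->
  subexp_imaginary (fun z => f z * g z).
Proof.
move=> sf sg e e0; have e2 : 0 < e / 2 by rewrite divr_gt0.
have [Y1 h1] := sf _ e2; have [Y2 h2] := sg _ e2.
exists (Num.max Y1 Y2) => y; rewrite gt_max => /andP[y1 y2].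
have -> : e * y = e / 2 * y + e / 2 * y by lra.
by rewrite expRD mcM; apply: ler_pM; rewrite ?mc_ge0 ?h1 ?h2.
Qed.

Lemma subexp_le f g Y : subexp_imaginary f ->
  (forall y : R, Y < y -> mc (g (0 +i* y)) <= mc (f (0 +i* y))) -> subexp_imaginary g.
Proof.
move=> sf fg e e0; have [Y1 h1] := sf _ e0.
exists (Num.max Y1 Y) => y; rewrite gt_max => /andP[y1 y2].
exact: le_trans (fg _ y2) (h1 _ y1).
Qed.

Lemma subexp_bounded f M : (forall z, uhp z -> mc (f z) <= M) -> subexp_imaginary f.
Proof.
move=> fM e e0; exists (Num.max 0 (M / e)) => y; rewrite gt_max => /andP[y0 yM].
apply: le_trans (fM _ _) _; first by [].
move: yM; rewrite ltr_pdivrMr // mulrC => h; apply: le_trans (ltW h) _.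
by apply: le_trans (expR_ge1Dx _); rewrite lerDr.
Qed.

Lemma nt_bounded phi M : (forall z, uhp z -> holo phi z) ->
  (forall z, uhp z -> mc (phi z) <= M) -> nt phi.
Proof.
move=> hphi bphi; split => //; last exact: subexp_bounded bphi.
exists (fun=> 1), 'i%C, M, 1; split => [z _||z _|z uz].
- exact: holo_cst.
- by rewrite /upper_half_plane /= ltr01 oner_eq0.
- by rewrite mc1.
- by rewrite mulr1; exact: bphi.
Qed.

Lemma nt_cst c : nt (fun=> c).
Proof. by apply: (@nt_bounded _ (mc c)) => [z _|z _ //]; exact: holo_cst. Qed.

Lemma mc_uhpDi z : uhp z -> 1 <= mc (z + 'i%C).
Proof.
rewrite /upper_half_plane /= => uz; apply: le_trans (mc_im _).
by rewrite !cE /=; apply: le_trans (ler_norm _); lra.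
Qed.

Lemma nt_id : nt id.
Proof.
have di z : uhp z -> z + 'i%C != 0.
  by move=> uz; rewrite -mc_gt0; apply: lt_le_trans (mc_uhpDi uz).
split; first by move=> z _; exact: holo_id.
  exists (fun z => (z + 'i%C)^-1), 'i%C, 2, 1; split.
  - by move=> z uz; apply: (@holoV _ (fun z => z + 'i%C) z (di _ uz)); apply: holoD; [exact: holo_id|exact: holo_cst].
  - have ui : uhp 'i%C by rewrite /upper_half_plane /=.
    by split=> //; rewrite invr_eq0; exact: di.
  - by move=> z uz; rewrite mcV invf_le1 ?mc_uhpDi // (lt_le_trans ltr01 (mc_uhpDi uz)).
  - move=> z uz; have h := mc_uhpDi uz; rewrite mc_div ler_pdivrMr; last lra.
    have -> : z = z + 'i%C - 'i%C by rewrite addrK.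
    by apply: le_trans (mcB _ _) _; rewrite addrK mc_i; lra.
(* From exp (e y) >= (1 + e y / 2)^2 >= e^2 y^2 / 4, which exceeds y for y > 4 / e^2. *)
move=> e e0; exists (4 / e ^+ 2) => y hy.
have y0 : 0 < y by apply: le_lt_trans hy; rewrite divr_ge0 // sqr_ge0.
rewrite mcE /= expr0n add0r sqrtr_sqr gtr0_norm //.
move: hy; rewrite ltr_pdivrMr ?exprn_gt0 // => hy.
have ey : 0 < e / 2 * y by rewrite mulr_gt0 // divr_gt0.
have -> : e * y = e / 2 * y + e / 2 * y by lra.
rewrite expRD; have := expR_ge1Dx (e / 2 * y); set X := expR _ => hX.
have : (1 + e / 2 * y) * (1 + e / 2 * y) <= X * X.
  by apply: ler_pM => //; rewrite ltW // ltr_wpDr // ltW.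
have : 4 * y < y * e ^+ 2 * y by rewrite ltr_pM2r.
nra.
Qed.

Lemma ntM phi psi : nt phi -> nt psi -> nt (fun z => phi z * psi z).
Proof.
move=> [hp [h [z1 [Mg [Mh [hh [u1 h1] bh bg]]]]] sp].
move=> [hq [h' [z2 [Mg' [Mh' [hh' [u2 h2] bh' bg']]]]] sq].
split; last exact: subexpM.
  by move=> z uz; apply: holoM; [exact: hp|exact: hq].
have [z3 u3 h3] := uhp_mul_neq0 hh hh' u1 h1 u2 h2.
exists (fun z => h z * h' z), z3, (Mg * Mg'), (Mh * Mh'); split => // z uz.
- by apply: holoM; [exact: hh|exact: hh'].
- by rewrite mcM; apply: ler_pM; rewrite ?mc_ge0 ?bh ?bh'.
- rewrite mulrACA mcM; apply: ler_pM; rewrite ?mc_ge0 ?bg ?bg' //.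
Qed.

Lemma ntD phi psi : nt phi -> nt psi -> nt (fun z => phi z + psi z).
Proof.
move=> [hp [h [z1 [Mg [Mh [hh [u1 h1] bh bg]]]]] sp].
move=> [hq [h' [z2 [Mg' [Mh' [hh' [u2 h2] bh' bg']]]]] sq].
split; last exact: subexpD.
  by move=> z uz; apply: holoD; [exact: hp|exact: hq].
have [z3 u3 h3] := uhp_mul_neq0 hh hh' u1 h1 u2 h2.
exists (fun z => h z * h' z), z3, (Mg * Mh' + Mg' * Mh), (Mh * Mh'); split => // z uz.
- by apply: holoM; [exact: hh|exact: hh'].
- by rewrite mcM; apply: ler_pM; rewrite ?mc_ge0 ?bh ?bh'.
- have -> : (phi z + psi z) * (h z * h' z) = phi z * h z * h' z + psi z * h' z * h z by ring.
  apply: le_trans (mcD _ _) _; rewrite !(mcM (_ * _)).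
  by apply: lerD; apply: ler_pM; rewrite ?mc_ge0 ?bg ?bg' ?bh ?bh'.
Qed.

Lemma nt_sum (I : Type) (s : seq I) (F : I -> C -> C) :
  (forall i, nt (F i)) -> nt (fun z => \sum_(i <- s) F i z).
Proof.
move=> hF; elim: s => [|i s IH].
  by rewrite (_ : (fun z => _) = fun=> 0) ?funeqE => [|z]; [exact: nt_cst|rewrite big_nil].
rewrite (_ : (fun z => _) = fun z => F i z + \sum_(j <- s) F j z); first exact: ntD.
by apply/funext => z; rewrite big_cons.
Qed.

Lemma ntX phi n : nt phi -> nt (fun z => phi z ^+ n).
Proof.
move=> hF; elim: n => [|n IH]; first exact: nt_cst.
rewrite (_ : (fun z => _) = fun z => phi z * phi z ^+ n); first exact: ntM.
by apply/funext => z; rewrite exprS.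
Qed.

Lemma nt_poly (p : {poly C}) : nt (horner p).
Proof.
rewrite (_ : horner p = fun z => \sum_(i < size p) p`_i * z ^+ i); last first.
  by apply/funext => z; rewrite horner_coef.
by apply: nt_sum => i; apply: ntM; [exact: nt_cst|exact/ntX/nt_id].
Qed.

(** The denominator is multiplied by (z - c) / (z + i), which is bounded on the half-plane, and the
    numerator becomes phi h / (z + i). High on the imaginary axis |z - c| >= 1, so the mean type
    does not increase. *)
Lemma nt_div_linear phi psi c : nt phi -> (forall z, uhp z -> holo psi z) ->
  (forall z, uhp z -> phi z = psi z * (z - c)) -> nt psi.
Proof.
move=> [hp [h [z1 [Mg [Mh [hh [u1 h1] bh bg]]]]] sp] hpsi E.
have di z : uhp z -> z + 'i%C != 0.
  by move=> uz; rewrite -mc_gt0; apply: lt_le_trans (mc_uhpDi uz).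
have hl z : uhp z -> holo (fun z => (z - c) / (z + 'i%C)) z.
  move=> uz; apply: (@holo_div _ (fun z => z - c) (fun z => z + 'i%C) z (di _ uz) (holo_shift _ _)).
  by apply: holoD; [exact: holo_id|exact: holo_cst].
have [z2 u2 l2] : exists2 z, uhp z & (z - c) / (z + 'i%C) != 0.
  have ui : uhp 'i%C by rewrite /upper_half_plane /=.
  have u2i : uhp ('i%C + 'i%C) by rewrite /upper_half_plane /= addr_gt0.
  have [ic|ic] := eqVneq ('i%C : C) c; last by exists 'i%C; rewrite // mulf_neq0 ?invr_eq0 ?di ?subr_eq0.
  exists ('i%C + 'i%C) => //; rewrite mulf_neq0 ?invr_eq0 ?di //.
  by rewrite -ic addrK -mc_gt0 mc_i.
have [z3 u3 h3] := uhp_mul_neq0 hh hl u1 h1 u2 l2.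
split=> //.
  exists (fun z => h z * ((z - c) / (z + 'i%C))), z3, Mg, (Mh * (1 + mc (c + 'i%C))).
  split=> // z uz.
  - by apply: holoM; [exact: hh|exact: hl].
  - have zi1 := mc_uhpDi uz; rewrite mcM; apply: ler_pM; rewrite ?mc_ge0 ?bh //.
    rewrite mc_div ler_pdivrMr; last lra.
    have -> : z - c = z + 'i%C - (c + 'i%C) by ring.
    by apply: le_trans (mcB _ _) _; have := mc_ge0 (c + 'i%C); nra.
  - have -> : psi z * (h z * ((z - c) / (z + 'i%C))) = phi z * h z / (z + 'i%C).
      by rewrite E //; ring.
    have zi1 := mc_uhpDi uz; have := bg z uz; have := mc_ge0 (phi z * h z).
    by rewrite mc_div => m0 b; rewrite ler_pdivrMr; [nra|lra].
apply: (@subexp_le phi psi (1 + mc c)) => // y hy.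
have y0 : 0 < y by apply: lt_trans hy; rewrite ltr_pwDl // mc_ge0.
rewrite E // mcM -[leLHS]mulr1 ler_wpM2l ?mc_ge0 //.
have := mc_dist (0 +i* y) c.
have -> : mc (0 +i* y) = y by rewrite mcE /= expr0n add0r sqrtr_sqr gtr0_norm.
by lra.
Qed.

Lemma nt_div_roots (s : seq C) phi psi : nt phi -> (forall z, uhp z -> holo psi z) ->
  (forall z, uhp z -> phi z = psi z * \prod_(c <- s) (z - c)) -> nt psi.
Proof.
elim: s psi => [|c s IH] psi nphi hpsi E.
  (* Without roots phi and psi agree only on the half-plane; multiplying by z and dividing by it
     again transfers [nt]. *)
  have := @nt_div_linear (fun z => phi z * (z - 0)) psi 0; apply => //.
    apply: ntM => //; rewrite (_ : (fun z => _) = id); first exact: nt_id.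
    by apply/funext => z; rewrite subr0.
  by move=> z uz; rewrite E // big_nil mulr1.
have hl z : uhp z -> holo (fun z => psi z * (z - c)) z.
  by move=> uz; apply: holoM (holo_shift _ _); exact: hpsi.
apply: (@nt_div_linear (fun z => psi z * (z - c)) _ c) => //.
by apply: IH => // z uz; rewrite E // big_cons mulrA.
Qed.

End BoundedType.

(** * The involution and polynomial bounds *)

Section Star.
Variable R : realType.
Local Notation C := R[i].
Implicit Types (f g : C -> C) (z : C).

Lemma fstarK f : fstar (fstar f) = f.
Proof. by apply/funext => z; rewrite /fstar !conjcK. Qed.

Lemma fstarD f g : fstar (fun z => f z + g z) = fun z => fstar f z + fstar g z.
Proof. by apply/funext => z; rewrite /fstar rmorphD. Qed.

Lemma fstarM f g : fstar (fun z => f z * g z) = fun z => fstar f z * fstar g z.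
Proof. by apply/funext => z; rewrite /fstar rmorphM. Qed.

Lemma fstar_cst (c : C) : fstar (fun=> c) = fun=> conjc c.
Proof. by []. Qed.

Lemma fstarX f n : fstar (fun z => f z ^+ n) = fun z => fstar f z ^+ n.
Proof. by apply/funext => z; rewrite /fstar rmorphXn. Qed.

Lemma fstar_id : fstar (fun z => z) = id :> (C -> C).
Proof. by apply/funext => z; rewrite /fstar conjcK. Qed.

Lemma fstar_poly (p : {poly C}) : fstar (horner p) = horner (map_poly (@conjc R) p).
Proof. by apply/funext => z; have := horner_map (@conjc R) p (conjc z); rewrite /= conjcK. Qed.

Lemma fstar_real f (x : R) : fstar f x%:C = conjc (f x%:C).
Proof. by rewrite /fstar conjc_real. Qed.

Lemma holo_fstar f z : holo f (conjc z) -> holo (fstar f) z.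
Proof.
move=> [d [q [qc qd hq]]]; exists (conjc d), (fun w => conjc (q (conjc w))); split.
- apply: ccontJ; apply: (@ccont_comp _ setT setT q (@conjc R)) => //.
  by apply: ccontJ; exact: ccont_id.
- by rewrite qd.
- by move=> w _; rewrite /fstar -rmorphB /= hq // rmorphM rmorphB /= !conjcK.
Qed.

Lemma entireP f : entire f <-> forall z, holo f z.
Proof. by split=> h z; apply/cdifferentiableP. Qed.

Lemma holo_poly (p : {poly C}) z : holo (horner p) z.
Proof.
rewrite (_ : horner p = fun z => \sum_(i < size p) p`_i * z ^+ i); last first.
  by apply/funext => w; rewrite horner_coef.
by apply: holo_sum => i; apply: holoM; [exact: holo_cst|exact/holoX/holo_id].
Qed.

(** The factor T on the left avoids the exponent n - 1 and so includes n = 0. *)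
Lemma poly_coef_bound (p : {poly C}) n (L T : R) z : (size p <= n)%N ->
  (forall i, mc p`_i <= L) -> 1 <= T -> mc z <= T -> mc p.[z] * T <= n%:R * L * T ^+ n.
Proof.
move=> sp pL T1 zT; have T0 : 0 <= T by lra.
have L0 : 0 <= L by apply: le_trans (mc_ge0 _) (pL 0%N).
rewrite (horner_coef_wide _ sp).
apply: le_trans (ler_wpM2r T0 (mc_sum _ _ _)) _; rewrite mulr_suml.
have -> : n%:R * L * T ^+ n = \sum_(i < n) L * T ^+ n.
  by rewrite sumr_const card_ord -mulrA mulr_natl.
apply: ler_sum => i _; rewrite mcM mcX -mulrA ler_pM ?mc_ge0 ?pL //.
  by rewrite mulr_ge0 // exprn_ge0 // mc_ge0.
apply: (@le_trans _ _ (T ^+ i.+1)).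
  by rewrite exprSr ler_wpM2r // lerXn2r ?nnegrE ?mc_ge0.
by rewrite ler_weXn2l.
Qed.

Lemma coef_bounded (p : {poly C}) : exists2 L : R, 1 <= L & forall i, mc p`_i <= L.
Proof.
have s0 i : 0 <= mc p`_i by exact: mc_ge0.
exists (1 + \sum_(i < size p) mc p`_i); first by rewrite lerDl sumr_ge0.
move=> i; have [ip|ip] := ltnP i (size p); last first.
  by rewrite nth_default // mc0 addr_ge0 // sumr_ge0.
by rewrite (bigD1 (Ordinal ip)) //= addrCA lerDl addr_ge0 // sumr_ge0.
Qed.

Lemma poly_bound (p : {poly C}) n : (size p <= n.+1)%N ->
  exists2 K, 0 < K & forall z, mc p.[z] <= K * (1 + mc z ^+ n).
Proof.
move=> sp; have [L L1 pL] := coef_bounded p.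
exists (n.+1%:R * L); first by rewrite mulr_gt0 ?ltr0n //; lra.
move=> z; have K0 : 0 <= n.+1%:R * L by rewrite mulr_ge0 //; lra.
have [z1|z1] := lerP (mc z) 1.
  have := @poly_coef_bound p n.+1 L 1 z sp pL (lexx _) z1.
  rewrite expr1n !mulr1 => h; apply: le_trans h _; rewrite ler_peMr // lerDl exprn_ge0 //.
  exact: mc_ge0.
have z0 : 0 < mc z by lra.
have := @poly_coef_bound p n.+1 L (mc z) z sp pL (ltW z1) (lexx _).
rewrite exprSr mulrA ler_pM2r // => h; apply: le_trans h _.
by rewrite ler_wpM2l // lerDr.
Qed.

Lemma poly_neq0_eval (p : {poly C}) : p != 0 -> exists z, p.[z] != 0.
Proof.
move=> p0; apply: contrapT => /forallNP h.
have := @max_poly_roots _ p [seq i%:R | i <- iota 0 (size p)] p0.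
rewrite size_map size_iota ltnn; case/(_ _ _)/negP => //.
  by apply/allP => x _; apply/rootP/eqP/negPn/negP; exact: h.
by rewrite map_inj_uniq ?iota_uniq // => i j /eqP; rewrite eqr_nat => /eqP.
Qed.

End Star.

(** * De Branges spaces *)

Section DeBrangesSpace.
Variable R : realType.
Local Notation C := R[i].
Local Notation uhp := (@upper_half_plane R).
Local Notation uhpc := (@cuhp R).
Local Notation mu := (@lebesgue_measure R).
Variable E : C -> C.
Hypotheses (HB_E : hermite_biehler E) (E_real : forall x : R, E x%:C != 0).
Implicit Types (f g h q : C -> C) (z : C) (p : {poly C}).

Lemma HB_holo z : holo E z.
Proof. by have /entireP := HB_E.1. Qed.

Lemma HB_star_lt z : uhp z -> mc (fstar E z) < mc (E z).
Proof. exact: HB_E.2. Qed.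

Lemma HB_star_real (x : R) : mc (fstar E x%:C) = mc (E x%:C).
Proof. by rewrite fstar_real mcJ. Qed.

Lemma cuhp_cases z : uhpc z -> uhp z \/ z = (complex.Re z)%:C.
Proof.
rewrite /cuhp /= le_eqVlt => /predU1P[z0|]; last by left.
by right; apply: cuhp_real.
Qed.

Lemma HB_neq0 z : uhpc z -> E z != 0.
Proof.
case/cuhp_cases=> [uz|->]; last exact: E_real.
by rewrite -mc_gt0; apply: le_lt_trans (mc_ge0 _) (HB_star_lt uz).
Qed.

Lemma HB_star_le z : uhpc z -> mc (fstar E z) <= mc (E z).
Proof. by case/cuhp_cases=> [/HB_star_lt/ltW //|->]; rewrite HB_star_real. Qed.

Lemma uhp_cuhp : uhp `<=` uhpc.
Proof. by move=> z /ltW. Qed.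

Definition HB_dom : set C := [set z | E z != 0].

Lemma HB_dom_open : copen HB_dom.
Proof.
move=> z Ez; have [r r0 hr] := ccont_neq0 (holo_cont (HB_holo z)) Ez.
exists r => // w wr; rewrite /HB_dom /= -mc_gt0; apply: le_lt_trans (hr w I wr).
by rewrite divr_ge0 // mc_ge0.
Qed.

Lemma HB_dom_cuhp : uhpc `<=` HB_dom.
Proof. by move=> z /HB_neq0. Qed.

Definition quoE f z := f z / E z.

Lemma quoE_holo f z : (forall w, holo f w) -> HB_dom z -> holo (quoE f) z.
Proof. by move=> hf Ez; apply: holo_div Ez (hf z) (HB_holo z). Qed.

Definition density f (x : R) : R := mc (quoE f x%:C) ^+ 2.

Definition sqn f : R := \int[mu]_x density f x.

Lemma fine_dB_sqnorm f : fine (dB_sqnorm E f) = sqn f.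
Proof. by []. Qed.

Lemma density_ge0 f x : 0 <= density f x. Proof. exact: sqr_ge0. Qed.

Lemma quoE_cont f (x : R) : (forall w, holo f w) -> ccont setT (quoE f) x%:C.
Proof. by move=> hf; apply/holo_cont/quoE_holo => //; exact: E_real. Qed.

Lemma density_cont f : (forall w, holo f w) -> continuous (density f).
Proof.
move=> hf; rewrite (_ : density f =
    fun x : R => complex.Re (quoE f x%:C * conjc (quoE f x%:C))); last first.
  by apply/funext => x; rewrite mulJ.
apply: (continuous_re (f := fun z => quoE f z * conjc (quoE f z))) => x.
by apply: ccontM; [exact: quoE_cont|apply: ccontJ; exact: quoE_cont].
Qed.

Lemma sqn_ge0 f : 0 <= sqn f.
Proof. by apply: Rintegral_ge0 => x _; exact: density_ge0. Qed.

Lemma dB_finite f : (forall w, holo f w) ->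
  ((dB_sqnorm E f < +oo)%E <-> rintegrable (density f)).
Proof.
move=> hf; have mf := continuous_measurable_EFin (density_cont hf).
have E1 : (\int[mu]_x `|(EFin \o density f) x|)%E = dB_sqnorm E f.
  by apply: eq_integral => x _; rewrite /= ger0_norm // density_ge0.
split; first by move=> h; apply/integrableP; split => //; rewrite E1.
by case/integrableP => _; rewrite E1.
Qed.

Lemma dB_spaceP f : dB_space E f <->
  [/\ forall z, holo f z, rintegrable (density f), nt (quoE f) & nt (quoE (fstar f))].
Proof.
split=> [[/entireP hf /(dB_finite hf) If /ntP n1 /ntP n2]|[hf If n1 n2]]; first by split.
by split; [exact/entireP|exact/(dB_finite hf)|exact/ntP|exact/ntP].
Qed.

Lemma dB_dominated f v : (forall z, holo f z) -> nt (quoE f) -> nt (quoE (fstar f)) ->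
  rintegrable v -> (forall x, density f x <= v x) -> dB_space E f.
Proof.
move=> hf n1 n2 Iv fv; apply/dB_spaceP; split => //.
apply: rintegrable_le Iv; first exact: density_cont.
by move=> x; rewrite ger0_norm ?density_ge0.
Qed.

Lemma dB_holo f z : dB_space E f -> holo f z. Proof. by case/dB_spaceP. Qed.

Lemma density_fstar f x : density (fstar f) x = density f x.
Proof. by rewrite /density /quoE fstar_real !mc_div mcJ. Qed.

Lemma sqn_fstar f : sqn (fstar f) = sqn f.
Proof. by rewrite /sqn; under eq_Rintegral do rewrite density_fstar. Qed.

Lemma dB_fstar f : dB_space E f -> dB_space E (fstar f).
Proof.
move=> /dB_spaceP[hf If n1 n2]; apply: (@dB_dominated _ (density f)) => //.
- by move=> z; apply: holo_fstar; exact: hf.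
- by rewrite fstarK.
- by move=> x; rewrite density_fstar.
Qed.

Lemma dB_add f g : dB_space E f -> dB_space E g -> dB_space E (fun z => f z + g z).
Proof.
move=> /dB_spaceP[hf If n1 n2] /dB_spaceP[hg Ig m1 m2].
have oD u v : quoE (fun z => u z + v z) = fun z => quoE u z + quoE v z.
  by apply/funext => z; rewrite /quoE mulrDl.
apply: (@dB_dominated _ (fun x => 2 * (density f x + density g x))).
- by move=> z; apply: holoD.
- by rewrite oD; apply: ntD.
- by rewrite fstarD oD; apply: ntD.
- by apply: rintegrableZ; apply: rintegrableD.
move=> x; rewrite /density oD; have := mcD (quoE f x%:C) (quoE g x%:C).
have := mc_ge0 (quoE f x%:C + quoE g x%:C).
move: (mc (_ + _)) (mc (quoE f _)) (mc (quoE g _)) => a b c a0 abc.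
have : a ^+ 2 <= (b + c) ^+ 2 by rewrite lerXn2r ?nnegrE //; lra.
by move=> h; apply: le_trans h _; have := sqr_ge0 (b - c); nra.
Qed.

(** Since |p| <= K (1 + |x|^n), the two extreme cases f and z^n f dominate g on the real line. *)
Lemma dB_mul f g n p : (forall z, g z = p.[z] * f z) -> (size p <= n.+1)%N ->
  dB_space E f -> dB_space E (fun z => z ^+ n * f z) -> dB_space E g.
Proof.
move=> /funext -> sp /dB_spaceP[hf If n1 n2] /dB_spaceP[_ Ig _ _].
have oM u v : quoE (fun z => u z * v z) = fun z => u z * quoE v z.
  by apply/funext => z; rewrite /quoE mulrA.
have [K K0 hK] := poly_bound sp.
apply: (@dB_dominated _ (fun x => 2 * K ^+ 2 * (density f x + density (fun z => z ^+ n * f z) x))).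
- by move=> z; apply: holoM => //; exact: holo_poly.
- by rewrite oM; apply: ntM => //; exact: nt_poly.
- by rewrite fstarM fstar_poly oM; apply: ntM => //; exact: nt_poly.
- by apply: rintegrableZ; apply: rintegrableD.
move=> x; rewrite /density oM oM (mcM p.[_]) (mcM (_ ^+ n)) mcX; have := hK x%:C.
move: (mc p.[_]) (mc (quoE f _)) (mc_ge0 p.[x%:C]) (mc x%:C ^+ n) => a b a0 c hc.
rewrite !exprMn.
have -> : 2 * K ^+ 2 * (b ^+ 2 + c ^+ 2 * b ^+ 2) = (2 * (1 + c ^+ 2) * K ^+ 2) * b ^+ 2 by ring.
rewrite ler_wpM2r ?sqr_ge0 //; apply: (@le_trans _ _ ((K * (1 + c)) ^+ 2)).
  by rewrite lerXn2r ?nnegrE //; apply: le_trans hc.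
by rewrite exprMn mulrC ler_wpM2r ?sqr_ge0 //; have := sqr_ge0 (1 - c); nra.
Qed.

Lemma dB_X_poly k f p : dB_X E k f -> (size p <= k.+1)%N -> dB_space E (fun z => p.[z] * f z).
Proof. by case=> hf hk sp; apply: (dB_mul _ sp) hf hk. Qed.

(** Evaluation in the upper half-plane is bounded by the norm. [hardy_bound] needs a positive
    constant, so it is used with |f|^2 + e. *)
Lemma dB_bound f z : dB_space E f -> uhp z -> mc (quoE f z) ^+ 2 * complex.Im z <= 25 * sqn f.
Proof.
move=> /dB_spaceP[hf If [_ [h [z0 [Mg [Mh [hh [u0 h0] bh bg]]]]] sf] _] uz.
have hO w : HB_dom w -> holo (quoE f) w by exact: quoE_holo.
have hu w : uhp w -> holo (quoE f) w by move=> uw; apply/hO/HB_dom_cuhp/ltW.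
have [A [c [A0 c0 gA]]] := bounded_type_growth hu hh bh bg u0 h0.
have key e : 0 < e -> mc (quoE f z) ^+ 2 * complex.Im z <= 25 * (sqn f + e).
  move=> e0; have B0 : 0 < sqn f + e by rewrite ltr_wpDl // sqn_ge0.
  apply: (hardy_bound HB_dom_open HB_dom_cuhp hO A0 (ltW c0) gA sf B0) => // a b ab.
  have [V [dV VE]] := seg_primitive (density_cont hf) ab.
  exists (fun z => (V (complex.Re z))%:C); split.
    move=> t /dV dt; apply: (cder_is_derive dt) => w.
    by move=> [s _ ->].
  rewrite /= VE; apply: le_trans (Rintegral_seg_le _ _ (density_cont hf) (density_ge0 f) If) _.
  by rewrite lerDl ltW.
apply/ler_addgt0Pr => e e0; have e25 : 0 < e / 25 by rewrite divr_gt0.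
by have := key _ e25; lra.
Qed.

(** Norm 0 would make f vanish on the whole upper half-plane by [dB_bound], but near i the zeros are
    isolated. *)
Lemma sqn_gt0 f : dB_space E f -> nonzero_fun f -> 0 < sqn f.
Proof.
move=> Hf [z0 fz0]; rewrite lt_def sqn_ge0 andbT; apply/eqP => N0.
have hf w : holo f w by exact: dB_holo.
have [d d0 hd] := isolated_zeros 'i%C hf fz0.
pose z : C := 'i%C + 'i%C * (d / 2)%:C.
have d2 : 0 < d / 2 by rewrite divr_gt0.
have zz : mc (z - 'i%C) = d / 2 by rewrite /z addrAC subrr add0r mcM mc_i mul1r mcR gtr0_norm.
have uz : uhp z by change (0 < complex.Im z); rewrite /z !cE /=; lra.
have := dB_bound Hf uz; rewrite N0 mulr0 leNgt mulr_gt0 // exprn_gt0 // mc_gt0.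
rewrite mulf_neq0 ?invr_eq0 ?HB_neq0 //; last exact: ltW.
apply: hd; last by rewrite zz; lra.
by rewrite -subr_eq0 -mc_gt0 zz.
Qed.

(** [dB_bound] degenerates like (Im w)^(-1/2) at the real line. On the circle |w| = r the factor w^2
    - r^2 has modulus 2 r |Im w| and compensates this; by the maximum principle the bound passes
    inside, where r = 2 T gives |z^2 - r^2| >= 3 T^2. *)
Lemma local_bound T : 0 < T -> exists2 K, 0 < K & forall f z, dB_space E f -> mc z <= T ->
  mc (f z) <= K * Num.sqrt (sqn f).
Proof.
move=> T0; pose r := 2 * T; have r0 : 0 < r by rewrite mulr_gt0.
have [M M0 hM] := @disc_bound R E 0 r (ltW r0) (fun w _ => holo_cont (HB_holo w)).
pose K1 := 10 * r * Num.sqrt r * M.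
have sr0 : 0 < Num.sqrt r by rewrite sqrtr_gt0.
have K10 : 0 < K1 by rewrite !mulr_gt0.
exists (K1 / (3 * T ^+ 2)); first by rewrite divr_gt0 // mulr_gt0 // exprn_gt0.
move=> f z Hf zT; set n := Num.sqrt (sqn f).
have n0 : 0 <= n by exact: sqrtr_ge0.
have nE : n ^+ 2 = sqn f by rewrite sqr_sqrtr // sqn_ge0.
have hf w : holo f w by exact: dB_holo.
have upper g w : dB_space E g -> sqn g = sqn f -> uhp w -> mc w = r ->
    mc (g w) * (2 * r * complex.Im w) <= K1 * n.
  move=> Hg gE uw wr; have := dB_bound Hg uw; rewrite gE -nE.
  have Ew : mc (E w) <= M by apply: hM; rewrite subr0 wr.
  have E0 : 0 < mc (E w) by rewrite mc_gt0 HB_neq0 //; exact: uhp_cuhp.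
  have gw : mc (g w) = mc (quoE g w) * mc (E w).
    by rewrite -mcM /quoE mulfVK // -mc_gt0.
  have y0 : 0 < complex.Im w by [].
  have yr : complex.Im w <= r by rewrite -wr; apply: le_trans (ler_norm _) (mc_im _).
  rewrite gw; move: (mc (quoE g w)) (mc_ge0 (quoE g w)) => a a0 ay.
  have y0s : 0 < Num.sqrt (complex.Im w) by rewrite sqrtr_gt0.
  have h1 : a * Num.sqrt (complex.Im w) <= 5 * n.
    rewrite -(@ler_pXn2r _ 2) ?nnegrE ?mulr_ge0 ?(ltW y0s) //.
    by rewrite !exprMn sqr_sqrtr ?(ltW y0) // (_ : 5 ^+ 2 = 25) //; ring.
  have h2 : Num.sqrt (complex.Im w) <= Num.sqrt r by rewrite ler_wsqrtr.
  have -> : a * mc (E w) * (2 * r * complex.Im w) =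
     a * Num.sqrt (complex.Im w) * (Num.sqrt (complex.Im w) * (mc (E w) * (2 * r))).
    by rewrite -{1}(sqr_sqrtr (ltW y0)); ring.
  have -> : K1 * n = 5 * n * (Num.sqrt r * (M * (2 * r))) by rewrite /K1; ring.
  apply: ler_pM => //; rewrite ?mulr_ge0 ?(ltW y0s) ?(ltW E0) ?(ltW r0) ?(ltW T0) //.
  apply: ler_pM => //; rewrite ?mulr_ge0 ?(ltW y0s) ?(ltW E0) ?(ltW r0) ?(ltW T0) //.
  by rewrite ler_pM2r // mulr_gt0.
have circ w : mc w = r -> mc (f w * (w ^+ 2 - r%:C ^+ 2)) <= K1 * n.
  move=> wr; have -> : w ^+ 2 - r%:C ^+ 2 = w * (w - conjc w).
    by rewrite mulrBr mulJ wr expr2 rmorphXn.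
  have -> : w - conjc w = (2 * complex.Im w)%:C * 'i%C.
    by apply: complex_ext; rewrite !cE /=; ring.
  rewrite mcM (mcM w) wr (mcM _%:C) mc_i mulr1 mcR normrM ger0_norm //.
  have -> : r * (2 * `|complex.Im w|) = 2 * r * `|complex.Im w| by ring.
  have [y0|y0|y0] := ltgtP (complex.Im w) 0.
  (* The lower half circle is reached through [fstar f], which has the same norm. *)
  - have := upper (fstar f) (conjc w) (dB_fstar Hf) (sqn_fstar f).
    rewrite /fstar conjcK !mcJ imJ /upper_half_plane /= imJ oppr_gt0 => h.
    by rewrite ltr0_norm //; exact: h.
  - by rewrite gtr0_norm //; exact: upper.
  - by rewrite y0 normr0 !mulr0 mulr_ge0 // ltW.
have hF w : holo (fun w => f w * (w ^+ 2 - r%:C ^+ 2)) w.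
  by apply: holoM => //; apply: holoB; [exact/holoX/holo_id|exact: holo_cst].
have rT : T < r by rewrite /r; lra.
have zr : mc (z - 0) <= r by rewrite subr0; lra.
have rr : r < r + 1 by rewrite ltrDl.
have h : mc (f z * (z ^+ 2 - r%:C ^+ 2)) <= K1 * n.
  apply: (@disc_max R (fun w => f w * (w ^+ 2 - r%:C ^+ 2)) 0 r (r + 1)) => //.
  by move=> w; rewrite subr0; exact: circ.
have n3 : 3 * T ^+ 2 <= mc (z ^+ 2 - r%:C ^+ 2).
  rewrite mc_distC; apply: le_trans (mc_dist _ _); rewrite !mcX mcR gtr0_norm // /r exprMn.
  have : mc z ^+ 2 <= T ^+ 2 by rewrite lerXn2r ?nnegrE ?mc_ge0 ?(ltW T0).
  by lra.
rewrite mulrAC ler_pdivlMr ?mulr_gt0 ?exprn_gt0 //; apply: le_trans h.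
by rewrite mcM ler_wpM2l ?mc_ge0.
Qed.

End DeBrangesSpace.

(** * Quotients of corrected functions by products over nodes *)

Section Quotients.
Variable R : realType.
Local Notation C := R[i].
Local Notation uhp := (@upper_half_plane R).
Local Notation uhpc := (@cuhp R).
Local Notation mu := (@lebesgue_measure R).
Implicit Types (s : seq C) (z : C).

Lemma prod_lower s : exists2 T, 1 <= T &
  forall z, T <= mc z -> mc z ^+ size s <= 2 ^+ size s * mc (\prod_(c <- s) (z - c)).
Proof.
elim: s => [|c s [T T1 IH]].
  by exists 1 => // z _; rewrite big_nil mc1 !expr0 mulr1.
exists (Num.max T (2 * mc c)); first by rewrite le_max T1.
move=> z; rewrite ge_max => /andP[/IH h zc].
rewrite big_cons mcM /= !exprS mulrACA; apply: ler_pM; rewrite ?mc_ge0 ?exprn_ge0 ?mc_ge0 //.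
by have := mc_dist z c; lra.
Qed.

Lemma divide_roots s (G : C -> C) : (forall z, holo G z) -> uniq s ->
  (forall c, c \in s -> G c = 0) ->
  exists2 q, forall z, holo q z & forall z, G z = q z * \prod_(c <- s) (z - c).
Proof.
elim: s G => [|c s IH] G hG.
  by move=> _ _; exists G => // z; rewrite big_nil mulr1.
rewrite cons_uniq => /andP[cs us] G0.
have [q [_ qE hq]] := quotient_holo ltr01 (fun w (_ : mc (w - c) < 1) => hG w).
have Gc : G c = 0 by apply: G0; rewrite mem_head.
have [|q' hq' q'E] := IH q (fun z => hq z (hG z)) us.
  move=> d ds; have := qE d; rewrite Gc G0 ?in_cons ?ds ?orbT // subr0 => /esym/eqP.
  rewrite mulf_eq0 => /orP[/eqP //|]; rewrite subr_eq0 => /eqP dc.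
  by move: cs; rewrite -dc ds.
exists q' => // z; rewrite big_cons -[LHS](subr0) -Gc qE q'E; ring.
Qed.

(** Used with m = |x|, A = |x|^n, t = 1 / (1 + x^2), v = |x|^j |q / E|, phi = |f / E|, a = |Q x|, b
    = |P x|: the polynomials, of degree below n, contribute only O(L / |x|) after division. *)
Lemma tail_estimate (v m W phi a b n L t A : R) : 1 <= m -> 0 <= W -> 0 <= phi -> 0 <= v ->
  0 <= L -> 0 <= n -> 1 <= 2 * m ^+ 2 * t -> 1 <= A ->
  v * A <= W * (phi + a + b) -> a * m <= n * L * A -> b * m <= n * L * A ->
  v ^+ 2 <= (2 * W ^+ 2 + 16 * W ^+ 2 * n ^+ 2) * (phi ^+ 2 + L ^+ 2 * t).
Proof.
move=> m1 W0 p0 v0 L0 n0 mt A1 vA am bm.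
have m0 : 0 < m by lra.
have A0 : 0 < A by lra.
have h1 : v * m <= W * (phi * m + 2 * n * L).
  rewrite -(ler_pM2r A0).
  have : v * A * m <= W * (phi + a + b) * m by rewrite ler_pM2r.
  have h : W * (phi * m + a * m + b * m) <= W * ((phi * m + 2 * n * L) * A).
    rewrite ler_wpM2l //; have : 0 <= phi * m * (A - 1) by rewrite !mulr_ge0 //; lra.
    by lra.
  by lra.
have h2 : (v * m) ^+ 2 <= (W * (phi * m + 2 * n * L)) ^+ 2.
  by rewrite lerXn2r ?nnegrE ?mulr_ge0 ?addr_ge0 ?mulr_ge0 //; lra.
have h3 : (phi * m + 2 * n * L) ^+ 2 <= 2 * (phi ^+ 2 * m ^+ 2 + 4 * n ^+ 2 * L ^+ 2).
  by have := sqr_ge0 (phi * m - 2 * n * L); rewrite -subr_ge0 => h; rewrite -subr_ge0; lra.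
have h4 : L ^+ 2 <= L ^+ 2 * (2 * m ^+ 2 * t) by rewrite ler_peMr // sqr_ge0.
have mm : 0 < m ^+ 2 by rewrite exprn_gt0.
rewrite -(ler_pM2r mm) -exprMn; apply: le_trans h2 _; rewrite exprMn.
apply: le_trans (ler_wpM2l (sqr_ge0 W) h3) _.
have t0 : 0 <= t.
  by rewrite leNgt; apply/negP => t0; have := nmulr_llt0 m t0; nra.
have X0 : 0 <= W ^+ 2 * n ^+ 2 * phi ^+ 2 * m ^+ 2 by apply: mulr_ge0; [apply: mulr_ge0; [apply: mulr_ge0|]|]; exact: sqr_ge0.
have Y0 : 0 <= W ^+ 2 * L ^+ 2 * t * m ^+ 2 by apply: mulr_ge0; [apply: mulr_ge0; [apply: mulr_ge0|]|]; rewrite ?sqr_ge0.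
have := ler_wpM2l (mulr_ge0 (sqr_ge0 W) (sqr_ge0 n)) h4.
by lra.
Qed.

Variable E : C -> C.
Hypotheses (HB_E : hermite_biehler E) (E_real : forall x : R, E x%:C != 0).
Local Notation A := (dB_A E).
Local Notation B := (dB_B E).
Local Notation ov := (quoE E).
Local Notation dens := (density E).
Local Notation nrm := (sqn E).
Implicit Types (f g h q : C -> C) (Q P : {poly C}).

Lemma holo_A z : holo A z.
Proof.
apply: holoM; first exact: holo_cst.
by apply: holoD; [exact: HB_holo|apply/holo_fstar/HB_holo].
Qed.

Lemma holo_B z : holo B z.
Proof.
apply: holoM; first exact: holo_cst.
by apply: holoB; [exact: HB_holo|apply/holo_fstar/HB_holo].
Qed.

Lemma fstar_A : fstar A = A.
Proof.
rewrite /dB_A (fstarM (fun=> 2^-1) (fun z => E z + fstar E z)) fstarD fstarK.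
by apply/funext => z; rewrite {1}/fstar fmorphV rmorph_nat /= addrC.
Qed.

Lemma fstar_B : fstar B = B.
Proof.
rewrite /dB_B (fstarM (fun=> 'i%C / 2) (fun z => E z - fstar E z)) (fstarD _ (fun z => - fstar E z)).
apply/funext => z.
have -> : fstar (fun=> 'i%C / 2) z = - 'i%C / 2.
  rewrite fstar_cst rmorphM fmorphV rmorph_nat; congr (_ / _).
  by apply: complex_ext; rewrite /= ?oppr0.
have -> : fstar (fun w => - fstar E w) z = - E z by rewrite -{2}(fstarK E) /fstar rmorphN.
by ring.
Qed.

Definition comb Q P z := A z * Q.[z] + B z * P.[z].

Lemma holo_comb Q P z : holo (comb Q P) z.
Proof.
apply: holoD; apply: holoM; [exact: holo_A|exact: holo_poly|exact: holo_B|exact: holo_poly].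
Qed.

Lemma fstar_comb Q P : fstar (comb Q P) = comb (map_poly (@conjc R) Q) (map_poly (@conjc R) P).
Proof. by rewrite /comb fstarD (fstarM A (horner Q)) (fstarM B (horner P)) fstar_A fstar_B !fstar_poly. Qed.

Lemma ov_A_le z : uhpc z -> mc (ov A z) <= 1.
Proof.
move=> uz; have E0 : 0 < mc (E z) by rewrite mc_gt0 (HB_neq0 HB_E).
rewrite mc_div ler_pdivrMr // mul1r mcM mcV.
have -> : mc 2 = 2 :> R by rewrite -[2]/(2%:R) -(rmorph_nat (real_complex R)) mcR ger0_norm.
by have := mcD (E z) (fstar E z); have := HB_star_le HB_E uz; lra.
Qed.

Lemma ov_B_le z : uhpc z -> mc (ov B z) <= 1.
Proof.
move=> uz; have E0 : 0 < mc (E z) by rewrite mc_gt0 (HB_neq0 HB_E).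
rewrite mc_div ler_pdivrMr // mul1r mcM mc_div mc_i.
have -> : mc 2 = 2 :> R by rewrite -[2]/(2%:R) -(rmorph_nat (real_complex R)) mcR ger0_norm.
by have := mcB (E z) (fstar E z); have := HB_star_le HB_E uz; lra.
Qed.

Lemma ov_combE f Q P z :
  ov (fun z => f z + comb Q P z) z = ov f z + ov A z * Q.[z] + ov B z * P.[z].
Proof. by rewrite /quoE /comb; ring. Qed.

Lemma nt_ov_comb f Q P : nt (ov f) -> nt (ov (fun z => f z + comb Q P z)).
Proof.
move=> nf; rewrite (_ : quoE E _ = fun z => ov f z + ov A z * Q.[z] + ov B z * P.[z]).
  have hAB (F : C -> C) : (forall z, holo F z) -> (forall z, uhp z -> mc (ov F z) <= 1) ->
      nt (ov F).
    move=> hF; apply: nt_bounded => z /ltW uz; apply: quoE_holo => //.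
    exact: (HB_dom_cuhp HB_E E_real).
  apply: ntD; [apply: ntD => //|]; apply: ntM; try exact: nt_poly; apply: hAB.
  - exact: holo_A.
  - by move=> z /ltW; exact: ov_A_le.
  - exact: holo_B.
  - by move=> z /ltW; exact: ov_B_le.
by apply/funext => z; rewrite ov_combE.
Qed.

Lemma nt_ov_quotient f Q P q s : nt (ov f) -> (forall z, holo q z) ->
  (forall z, f z + comb Q P z = q z * \prod_(c <- s) (z - c)) -> nt (ov q).
Proof.
move=> nf hq E1; apply: (nt_div_roots (s := s) (nt_ov_comb Q P nf)).
  by move=> z /ltW uz; apply: quoE_holo => //; exact: (HB_dom_cuhp HB_E E_real).
by move=> z _; rewrite /quoE E1 mulrAC.
Qed.

(** Far out, dividing by j + n linear factors leaves x^j q / E = O(|f / E| + L / |x|), because |A /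
    E| and |B / E| are at most 1; on a bounded interval the maximum principle bounds q by its values
    on a large circle, which are O(L). Hence a square integrable majorant exists although A and B
    need not be square integrable against |E|^-2. *)
Lemma quotient_bound s j n : size s = (j + n)%N -> exists2 K, 0 < K &
  forall f Q P q (L : R) i x, dB_space E f -> nrm f <= L ^+ 2 -> 0 <= L ->
    (size Q <= n)%N -> (size P <= n)%N -> (forall i, mc Q`_i <= L) -> (forall i, mc P`_i <= L) ->
    (forall z, holo q z) -> (forall z, f z + comb Q P z = q z * \prod_(c <- s) (z - c)) ->
    (i <= j)%N ->
    dens (fun z => z ^+ i * q z) x <= K * (dens f x + L ^+ 2 * (1 + x ^+ 2)^-1).
Proof.
move=> ss; have [T T1 hT] := prod_lower s; rewrite ss in hT.
have T0 : 0 < T by lra.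
pose W : R := 2 ^+ (j + n); have W0 : 0 <= W by rewrite exprn_ge0.
have [Kb Kb0 hKb] := local_bound HB_E E_real T0.
have [MA MA0 hMA] := @disc_bound R A 0 T (ltW T0) (fun w _ => holo_cont (holo_A w)).
have [MB MB0 hMB] := @disc_bound R B 0 T (ltW T0) (fun w _ => holo_cont (holo_B w)).
(* The interval is part of a closed half disc, a compact set on which E has no zeros. *)
have [e0 e00 he0] : exists2 e0 : R, 0 < e0 & forall x : R, `|x| <= T -> mc (E x%:C)^-1 <= e0.
  pose K := [set w : C | uhpc w /\ mc w <= T].
  have K0 : K 0 by split; [rewrite /cuhp /=|rewrite mc0 ltW].
  have [||z0 Kz0 hz0] := @usc_max R K (fun z => mc (E z)^-1) 0 K0 (@cclosed_cuhp_ball R T).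
  - by exists T => w [].
  - apply: usc_mc => z [uz _]; apply: (@ccont_sub _ _ setT) => //.
    by apply: ccontV; [exact/holo_cont/HB_holo|exact: HB_neq0].
  exists (mc (E z0)^-1); first by rewrite mc_gt0 invr_eq0 (HB_neq0 HB_E) //; case: Kz0.
  by move=> x xT; apply: hz0; split; rewrite ?mcR // /cuhp /=.
pose K2 : R := W * (Kb + (MA + MB) * n%:R).
have K20 : 0 <= K2 by rewrite mulr_ge0 // addr_ge0 ?(ltW Kb0) // mulr_ge0 // addr_ge0 ?(ltW MA0) ?(ltW MB0).
pose K1 : R := 2 * W ^+ 2 + 16 * W ^+ 2 * n%:R ^+ 2.
have K10 : 0 <= K1 by rewrite addr_ge0 // !mulr_ge0 ?sqr_ge0.
pose K3 : R := (T ^+ j * (K2 * e0)) ^+ 2 * (1 + T ^+ 2).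
have K30 : 0 <= K3 by rewrite mulr_ge0 ?addr_ge0 ?sqr_ge0.
exists (K1 + K3 + 1); first by lra.
move=> f Q P q L i x Hf fL L0 sQ sP QL PL hq qE ij.
have xs0 : 0 <= x ^+ 2 by exact: sqr_ge0.
have t0 : 0 < (1 + x ^+ 2)^-1 by rewrite invr_gt0; lra.
have dE : dens (fun z => z ^+ i * q z) x = (`|x| ^+ i * mc (ov q x%:C)) ^+ 2.
  by rewrite /density /quoE -mulrA mcM mcX mcR.
have d0 : 0 <= dens f x by exact: density_ge0.
have Lt0 : 0 <= L ^+ 2 * (1 + x ^+ 2)^-1 by rewrite mulr_ge0 ?sqr_ge0 // ltW.
rewrite dE; have [xT|xT] := lerP T `|x|.
  have x1 : 1 <= `|x| by lra.
  apply: (@le_trans _ _ (K1 * (dens f x + L ^+ 2 * (1 + x ^+ 2)^-1))); last first.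
    by rewrite ler_wpM2r ?addr_ge0 //; lra.
  apply: (@le_trans _ _ ((`|x| ^+ j * mc (ov q x%:C)) ^+ 2)).
    rewrite lerXn2r ?nnegrE ?mulr_ge0 ?exprn_ge0 ?mc_ge0 //.
    by rewrite ler_wpM2r ?mc_ge0 // ler_weXn2l.
  have mt : 1 <= 2 * `|x| ^+ 2 * (1 + x ^+ 2)^-1.
    rewrite ler_pdivlMr ?mul1r -?[0 < 1 + _]invr_gt0 //.
    have : 1 <= `|x| ^+ 2 by rewrite exprn_ege1.
    by rewrite real_normK ?num_real // => ?; rewrite mulr2n mulrDl mul1r lerD2r.
  apply: (@tail_estimate _ `|x| _ (mc (ov f x%:C)) (mc Q.[x%:C]) (mc P.[x%:C]) _ _ _ (`|x| ^+ n)) => //.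
  - exact: mc_ge0.
  - by rewrite mulr_ge0 ?exprn_ge0 ?mc_ge0.
  - by rewrite exprn_ege1.
  - have := hT x%:C; rewrite mcR => /(_ xT) h.
    have := ov_combE f Q P x%:C; rewrite {1}/quoE qE mulrAC -/(ov q x%:C) => qD.
    rewrite mulrAC -exprD; apply: (@le_trans _ _ (W * mc (ov q x%:C * \prod_(c <- s) (x%:C - c)))).
      by rewrite mcM mulrCA mulrC ler_wpM2l ?mc_ge0.
    rewrite ler_wpM2l // qD; apply: le_trans (mcD _ _) _; apply: lerD; last first.
      by rewrite mcM ler_piMl ?mc_ge0 // ov_B_le // /cuhp /=.
    apply: le_trans (mcD _ _) _; apply: lerD => //.
    by rewrite mcM ler_piMl ?mc_ge0 // ov_A_le // /cuhp /=.
  - by apply: poly_coef_bound; rewrite ?mcR.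
  - by apply: poly_coef_bound; rewrite ?mcR.
have circ w : mc w = T -> mc (q w) <= K2 * L.
  move=> wT; have := hT w; rewrite wT => /(_ (lexx _)) h.
  have fw : mc (f w) <= Kb * L.
    apply: le_trans (hKb _ _ Hf _) _; first by rewrite wT.
    by rewrite ler_pM2l // -[leRHS]ger0_norm // -sqrtr_sqr ler_wsqrtr.
  have Tn : 1 <= T ^+ n by rewrite exprn_ege1.
  have Tn0 : 0 < T ^+ n by rewrite exprn_gt0.
  have pol (p : {poly C}) : (size p <= n)%N -> (forall i, mc p`_i <= L) ->
      mc p.[w] <= n%:R * L * T ^+ n.
    move=> sp pL; have := @poly_coef_bound R p n L T w sp pL T1; rewrite wT => /(_ (lexx _)).
    by apply: le_trans; rewrite ler_peMr ?mc_ge0.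
  have Aw : mc (A w) <= MA by apply: hMA; rewrite subr0 wT.
  have Bw : mc (B w) <= MB by apply: hMB; rewrite subr0 wT.
  have Gw : mc (f w + comb Q P w) <= (Kb + (MA + MB) * n%:R) * L * T ^+ n.
    have X : (Kb + (MA + MB) * n%:R) * L * T ^+ n =
       Kb * L * T ^+ n + (MA * (n%:R * L * T ^+ n) + MB * (n%:R * L * T ^+ n)) by ring.
    rewrite X; apply: le_trans (mcD _ _) _; apply: lerD.
      by apply: le_trans fw _; rewrite ler_peMr // mulr_ge0 // ltW.
    apply: le_trans (mcD _ _) _; rewrite (mcM (A w)) (mcM (B w)).
    by apply: lerD; apply: ler_pM; rewrite ?mc_ge0 // pol.
  rewrite -(ler_pM2r Tn0); apply: (@le_trans _ _ (mc (q w) * T ^+ (j + n))).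
    by rewrite ler_wpM2l ?mc_ge0 // ler_weXn2l // leq_addl.
  apply: (@le_trans _ _ (W * mc (f w + comb Q P w))).
    by rewrite qE mcM mulrCA ler_wpM2l ?mc_ge0.
  by rewrite /K2 -!mulrA ler_wpM2l // !mulrA.
have qx : mc (q x%:C) <= K2 * L.
  have TT : T < T + 1 by rewrite ltrDl.
  apply: (@disc_max R q 0 T (T + 1) (K2 * L) T0 TT (fun w _ => hq w)) => [w|]; rewrite subr0 ?mcR ?(ltW xT) //.
  exact: circ.
have ox : mc (ov q x%:C) <= K2 * e0 * L.
  rewrite /quoE mcM mulrAC; apply: ler_pM; rewrite ?mc_ge0 //.
  by apply: he0; exact: ltW.
have xi : `|x| ^+ i <= T ^+ j.
  apply: (@le_trans _ _ (T ^+ i)); last by rewrite ler_weXn2l.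
  by rewrite lerXn2r ?nnegrE // ltW.
apply: (@le_trans _ _ ((T ^+ j * (K2 * e0 * L)) ^+ 2)).
  have l0 : 0 <= `|x| ^+ i * mc (ov q x%:C) by rewrite mulr_ge0 ?exprn_ge0 ?mc_ge0.
  have lr : `|x| ^+ i * mc (ov q x%:C) <= T ^+ j * (K2 * e0 * L).
    by apply: ler_pM; rewrite ?exprn_ge0 ?mc_ge0.
  by rewrite lerXn2r ?nnegrE // (le_trans l0).
apply: (@le_trans _ _ (K3 * (L ^+ 2 * (1 + x ^+ 2)^-1))); last first.
  apply: ler_pM => //; last by rewrite lerDr.
  by rewrite -addrA addrCA lerDl addr_ge0.
have -> : (T ^+ j * (K2 * e0 * L)) ^+ 2 = (T ^+ j * (K2 * e0)) ^+ 2 * L ^+ 2 by ring.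
have -> : K3 * (L ^+ 2 * (1 + x ^+ 2)^-1) =
    (T ^+ j * (K2 * e0)) ^+ 2 * (L ^+ 2 * ((1 + T ^+ 2) * (1 + x ^+ 2)^-1)).
  by rewrite /K3 -mulrA; congr (_ * _); rewrite mulrCA.
rewrite ler_wpM2l ?sqr_ge0 // ler_peMr ?sqr_ge0 //.
rewrite ler_pdivlMr ?mul1r -?[0 < 1 + _]invr_gt0 //.
by rewrite lerD2l -(real_normK (num_real x)) lerXn2r ?nnegrE ?(ltW T0) // ltW.
Qed.

(** With j = n = k, the exponents i = 0 and i = k put the quotient into [dB_X E k]. With j = 0 it
    yields the lower bound for the shifted norm that makes [EP] positive. *)
Lemma quotient_mem s j n : size s = (j + n)%N -> exists2 K, 0 < K &
  forall f Q P q (L : R) i, dB_space E f -> nrm f <= L ^+ 2 -> 0 <= L ->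
    (size Q <= n)%N -> (size P <= n)%N -> (forall i, mc Q`_i <= L) -> (forall i, mc P`_i <= L) ->
    (forall z, holo q z) -> (forall z, f z + comb Q P z = q z * \prod_(c <- s) (z - c)) ->
    (i <= j)%N ->
    dB_space E (fun z => z ^+ i * q z) /\ nrm (fun z => z ^+ i * q z) <= K * L ^+ 2.
Proof.
move=> ss; have [K K0 hK] := quotient_bound ss.
pose I : R := \int[mu]_x (1 + x ^+ 2)^-1.
have I0 : 0 <= I.
  by apply: Rintegral_ge0 => x _; rewrite invr_ge0 addr_ge0 ?sqr_ge0.
exists (K * (1 + I)); first by rewrite mulr_gt0 //; lra.
move=> f Q P q L i Hf fL L0 sQ sP QL PL hq qE ij.
have oM (u v : C -> C) : ov (fun z => u z * v z) = fun z => u z * ov v z.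
  by apply/funext => z; rewrite /quoE mulrA.
have [hf If n1 n2] := (dB_spaceP HB_E E_real f).1 Hf.
have nX : nt (fun z : C => z ^+ i) by apply: ntX; exact: nt_id.
have Iv : rintegrable (fun x => dens f x + L ^+ 2 * (1 + x ^+ 2)^-1).
  by apply: rintegrableD => //; apply: rintegrableZ; exact: rintegrable_oneDsqr.
have HX : dB_space E (fun z => z ^+ i * q z).
  apply: (@dB_dominated _ _ HB_E E_real _ (fun x => K * (dens f x + L ^+ 2 * (1 + x ^+ 2)^-1))).
  - by move=> z; apply: holoM => //; exact/holoX/holo_id.
  - by rewrite oM; apply: ntM => //; exact: nt_ov_quotient n1 hq qE.
  - rewrite fstarM fstarX fstar_id oM; apply: ntM => //.
    apply: (nt_ov_quotient (f := fstar f) (Q := map_poly (@conjc R) Q)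
      (P := map_poly (@conjc R) P) (s := map (@conjc R) s)) => //.
      by move=> z; apply: holo_fstar.
    move=> z; rewrite -fstar_comb; have := qE (conjc z) => /(congr1 (@conjc R)).
    rewrite rmorphD rmorphM rmorph_prod big_map /fstar /= => ->; congr (_ * _).
    by apply: eq_bigr => c _; rewrite rmorphB /= conjcK.
  - exact: rintegrableZ.
  - by move=> x; apply: (hK _ Q P) => //.
split => //; have [_ Iq _ _] := (dB_spaceP HB_E E_real _).1 HX.
apply: (@le_trans _ _ (\int[mu]_x (K * (dens f x + L ^+ 2 * (1 + x ^+ 2)^-1)))).
  by apply: rint_le => // [|x]; [exact: rintegrableZ|apply: (hK _ Q P)].
have I1 : rintegrable (fun x : R => L ^+ 2 * (1 + x ^+ 2)^-1).
  by apply: rintegrableZ; exact: rintegrable_oneDsqr.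
rewrite rintZ // rintD // rintZ -/I; last exact: rintegrable_oneDsqr.
rewrite -/(nrm f) -mulrA ler_pM2l //.
have -> : (1 + I) * L ^+ 2 = L ^+ 2 + L ^+ 2 * I by ring.
exact: lerD.
Qed.

End Quotients.

(** * The quadratic form *)

Section QuadraticForm.
Variable R : realType.
Local Notation C := R[i].
Local Notation uhp := (@upper_half_plane R).
Local Notation uhpc := (@cuhp R).
Local Notation mu := (@lebesgue_measure R).
Variable E : C -> C.
Hypotheses (HB_E : hermite_biehler E) (E_real : forall x : R, E x%:C != 0).
Local Notation ov := (quoE E).
Local Notation nrm := (sqn E).
Implicit Types (f g h q : C -> C) (Q P p : {poly C}) (z : C).

(** As p and r have degree below k, both g and z g lie in the space; [dB_bound] for z g is the decay
    that [contour_vanish] requires. *)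
Lemma dB_poly2_int f h (p r : {poly C}) k : dB_X E k f -> dB_X E k h ->
  (size p <= k)%N -> (size r <= k)%N ->
  let g z := p.[z] * f z + r.[z] * h z in
  rintegrable (fun x => complex.Re (ov g x%:C)) /\ \int[mu]_x complex.Re (ov g x%:C) = 0.
Proof.
move=> Xf Xh sp sr g.
have sX (u : {poly C}) : (size u <= k)%N -> (size ('X * u)%R <= k.+1)%N.
  by move=> su; apply: leq_trans (size_polyMleq _ _) _; rewrite size_polyX.
have Hg : dB_space E g.
  by apply: (dB_add HB_E E_real); [apply: (dB_X_poly HB_E E_real Xf)|apply: (dB_X_poly HB_E E_real Xh)]; exact: leqW.
have Hzg : dB_space E (fun z => z * g z).
  rewrite (_ : (fun z => _) = fun z => ('X * p).[z] * f z + ('X * r).[z] * h z).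
    apply: (dB_add HB_E E_real); first by apply: (dB_X_poly HB_E E_real Xf); exact: sX.
    by apply: (dB_X_poly HB_E E_real Xh); exact: sX.
  by apply/funext => z; rewrite !hornerM hornerX /g mulrDr !mulrA.
have [hg Ig _ _] := (dB_spaceP HB_E E_real g).1 Hg.
have [_ Izg _ _] := (dB_spaceP HB_E E_real _).1 Hzg.
have Ip : rintegrable (fun x => complex.Re (ov g x%:C)).
  (* For a = |g / E| one has a <= a^2 (1 + x^2) + 1 / (1 + x^2). *)
  apply: (@rintegrable_le _ _ (fun x => (density E g x + density E (fun z => z * g z) x) + (1 + x ^+ 2)^-1)).
  - by apply: continuous_re => x; exact: quoE_cont.
  - move=> x; apply: le_trans (mc_re _) _.
    have -> : density E (fun z => z * g z) x = x ^+ 2 * mc (ov g x%:C) ^+ 2.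
      by rewrite /density /quoE -mulrA mcM mcR exprMn real_normK // num_real.
    rewrite /density; move: (mc (ov g x%:C)) => a.
    have s0 : 0 < 1 + x ^+ 2 by rewrite ltr_pwDl // sqr_ge0.
    have -> : a ^+ 2 + x ^+ 2 * a ^+ 2 = a ^+ 2 * (1 + x ^+ 2) by ring.
    move: (1 + x ^+ 2) s0 => s s0; rewrite -(ler_pM2r s0) mulrDl mulVf ?gt_eqF //.
    by have := sqr_ge0 (a * s - 1); have := sqr_ge0 (a * s); nra.
  - by apply: rintegrableD; [exact: rintegrableD|exact: rintegrable_oneDsqr].
split=> //; apply: (@contour_vanish R (HB_dom E) (ov g) (Num.sqrt (25 * nrm (fun z => z * g z)))) => //.
- exact: HB_dom_open.
- exact: HB_dom_cuhp.
- by move=> z; exact: quoE_holo.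
- move=> z uz; rewrite sqr_sqrtr ?mulr_ge0 ?sqn_ge0 //.
  have := dB_bound HB_E E_real Hzg uz.
  have -> : ov (fun z => z * g z) z = z * ov g z by rewrite /quoE mulrA.
  by rewrite mcM exprMn => le25; rewrite mulrC mulrA.
Qed.

Definition cross Q P h (x : R) : R :=
  complex.Re (ov (comb E Q P) x%:C * conjc (ov h x%:C)).

Lemma dB_X_fstar k f : dB_X E k f -> dB_X E k (fstar f).
Proof.
case=> Hf Hk; split; first exact: dB_fstar.
have -> : (fun z => z ^+ k * fstar f z) = fstar (fun z => z ^+ k * f z).
  by rewrite fstarM fstarX fstar_id.
exact: dB_fstar.
Qed.

(* On the real line E^* is the conjugate of E, so that conjugating the term
   with the factor E turns the cross term into the real part of g / E with
   z g in the space. *)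
Lemma cross_int k Q P h : dB_X E k h -> (size Q <= k)%N -> (size P <= k)%N ->
  rintegrable (cross Q P h) /\ \int[mu]_x cross Q P h x = 0.
Proof.
move=> Xh sQ sP.
(* The term with E turns into p h / E by conjugation; in the other one [fstar E] cancels against the
   conjugate of E and leaves r * [fstar h] / E. *)
pose p := 2^-1 *: map_poly (@conjc R) (Q + 'i%C *: P).
pose r := 2^-1 *: (Q - 'i%C *: P).
have sD : (size (Q + 'i%C *: P)%R <= k)%N.
  apply: leq_trans (size_polyD _ _) _; rewrite geq_max sQ.
  by apply: leq_trans (size_scale_leq _ _) _.
have sB : (size (Q - 'i%C *: P)%R <= k)%N.
  apply: leq_trans (size_polyD _ _) _; rewrite geq_max sQ size_polyN.
  by apply: leq_trans (size_scale_leq _ _) _.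
have sp : (size p <= k)%N.
  apply: leq_trans (size_scale_leq _ _) _; by rewrite size_map_poly.
have sr : (size r <= k)%N by apply: leq_trans (size_scale_leq _ _) _.
suff -> : cross Q P h =
    fun x : R => complex.Re (ov (fun z => p.[z] * h z + r.[z] * fstar h z) x%:C).
  exact: dB_poly2_int Xh (dB_X_fstar Xh) sp sr.
apply/funext => x; rewrite /cross.
have Ex := E_real x.
have Ec : conjc (E x%:C) != 0 by rewrite -mc_gt0 mcJ mc_gt0.
have pE : p.[x%:C] = 2^-1 * conjc (Q.[x%:C] + 'i%C * P.[x%:C]).
  rewrite /p hornerZ; have := horner_map (@conjc R) (Q + 'i%C *: P) x%:C.
  by rewrite /= oppr0 => ->; rewrite hornerD hornerZ.
have rE : r.[x%:C] = 2^-1 * (Q.[x%:C] - 'i%C * P.[x%:C]).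
  by rewrite /r hornerZ hornerD hornerN hornerZ.
rewrite /quoE pE rE.
rewrite /comb /dB_A /dB_B !fstar_real.
move: (Q.[x%:C]) (P.[x%:C]) (E x%:C) (h x%:C) Ex Ec => a b e w Ex Ec.
rewrite (rmorphM (@conjc R)) fmorphV /=.
transitivity (complex.Re (2^-1 * (a + 'i%C * b) * conjc w / conjc e) +
              complex.Re (2^-1 * (a - 'i%C * b) * conjc w / e)).
  rewrite -reD; congr complex.Re.
  have i2 : 'i%C * 'i%C = -1 :> C by rewrite -expr2 sqr_i.
  field: i2; by rewrite Ex Ec.
rewrite mulrDl reD; congr (_ + _).
rewrite -(reJ (2^-1 * _ * _ / _)); congr complex.Re.
by rewrite !rmorphM !fmorphV rmorph_nat /= !conjcK; ring.
Qed.

Lemma density_shift f (al : R) k x :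
  density E (fun z => (z - al%:C) ^+ k * f z) x = ((x - al) ^+ k) ^+ 2 * density E f x.
Proof.
rewrite /density /quoE -mulrA mcM mcX mcBR exprMn; congr (_ * _).
by rewrite -normrX real_normK ?num_real.
Qed.

Lemma dB_X_shift f (al : R) k : dB_X E k f -> dB_space E (fun z => (z - al%:C) ^+ k * f z).
Proof.
move=> Xf; have := @dB_X_poly _ _ HB_E E_real k f (('X - al%:C%:P) ^+ k) Xf.
rewrite size_exp_XsubC ltnS leqnn => /(_ isT).
rewrite (_ : (fun z => _) = (fun z => (z - al%:C) ^+ k * f z)) //.
by apply/funext => z; rewrite horner_exp hornerXsubC.
Qed.

Lemma dB_X_comb k f q (c : C) : dB_X E k f -> dB_X E k q -> dB_X E k (fun z => f z + c * q z).
Proof.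
move=> Xf Xq; case: (Xf) => Hf Hkf.
have Hc n (u : C -> C) : (fun z => z ^+ n * (u z + c * q z)) =
    (fun z => z ^+ n * u z + ('X^n * c%:P).[z] * q z).
  by apply/funext => z; rewrite hornerM hornerXn hornerC; ring.
have Hq n : (n <= k)%N -> dB_space E (fun z => ('X^n * c%:P).[z] * q z).
  move=> nk; apply: (dB_X_poly HB_E E_real Xq).
  apply: leq_trans (size_polyMleq _ _) _; rewrite size_polyXn size_polyC addSn /=.
  by case: (c != 0); rewrite ?addn1 ?addn0 //; apply: leqW.
split; last by rewrite Hc; apply: (dB_add HB_E E_real) => //; exact: Hq.
rewrite (_ : (fun z => _) = (fun z => z ^+ 0 * (f z + c * q z))).
  rewrite Hc; apply: (dB_add HB_E E_real); last exact: Hq.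
  by rewrite (_ : (fun z => _) = f) //; apply/funext => z; rewrite expr0 mul1r.
by apply/funext => z; rewrite expr0 mul1r.
Qed.

(* On the real line (x - al)^(2k) - s is real; h is the quotient of f + comb Q P
   by it, so that the form of f - t h only involves integrals of f, of f
   against h, and the vanishing cross integrals. *)
Lemma form_expansion k (al s t : R) f h g Q P : dB_X E k f -> dB_X E k h ->
  (size Q <= k)%N -> (size P <= k)%N ->
  (forall z, f z + comb E Q P z = h z * ((z - al%:C) ^+ (2 * k) - s%:C)) ->
  (forall z, g z = f z + (- t)%:C * h z) ->
  nrm (fun z => (z - al%:C) ^+ k * g z) - s * nrm g <=
  nrm (fun z => (z - al%:C) ^+ k * f z) - s * nrm f - 2 * t * nrm f
    + t ^+ 2 * (2^-1 * (nrm f + nrm h)).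
Proof.
move=> Xf Xh sQ sP hE gE.
have Xg : dB_X E k g by rewrite (funext gE); exact: dB_X_comb.
have Xd : dB_X E k (fun z => f z + (- 1)%:C * h z) by exact: dB_X_comb.
have int u : dB_space E u -> rintegrable (density E u).
  by move=> Hu; have [] := (dB_spaceP HB_E E_real u).1 Hu.
have [c1 c2] := cross_int Xf sQ sP; have [d1 d2] := cross_int Xh sQ sP.
(* By polarisation v is the density of Re <f, h>: it is integrable because three norms are finite,
   and dropping |f - h|^2 bounds its integral. *)
pose v x := 2^-1 * ((density E f x + density E h x) - density E (fun z => f z + (- 1)%:C * h z) x).
have If := int _ Xf.1; have Ih := int _ Xh.1; have Ig := int _ Xg.1; have Id := int _ Xd.1.
have Ikf := int _ (dB_X_shift al Xf); have Ikg := int _ (dB_X_shift al Xg).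
have Ifh := rintegrableD If Ih.
have Iv : rintegrable v by apply: rintegrableZ; apply: rintegrableB.
have vE : \int[mu]_x v x <= 2^-1 * (nrm f + nrm h).
  rewrite rintZ; last exact: rintegrableB.
  rewrite ler_pM2l ?invr_gt0 // rintB // rintD // gerBl.
  exact: sqn_ge0.
pose L x := density E (fun z => (z - al%:C) ^+ k * g z) x - s * density E g x.
pose M x := density E (fun z => (z - al%:C) ^+ k * f z) x - s * density E f x.
(* By [hE], N and K are the densities of Re b(f, h) and b(h, h) for the form b = <(z - al)^k ., (z -
   al)^k .> - s <., .>, and M is that of b(f, f). *)
pose N x := density E f x + cross Q P f x.
pose K x := v x + cross Q P h x.
have LE x : L x = (M x - 2 * t * N x) + t ^+ 2 * K x.
  rewrite /L /M /N /K /v !density_shift /cross /density.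
  have -> : ov g x%:C = ov f x%:C + (- t)%:C * ov h x%:C by rewrite /quoE gE; ring.
  have -> : ov (fun z => f z + (- 1)%:C * h z) x%:C = ov f x%:C + (- 1)%:C * ov h x%:C.
    by rewrite /quoE; ring.
  have -> : ov (comb E Q P) x%:C = ov h x%:C * (((x - al) ^+ k) ^+ 2 - s)%:C - ov f x%:C.
    rewrite /quoE; have := hE x%:C; rewrite addrC => /eqP; rewrite eq_sym -subr_eq => /eqP <-.
    by rewrite rmorphB -exprM mulnC (rmorphXn (real_complex R)) rmorphB /=; ring.
  move: (ov f x%:C) (ov h x%:C) (((x - al) ^+ k) ^+ 2) => a b d.
  by rewrite !mc_sqr !cE /=; field.
have IM : rintegrable M by apply: rintegrableB => //; exact: rintegrableZ.
have IN : rintegrable N by exact: rintegrableD.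
have IK : rintegrable K by exact: rintegrableD.
have I2N : rintegrable (fun x => 2 * t * N x) by exact: rintegrableZ.
have -> : nrm (fun z => (z - al%:C) ^+ k * g z) - s * nrm g = \int[mu]_x L x.
  by rewrite rintB //; [rewrite rintZ|exact: rintegrableZ].
have -> : \int[mu]_x L x = \int[mu]_x ((M x - 2 * t * N x) + t ^+ 2 * K x).
  by apply: eq_Rintegral => x _; exact: LE.
rewrite rintD; [|exact: rintegrableB|exact: rintegrableZ].
rewrite rintB // !rintZ // (rintB Ikf) ?rintZ //; last exact: rintegrableZ.
rewrite (rintD If c1) (rintD Iv d1) c2 d2 !addr0 lerD2l.
by rewrite ler_wpM2l ?sqr_ge0.
Qed.

(** The value of the form at h is exactly the integral of [cross Q P h]. *)
Lemma form_isotropic k (al s : R) h Q P : dB_X E k h -> (size Q <= k)%N -> (size P <= k)%N ->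
  (forall z, comb E Q P z = h z * ((z - al%:C) ^+ (2 * k) - s%:C)) ->
  nrm (fun z => (z - al%:C) ^+ k * h z) = s * nrm h.
Proof.
move=> Xh sQ sP hE; have [d1 d2] := cross_int Xh sQ sP.
have [_ Ih _ _] := (dB_spaceP HB_E E_real h).1 Xh.1.
transitivity (\int[mu]_x (s * density E h x + cross Q P h x)); last first.
  by rewrite rintD ?rintZ // ?d2 ?addr0 //; exact: rintegrableZ.
apply: eq_Rintegral => x _; rewrite density_shift /density /cross.
have -> : ov (comb E Q P) x%:C = ov h x%:C * (((x - al) ^+ k) ^+ 2 - s)%:C.
  rewrite /quoE hE rmorphB -exprM mulnC (rmorphXn (real_complex R)) rmorphB /=; ring.
by move: (ov h x%:C) => a; rewrite mc_sqr !cE /=; ring.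
Qed.

End QuadraticForm.

(** * Nonvanishing of A Q + B P *)

Section ExtremalProblem.
Variable R : realType.
Local Notation C := R[i].
Local Notation uhp := (@upper_half_plane R).
Local Notation uhpc := (@cuhp R).
Variable E : C -> C.
Hypotheses (HB_E : hermite_biehler E) (E_real : forall x : R, E x%:C != 0).
Local Notation ov := (quoE E).
Local Notation nrm := (sqn E).
Implicit Types (f g h q : C -> C) (Q P p : {poly C}) (z : C).

(** A zero of E has Im z < 0, so its conjugate lies in the upper half-plane, where E has no
    zeros. *)
Lemma HB_no_common_zero z : E z = 0 -> fstar E z != 0.
Proof.
move=> Ez; rewrite -mc_gt0 /fstar mcJ mc_gt0; apply: HB_neq0 => //.
rewrite /cuhp /= imJ oppr_ge0 leNgt; apply/negP => /ltW uz.
by have := HB_neq0 HB_E E_real uz; rewrite Ez eqxx.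
Qed.

Lemma entire_mul_eq0 f g z0 : (forall z, holo f z) -> (forall z, holo g z) -> f z0 != 0 ->
  (forall z, f z * g z = 0) -> forall z, g z = 0.
Proof.
move=> hf hg f0 fg z1; apply/eqP; apply: contraT => g1.
have [d d0 hd] := isolated_zeros z1 hf f0.
have [e e0 he] := ccont_neq0 (holo_cont (hg z1)) g1.
pose r := Num.min d e / 2.
have m0 : 0 < Num.min d e by rewrite lt_min d0 e0.
have r0 : 0 < r by rewrite divr_gt0.
have rm : r < Num.min d e by rewrite /r ltr_pdivrMr //; lra.
have [rd re] : r < d /\ r < e by move: rm; rewrite lt_min => /andP.
have zz : mc (z1 + r%:C - z1) = r by rewrite addrAC subrr add0r mcR gtr0_norm.
have := fg (z1 + r%:C) => /eqP; rewrite mulf_eq0 => /orP[fz|gz].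
  have /negP[] : f (z1 + r%:C) != 0 by apply: hd; [rewrite -subr_eq0 -mc_gt0 zz|rewrite zz].
  by [].
have /negP[] : g (z1 + r%:C) != 0; last by [].
rewrite -mc_gt0; apply: le_lt_trans (he _ I _); last by rewrite zz.
by rewrite divr_ge0 // mc_ge0.
Qed.

(** A Liouville argument: the factor w^2 - r^2 absorbs the singularity at the real line, and the
    maximum principle gives |g z| <= 4 M / r. *)
Lemma vanishing_of_growth g M : (forall z, holo g z) ->
  (forall z, 1 <= mc z -> mc (g z) ^+ 2 * `|complex.Im z| * mc z ^+ 2 <= M ^+ 2) ->
  0 <= M -> forall z, g z = 0.
Proof.
move=> hg gM M0 z; apply/eqP; rewrite -mc_eq0 eq_le mc_ge0 andbT leNgt; apply/negP => gz.
(* The first term ensures |z^2 - r^2| >= r^2 / 2, and together they give 4 M < |g z| r. *)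
pose r := 2 * (mc z + 1) + 4 * M / mc (g z).
have z0 := mc_ge0 z.
have q0 : 0 <= 4 * M / mc (g z) by rewrite divr_ge0 ?mulr_ge0 ?(ltW gz).
have r2 : 2 * (mc z + 1) <= r by rewrite /r lerDl.
have rM : 4 * M < mc (g z) * r.
  rewrite /r mulrDr mulrC -[X in _ < _ + X]mulrC divfK ?gt_eqF // ltrDr.
  by rewrite !mulr_gt0 //; lra.
move: r2 rM; move: r => {q0} r r2 rM.
have r1 : 1 <= r by lra.
have r0 : 0 < r by lra.
have circ w : mc (w - 0) = r -> mc (g w * (w ^+ 2 - r%:C ^+ 2)) <= 2 * M * r.
  rewrite subr0 => wr; have := gM w; rewrite wr => /(_ r1).
  have -> : w ^+ 2 - r%:C ^+ 2 = w * (w - conjc w).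
    by rewrite mulrBr mulJ wr expr2 rmorphXn.
  have -> : w - conjc w = (2 * complex.Im w)%:C * 'i%C.
    by apply: complex_ext; rewrite !cE /=; ring.
  rewrite mcM (mcM w) wr (mcM _%:C) mc_i mulr1 mcR normrM (@ger0_norm _ 2) //.
  have yr : `|complex.Im w| <= r by rewrite -wr mc_im.
  move: (mc (g w)) (mc_ge0 (g w)) `|complex.Im w| (normr_ge0 (complex.Im w)) yr => a a0 y y0 yr h.
  rewrite -(@ler_pXn2r _ 2) ?nnegrE ?mulr_ge0 ?(ltW r0) //.
  have : (a ^+ 2 * y * r ^+ 2) * y <= M ^+ 2 * r ^+ 2.
    apply: ler_pM; rewrite ?mulr_ge0 ?sqr_ge0 ?(ltW r0) //.
    by rewrite expr2; nra.
  by lra.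
have zr : mc (z - 0) <= r by rewrite subr0; lra.
have rr : r < r + 1 by rewrite ltrDl.
have hF w : mc (w - 0) < r + 1 -> holo (fun w => g w * (w ^+ 2 - r%:C ^+ 2)) w.
  by move=> _; apply: holoM => //; apply: holoB; [exact/holoX/holo_id|exact: holo_cst].
have := disc_max r0 rr hF circ zr; rewrite mcM.
have n3 : r ^+ 2 / 2 <= mc (z ^+ 2 - r%:C ^+ 2).
  rewrite mc_distC; apply: le_trans (mc_dist _ _); rewrite !mcX mcR gtr0_norm //.
  by nra.
by nra.
Qed.

(* If comb Q P vanishes identically, then u = (P + iQ) / E = (P - iQ) / E^* is
   entire, and f u decays too fast for every f in the space. *)
Lemma comb_neq0 k Q P f : dB_X E k.+1 f -> nonzero_fun f -> (size Q <= k.+1)%N -> (size P <= k.+1)%N ->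
  (Q != 0) || (P != 0) -> exists z, comb E Q P z != 0.
Proof.
move=> [Hf Hkf] [z0 fz0] sQ sP QP0; apply: contrapT => /forallNP c0.
have hE := HB_holo HB_E.
have hES z : holo (fstar E) z by apply/holo_fstar/hE.
pose U := P + 'i%C *: Q; pose V := P - 'i%C *: Q.
have i2 : 'i%C * 'i%C = -1 :> C by rewrite -expr2 sqr_i.
have UV z : E z * V.[z] = fstar E z * U.[z].
  have /eqP : comb E Q P z = 0 by apply/eqP/negPn/negP; exact: c0.
  rewrite /comb /dB_A /dB_B /U /V hornerD hornerN !hornerZ hornerD hornerZ.
  move: (E z) (fstar E z) (Q.[z]) (P.[z]) => a b c d h.
  have e0 : 2 * (2^-1 * (a + b) * c + 'i%C / 2 * (a - b) * d) = (a + b) * c + 'i%C * (a - b) * d.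
    by field.
  have : (a + b) * c + 'i%C * (a - b) * d = 0 by rewrite -e0 (eqP h) mulr0.
  move=> /(congr1 (fun x => - 'i%C * x)); rewrite mulr0 => e1.
  apply/eqP; rewrite -subr_eq0 -e1; apply/eqP; ring: i2.
pose u z := if E z != 0 then U.[z] / E z else V.[z] / fstar E z.
have uE z : u z * E z = U.[z].
  rewrite /u; case: ifPn => [Ez|/negbNE/eqP Ez]; first by rewrite divfK.
  have := UV z; rewrite Ez mul0r mulr0 => /esym/eqP; rewrite mulf_eq0.
  by rewrite (negbTE (HB_no_common_zero Ez)) => /eqP.
have uS z : u z * fstar E z = V.[z].
  rewrite /u; case: ifPn => [Ez|/negbNE/eqP Ez]; last by rewrite divfK // HB_no_common_zero.
  by rewrite mulrAC mulrC -[U.[z] * _]mulrC -UV mulKf.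
have near_neq0 (F : C -> C) z : (forall w, holo F w) -> F z != 0 ->
    exists2 r, 0 < r & forall w, mc (w - z) < r -> F w != 0.
  move=> hF Fz; have [r r0 hr] := ccont_neq0 (holo_cont (hF z)) Fz.
  exists r => // w wr; rewrite -mc_gt0; apply: le_lt_trans (hr w I wr).
  by rewrite divr_ge0 // mc_ge0.
have hu z : holo u z.
  have [Ez|Ez] := eqVneq (E z) 0.
    have Sz := HB_no_common_zero Ez.
    have [r r0 hr] := near_neq0 _ z hES Sz.
    apply: (holo_near (f := fun w => V.[w] / fstar E w) r0) => [w /hr Sw|].
      by rewrite -uS mulfK.
    by apply: holo_div => //; exact: holo_poly.
  have [r r0 hr] := near_neq0 _ z hE Ez.
  apply: (holo_near (f := fun w => U.[w] / E w) r0) => [w /hr Ew|].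
    by rewrite -uE mulfK.
  by apply: holo_div => //; exact: holo_poly.
have hf z : holo f z by apply: (dB_holo HB_E).
pose F z := z ^+ k.+1 * f z.
have [K K0 hK] : exists2 K, 0 < K & forall z, 1 <= mc z ->
    mc U.[z] <= K * mc z ^+ k /\ mc V.[z] <= K * mc z ^+ k.
  have sS (T : {poly C}) : (size T <= k.+1)%N -> (size ('i%C *: T) <= k.+1)%N.
    by move=> sT; apply: leq_trans (size_scale_leq _ _) _.
  have sU : (size U <= k.+1)%N.
    by apply: leq_trans (size_polyD _ _) _; rewrite geq_max sP sS.
  have sV : (size V <= k.+1)%N.
    by apply: leq_trans (size_polyD _ _) _; rewrite geq_max sP size_polyN sS.
  have [K1 K10 h1] := poly_bound sU; have [K2 K20 h2] := poly_bound sV.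
  exists (2 * (K1 + K2)); first by rewrite mulr_gt0 // addr_gt0.
  move=> z z1; have zk : 1 <= mc z ^+ k by rewrite exprn_ege1.
  have := h1 z; have := h2 z; move: (mc z ^+ k) zk => x x1 a b.
  by split; nra.
have N0 : 0 <= nrm F by exact: sqn_ge0.
(* Here X is the modulus of F / E, or of its reflection in the lower half-plane. The degree of U and
   V is at most k, one less than the power of z in F, and this surplus gives the decay 1 / |z|. *)
have step z X : 1 <= mc z -> 0 <= X -> X ^+ 2 * `|complex.Im z| <= 25 * nrm F ->
    mc (z ^+ k.+1 * (f z * u z)) <= X * (K * mc z ^+ k) ->
    mc (f z * u z) ^+ 2 * `|complex.Im z| * mc z ^+ 2 <= (Num.sqrt (25 * nrm F) * K) ^+ 2.
  move=> z1 X0 XN; rewrite mcM mcX; move: (mc (f z * u z)) (mc_ge0 (f z * u z)) => a a0.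
  have zk : 0 < mc z ^+ k by rewrite exprn_gt0 //; lra.
  rewrite exprS mulrAC !mulrA ler_pM2r // => h.
  have h2 : (a * mc z) ^+ 2 <= (X * K) ^+ 2.
    by rewrite mulrC lerXn2r ?nnegrE ?mulr_ge0 ?mc_ge0 ?(ltW K0).
  rewrite exprMn sqr_sqrtr ?mulr_ge0 //.
  have := ler_wpM2r (normr_ge0 (complex.Im z)) h2.
  have := ler_wpM2r (sqr_ge0 K) XN; rewrite !exprMn => h3 h4.
  by lra.
have g0 := @vanishing_of_growth (fun z => f z * u z) (Num.sqrt (25 * nrm F) * K)
  (fun z => holoM (hf z) (hu z)).
have fu z : f z * u z = 0.
  apply: g0; last by rewrite mulr_ge0 ?sqrtr_ge0 ?ltW.
  move=> {}z z1; have [KU KV] := hK z z1.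
  have [y0|y0|y0] := ltgtP (complex.Im z) 0; last first.
  - by rewrite y0 normr0 mulr0 mul0r sqr_ge0.
  - have uz : uhp z by [].
    apply: (step z (mc (ov F z))) => //; first exact: mc_ge0.
      by rewrite gtr0_norm //; exact: dB_bound.
    have Ez : E z != 0 by apply: HB_neq0 => //; exact: ltW.
    have -> : z ^+ k.+1 * (f z * u z) = ov F z * U.[z].
      by rewrite -uE /quoE /F; field.
    by rewrite mcM ler_wpM2l ?mc_ge0.
  have uz : uhp (conjc z) by rewrite /upper_half_plane /= imJ oppr_gt0.
  apply: (step z (mc (ov (fstar F) (conjc z)))) => //; first exact: mc_ge0.
    rewrite ltr0_norm // -imJ -(sqn_fstar E F).
    by apply: dB_bound => //; exact: dB_fstar.
  have Ez : mc (E (conjc z)) != 0.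
    by rewrite mc_eq0 HB_neq0 //; exact: ltW.
  have -> : mc (z ^+ k.+1 * (f z * u z)) = mc (ov (fstar F) (conjc z)) * mc V.[z].
    rewrite -uS /quoE mc_div (mcM (u z)) /fstar conjcK !mcJ /F !mcM.
    by field.
  by rewrite ler_wpM2l ?mc_ge0.
have u0 := entire_mul_eq0 hf hu fz0 fu.
have U0 : U = 0.
  apply/eqP; apply: contraT => /poly_neq0_eval[z].
  by rewrite -uE u0 mul0r eqxx.
have V0 : V = 0.
  apply/eqP; apply: contraT => /poly_neq0_eval[z].
  by rewrite -uS u0 mul0r eqxx.
have P0 : P = 0.
  have : U + V = 0 by rewrite U0 V0 addr0.
  rewrite /U /V addrACA subrr addr0 -mulr2n -scaler_nat => /eqP.
  by rewrite scaler_eq0 pnatr_eq0 /= => /eqP.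
have Q0 : Q = 0.
  move: U0; rewrite /U P0 add0r => /eqP; rewrite scaler_eq0 => /orP[|/eqP //].
  by rewrite -mc_eq0 mc_i oner_eq0.
by move: QP0; rewrite P0 Q0 eqxx.
Qed.

End ExtremalProblem.

(** * The extremal value at singular and regular node systems *)

Section Extremum.
Variable R : realType.
Local Notation C := R[i].
Variable E : C -> C.
Hypotheses (HB_E : hermite_biehler E) (E_real : forall x : R, E x%:C != 0).
Variables (k : nat) (al : R).
Hypotheses (k_gt0 : (0 < k)%N) (Xk_neq0 : exists f, dB_X E k f /\ nonzero_fun f).
Local Notation nrm := (sqn E).
Local Notation shift f := (fun z => (z - al%:C) ^+ k * f z).
Implicit Types (f g h q : C -> C) (Q P p : {poly C}) (z : C).

Lemma sqn_zero f : ~ nonzero_fun f -> nrm f = 0.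
Proof.
move=> nf; rewrite /sqn (_ : density E f = fun x => 0 * (1 + x ^+ 2)^-1).
  by rewrite rintZ ?mul0r //; exact: rintegrable_oneDsqr.
apply/funext => x; rewrite /density /quoE mul0r.
have -> : f x%:C = 0 by apply/eqP/negPn/negP => fx; apply: nf; exists x%:C.
by rewrite mul0r mc0 expr0n.
Qed.

Lemma EP_le f : dB_X E k f -> EP E k al * nrm f <= nrm (shift f).
Proof.
move=> Xf; have [nf|nf] := pselect (nonzero_fun f); last first.
  by rewrite (sqn_zero nf) mulr0 sqn_ge0.
rewrite -ler_pdivlMr ?(sqn_gt0 HB_E E_real) //; last by case: Xf.
apply: ge_inf; last by exists f.
by exists 0 => _ [g _ <-]; rewrite divr_ge0 // !fine_dB_sqnorm sqn_ge0.
Qed.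

Lemma EP_ge c : (forall f, dB_X E k f -> c * nrm f <= nrm (shift f)) -> c <= EP E k al.
Proof.
move=> hc; apply: lb_le_inf.
  by have [f Xf] := Xk_neq0; eexists; exists f; first exact: Xf.
move=> _ [f [Xf nf] <-]; rewrite ler_pdivlMr; first exact: hc.
by apply: (sqn_gt0 HB_E E_real) => //; case: Xf.
Qed.

Lemma comb00 z : comb E 0 0 z = 0.
Proof. by rewrite /comb !horner0 !mulr0 addr0. Qed.

(** The function f is itself the quotient of (z - al)^k f by the k-fold node al, so [quotient_mem]
    without any correction bounds its norm by the shifted one. *)
Lemma EP_gt0 : 0 < EP E k al.
Proof.
have sz : size (nseq k al%:C : seq C) = (0 + k)%N by rewrite size_nseq.
have [K K0 hK] := quotient_mem HB_E E_real sz.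
apply: (@lt_le_trans _ _ K^-1); first by rewrite invr_gt0.
apply: EP_ge => f Xf; rewrite mulrC ler_pdivrMr // mulrC.
have Hs := dB_X_shift HB_E E_real al Xf.
have hf z : holo f z by apply: (dB_holo HB_E E_real); case: Xf.
have n0 : 0 <= nrm (shift f) by exact: sqn_ge0.
have [_] : dB_space E (fun z => z ^+ 0 * f z) /\
    nrm (fun z => z ^+ 0 * f z) <= K * Num.sqrt (nrm (shift f)) ^+ 2.
  apply: (hK (shift f) 0 0) => //.
  - by rewrite sqr_sqrtr.
  - by rewrite size_poly0.
  - by rewrite size_poly0.
  - by move=> i; rewrite coef0 mc0 sqrtr_ge0.
  - by move=> i; rewrite coef0 mc0 sqrtr_ge0.
  - by move=> z; rewrite comb00 addr0 mulrC big_nseq -Monoid.iteropE.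
rewrite sqr_sqrtr //; congr (nrm _ <= _).
by apply/funext => z; rewrite expr0 mul1r.
Qed.

Variables (s : seq C) (t : R).
Hypotheses (s_size : size s = (k + k)%N) (s_uniq : uniq s)
  (s_prod : forall z, \prod_(c <- s) (z - c) = (z - al%:C) ^+ (2 * k) - t%:C).

Lemma EP_le_singular Q P : (size Q <= k)%N -> (size P <= k)%N -> (Q != 0) || (P != 0) ->
  (forall c, c \in s -> comb E Q P c = 0) -> EP E k al <= t.
Proof.
move=> sQ sP QP0 sc.
have [q hq qE] := divide_roots (holo_comb HB_E Q P) s_uniq sc.
have [z0 c0] : exists z, comb E Q P z != 0.
  have [f [Xf nf]] := Xk_neq0; case: (k) k_gt0 Xf sQ sP => // k' _ Xf sQ sP.
  exact: (comb_neq0 HB_E E_real Xf nf sQ sP QP0).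
have [K K0 hK] := quotient_mem HB_E E_real s_size.
have [L1 L10 hL1] := coef_bounded Q; have [L2 L20 hL2] := coef_bounded P.
pose L := L1 + L2.
(* There is nothing to correct, so [quotient_mem] is applied to the zero function, obtained as f -
   f. *)
have [f0 f0E f00] : exists2 f, dB_X E k f & forall z, f z = 0.
  have [f [Xf _]] := Xk_neq0.
  exists (fun z => f z + (-1) * f z); first exact: dB_X_comb.
  by move=> z; rewrite mulN1r subrr.
have n0 : nrm f0 <= L ^+ 2.
  by rewrite sqn_zero ?sqr_ge0 // => -[z]; rewrite f00 eqxx.
have Xi i : (i <= k)%N -> dB_space E (fun z => z ^+ i * q z).
  move=> ik; suff [] : dB_space E (fun z => z ^+ i * q z) /\ nrm (fun z => z ^+ i * q z) <= K * L ^+ 2.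
    by [].
  apply: (hK f0 Q P) => //.
  - by case: f0E.
  - by rewrite /L; lra.
  - by move=> j; apply: le_trans (hL1 j) _; rewrite /L; lra.
  - by move=> j; apply: le_trans (hL2 j) _; rewrite /L; lra.
  - by move=> z; rewrite f00 add0r.
have Xq : dB_X E k q.
  split; last exact: Xi.
  have := Xi 0%N (leq0n _); congr (dB_space E _).
  by apply/funext => z; rewrite expr0 mul1r.
have nq : nonzero_fun q.
  by exists z0; apply: contraNneq c0 => q0; rewrite qE q0 mul0r.
have := EP_le Xq; rewrite (form_isotropic (s := t) HB_E E_real Xq sQ sP).
  by rewrite ler_pM2r // (sqn_gt0 HB_E E_real) //; case: Xq.
by move=> z; rewrite qE s_prod.
Qed.

(** The bound by the norm of f is what makes the solution of the form equation bounded. It is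
    supplied by an invertible matrix in [EP_neq_of_det]. *)
Hypothesis interpolation : exists K, forall f, dB_space E f -> exists Q P,
  [/\ (size Q <= k)%N /\ (size P <= k)%N, forall i, mc Q`_i <= K * Num.sqrt (nrm f),
      forall i, mc P`_i <= K * Num.sqrt (nrm f) & forall c, c \in s -> f c + comb E Q P c = 0].

(* The solution h of b(h, v) = <f, v>, where b = <(z - al)^k ., (z - al)^k .> - t <., .>,
   is bounded by f, so that 0 <= b(f - h / c, f - h / c) improves b >= 0 to b >= <., .> / c. *)
Lemma EP_neq_regular : EP E k al != t.
Proof.
apply/eqP => EPt; have [K0 hI] := interpolation.
have [K1 K10 hK] := quotient_mem HB_E E_real s_size.
pose K := `|K0| + 1.
have KK : K0 <= K by rewrite /K; have := ler_norm K0; lra.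
have Kp : 0 < K by rewrite /K; have := normr_ge0 K0; lra.
(* Chosen so that |f|^2 + |q|^2 <= 2 c |f|^2; with the step 1 / c the quadratic term is then at most
   |f|^2 / c, half of the linear gain. *)
pose c := 2^-1 * (1 + K1 * K ^+ 2).
have c0 : 0 < c by rewrite mulr_gt0 ?invr_gt0 // addr_gt0 // mulr_gt0 // exprn_gt0.
suff : t + c^-1 <= EP E k al by rewrite EPt gerDl leNgt invr_gt0 c0.
apply: EP_ge => f Xf; set n := nrm f.
have n0 : 0 <= n by exact: sqn_ge0.
have hf z : holo f z by apply: (dB_holo HB_E E_real); case: Xf.
have [Q [P [[sQ sP] QL PL QP]]] := hI f Xf.1.
have [q hq qE] : exists2 q, forall z, holo q z &
    forall z, f z + comb E Q P z = q z * \prod_(c <- s) (z - c).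
  by apply: divide_roots => // z; apply: holoD => //; exact: holo_comb.
pose L := K * Num.sqrt n.
have L2 : L ^+ 2 = K ^+ 2 * n by rewrite exprMn sqr_sqrtr.
have K1' : 1 <= K by rewrite /K; have := normr_ge0 K0; lra.
have KL : K0 * Num.sqrt n <= L by rewrite ler_wpM2r ?sqrtr_ge0.
have Xi i : (i <= k)%N -> dB_space E (fun z => z ^+ i * q z) /\ nrm (fun z => z ^+ i * q z) <= K1 * L ^+ 2.
  move=> ik; apply: (hK f Q P) => //; first by case: Xf.
  - by rewrite L2 ler_peMl // exprn_ege1.
  - by rewrite mulr_ge0 ?sqrtr_ge0 // ltW.
  - by move=> j; exact: le_trans (QL j) KL.
  - by move=> j; exact: le_trans (PL j) KL.
have q0E : (fun z => z ^+ 0 * q z) = q by apply/funext => z; rewrite expr0 mul1r.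
have [Hq nq] := Xi 0%N (leq0n _); rewrite q0E in Hq nq.
have Xq : dB_X E k q by split => //; exact: (Xi k (leqnn _)).1.
pose g z := f z + (- c^-1)%:C * q z.
have Xg : dB_X E k g by exact: dB_X_comb.
have qE' z : f z + comb E Q P z = q z * ((z - al%:C) ^+ (2 * k) - t%:C) by rewrite qE s_prod.
have := form_expansion HB_E E_real Xf Xq sQ sP qE' (fun z => erefl (g z)).
have := EP_le Xg; rewrite EPt -/n => g0.
have h1 : c^-1 ^+ 2 * (2^-1 * (n + nrm q)) <= c^-1 * n.
  rewrite expr2 -mulrA ler_pM2l ?invr_gt0 // mulrC ler_pdivrMr //.
  by rewrite L2 in nq; rewrite /c; lra.
move=> h2; rewrite mulrDl; have e : 2 * c^-1 * n = 2 * (c^-1 * n) by rewrite mulrA.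
rewrite e in h2; move: (c^-1 * n) h1 h2 => y h1 h2.
by lra.
Qed.

End Extremum.

(** * The determinant *)

Section RootsOfUnity.
Variable R : realType.
Local Notation C := R[i].
Variable k : nat.
Hypothesis k_gt0 : (0 < k)%N.
Local Notation w := (omega R k).

Lemma omegaX n : w ^+ n = cos (n%:R * (pi / k%:R)) +i* sin (n%:R * (pi / k%:R)).
Proof.
rewrite -cexp_iR; elim: n => [|n IH].
  by rewrite expr0 mul0r mulr0 cexp0.
rewrite exprS IH /omega -cexp_iR -cexpD; congr (cexp _).
by rewrite -mulrDr -rmorphD /= -natr1 [in RHS]mulrDl mul1r addrC.
Qed.

Lemma omega_k : w ^+ k = -1.
Proof.
rewrite omegaX mulrC divfK ?pnatr_eq0 -?lt0n // cospi sinpi.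
by apply: complex_ext; rewrite !cE /= ?oppr0.
Qed.

Lemma omega_2k : w ^+ (k + k) = 1.
Proof. by rewrite exprD omega_k mulrNN mulr1. Qed.

(** Consequently only the nodes with index 0 and k are real, and only there can A vanish. *)
Lemma omega_im_neq0 n : (0 < n < k + k)%N -> n != k -> complex.Im (w ^+ n) != 0.
Proof.
have k0 : 0 < k%:R :> R by rewrite ltr0n.
have low m : (0 < m < k)%N -> complex.Im (w ^+ m) != 0.
  move=> /andP[m0 mk]; rewrite omegaX /= gt_eqF // sin_gt0_pi //.
  rewrite mulr_gt0 ?ltr0n ?divr_gt0 ?pi_gt0 //= mulrCA mulrC gtr_pMl ?pi_gt0 //.
  by rewrite ltr_pdivrMr // mul1r ltr_nat.
move=> /andP[n0 n2] nk; case: (ltngtP n k) => [nlt|ngt|/eqP]; last by rewrite (negbTE nk).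
  by apply: low; rewrite n0.
rewrite -(subnKC (ltnW ngt)) exprD omega_k mulN1r imN oppr_eq0.
by apply: low; rewrite subn_gt0 ngt /= ltn_subLR // ltnW.
Qed.

Lemma omega_neq1 n : (0 < n < k + k)%N -> w ^+ n != 1.
Proof.
move=> nn; have [->|nk] := eqVneq n k.
  rewrite omega_k -subr_eq0 -opprD oppr_eq0 -[1 + 1]/(2%:R) pnatr_eq0 //.
by apply: contraNneq (omega_im_neq0 nn nk) => ->.
Qed.

Lemma omega_neq0 : w != 0.
Proof.
apply/eqP => w0; have := omega_2k; rewrite w0 expr0n addn_eq0 (gtn_eqF k_gt0).
by move/eqP; rewrite eq_sym oner_eq0.
Qed.

Lemma omega_primitive : (k + k).-primitive_root w.
Proof.
apply/andP; split; first by rewrite addn_gt0 k_gt0.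
apply/forallP => i; apply/eqP; rewrite unity_rootE.
have [->|ik] := eqVneq i.+1 (k + k)%N; first by rewrite omega_2k eqxx.
by apply/negbTE/omega_neq1; rewrite /= ltn_neqAle ik ltn_ord.
Qed.

Lemma omega_sum a b : (a < k + k)%N -> (b < k + k)%N ->
  \sum_(r < k + k) w ^- (r * a) * w ^+ (r * b) = (a == b)%:R * (k + k)%:R.
Proof.
move=> ak bk; have w0 := omega_neq0.
have wn n : w ^+ n != 0 by rewrite expf_neq0.
have xr r : w ^- (r * a) * w ^+ (r * b) = (w ^+ b / w ^+ a) ^+ r.
  by rewrite mulrC expr_div_n -!exprM !(mulnC r).
under eq_bigr do rewrite xr.
have [<-|ab] := eqVneq a b.
  rewrite divff // mul1r -[in RHS](card_ord (k + k)) -sumr_const.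
  by apply: eq_bigr => r _; rewrite expr1n.
rewrite mul0r; have x1 : w ^+ b / w ^+ a != 1.
  apply: contraNneq ab => e; have : w ^+ b == w ^+ a.
    by rewrite -[w ^+ b](divfK (wn a)) e mul1r.
  by rewrite (eq_prim_root_expr omega_primitive) !modn_small // eq_sym.
have := subrX1 (w ^+ b / w ^+ a) (k + k).
rewrite expr_div_n -!exprM !(mulnC _ (k + k)%N) !exprM omega_2k !expr1n divr1 subrr.
by move=> /esym/eqP; rewrite mulf_eq0 subr_eq0 (negbTE x1) => /eqP.
Qed.

Lemma omega_prod (x : C) : \prod_(r < k + k) (x - w ^+ r) = x ^+ (k + k) - 1.
Proof.
have := congr1 (horner^~ x) (factor_Xn_sub_1 omega_primitive).
rewrite hornerD hornerN hornerXn hornerC => <-.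
rewrite horner_prod big_mkord; apply: eq_bigr => r _.
by rewrite hornerXsubC.
Qed.

End RootsOfUnity.

Section InterpolationMatrix.
Variable R : realType.
Local Notation C := R[i].
Variable E : C -> C.
Hypotheses (HB_E : hermite_biehler E) (E_real : forall x : R, E x%:C != 0).
Variables (k : nat) (al : R).
Hypothesis k_gt0 : (0 < k)%N.
Local Notation A := (dB_A E).
Local Notation B := (dB_B E).
Local Notation w := (omega R k).
Implicit Types (x z : C) (mu : R).

Definition node x r : C := al%:C + w ^+ r * x.

(** The rows evaluate A u^j and B u^j at the nodes, for u = (z - al) / x, which equals w^r at node
    r. The powers for B run backwards so that the transformed block depends on l + j, as in [dB_V],
    rather than on l - j. *)
Definition interp_mx x : 'M[C]_(k + k) :=
  row_mx (\matrix_(r < k + k, j < k) (A (node x r) * w ^+ (r * j)))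
         (\matrix_(r < k + k, j < k) (B (node x r) * w ^+ (r * rev_ord j))).

Definition fourier_mx : 'M[C]_(k + k) :=
  col_mx (\matrix_(m < k, r < k + k) w ^- (r * m))
         (\matrix_(m < k, r < k + k) w ^- (r * (k + m))).

Lemma fourier_mxE m r : fourier_mx m r = w ^- (r * m).
Proof.
by case: (split_ordP m) => j ->; rewrite ?col_mxEu ?col_mxEd mxE.
Qed.

Lemma det_fourier_neq0 : \det fourier_mx != 0.
Proof.
pose G : 'M[C]_(k + k) := \matrix_(r, m) w ^+ (r * m).
have FG : fourier_mx *m G = (k + k)%:R%:M.
  apply/matrixP => a b; rewrite !mxE.
  transitivity ((val a == val b)%:R * (k + k)%:R : C); last by rewrite val_eqE mulr_natl.
  rewrite -(omega_sum R k_gt0 (ltn_ord a) (ltn_ord b)).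
  by apply: eq_bigr => r _; rewrite fourier_mxE mxE.
have := congr1 determinant FG; rewrite det_mulmx det_scalar => d.
have : \det fourier_mx * \det G != 0.
  by rewrite d expf_neq0 // pnatr_eq0 addn_eq0 (gtn_eqF k_gt0).
by rewrite mulf_eq0 negb_or => /andP[].
Qed.

(* The discrete Fourier transform makes the matrix block triangular, with
   dB_V as its lower right block. *)
Lemma det_interp_mx mu : (forall r : 'I_(k + k), A (node mu%:C r) != 0) ->
  \det fourier_mx * \det (interp_mx mu%:C) =
  (\prod_(r < k + k) A (node mu%:C r)) * ((k + k)%:R ^+ k * \det (dB_V E k al mu)).
Proof.
move=> A0.
pose L : 'M[C]_(k + k, k) := \matrix_(r, j) w ^+ (r * j).
pose T : 'M[C]_(k + k, k) := \matrix_(r, j) (dB_C E (node mu%:C r) * w ^+ (r * rev_ord j)).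
pose d : 'rV[C]_(k + k) := \row_r A (node mu%:C r).
have -> : interp_mx mu%:C = diag_mx d *m row_mx L T.
  rewrite mul_mx_row; congr row_mx; apply/matrixP => r j; rewrite mul_diag_mx !mxE //.
  by rewrite mulrA /dB_C; congr (_ * _); rewrite mulrC divfK.
rewrite det_mulmx mulrCA det_diag; congr (_ * _).
  by apply: eq_bigr => r _; rewrite mxE.
rewrite -det_mulmx mul_col_row.
have w0 := omega_neq0 R k_gt0.
have wn n : w ^+ n != 0 by rewrite expf_neq0.
have -> : (\matrix_(m < k, r < k + k) w ^- (r * m)) *m L = (k + k)%:R%:M.
  apply/matrixP => a b; rewrite !mxE.
  transitivity ((val a == val b)%:R * (k + k)%:R : C); last by rewrite val_eqE mulr_natl.
  rewrite -(omega_sum R k_gt0 (ltn_addr k (ltn_ord a)) (ltn_addr k (ltn_ord b))).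
  by apply: eq_bigr => r _; rewrite !mxE.
have -> : (\matrix_(m < k, r < k + k) w ^- (r * (k + m))) *m L = 0.
  apply/matrixP => a b; rewrite !mxE; have ka : (k + a < k + k)%N by rewrite ltn_add2l.
  transitivity ((k + a == b)%:R * (k + k)%:R : C).
    rewrite -(omega_sum R k_gt0 ka (ltn_addr k (ltn_ord b))).
    by apply: eq_bigr => r _; rewrite !mxE.
  by rewrite gtn_eqF ?mul0r // (leq_trans (ltn_ord b)) // leq_addr.
have -> : (\matrix_(m < k, r < k + k) w ^- (r * (k + m))) *m T = dB_V E k al mu.
  apply/matrixP => l j; rewrite !mxE.
  rewrite -(big_mkord predT (fun r => w ^- (r * (l + j).+1) * dB_C E (node mu%:C r))) -addnn big_mkord.
  apply: eq_bigr => r _; rewrite !mxE mulrCA mulrC; congr (_ * _).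
  have -> : (r * (k + l) = r * rev_ord j + r * (l + j).+1)%N.
    rewrite -mulnDr; congr (_ * _)%N; rewrite /= addnC -addSn; have := ltn_ord j.
    by move: (nat_of_ord j) (nat_of_ord l) => a b ak; lia.
  by rewrite exprD invfM mulrAC mulVf // mul1r.
by rewrite det_ublock det_scalar.
Qed.

End InterpolationMatrix.

(** * Zeros of the equation and singularity of the interpolation matrix *)

Section ZeroEquation.
Variable R : realType.
Local Notation C := R[i].
Variable E : C -> C.
Hypotheses (HB_E : hermite_biehler E) (E_real : forall x : R, E x%:C != 0).
Variables (k : nat) (al : R).
Hypothesis k_gt0 : (0 < k)%N.
Local Notation A := (dB_A E).
Local Notation B := (dB_B E).
Local Notation w := (omega R k).
Local Notation nd := (node k al).
Local Notation imx := (interp_mx E k al).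
Implicit Types (x z : C) (mu lam : R).

(** Evaluates the limit in [zero_of_equation] by a continuous extension g. *)
Lemma punctured_limit (f : R -> C) (g : C -> C) lam d : ccont setT g lam%:C -> 0 < d ->
  (forall mu, mu != lam -> `|mu - lam| < d -> f mu = g mu%:C) ->
  (((f : R -> C^o) @ lam^' --> (0 : C^o)) <-> g lam%:C = 0).
Proof.
have nE (u : C) : `|u| = (mc u)%:C by rewrite normc_def mcE.
move=> gc d0 fg; split.
  move=> /cvgrPdist_lt h; apply/eqP; apply: contraT => g0.
  have c0 : 0 < mc (g lam%:C) / 2 by rewrite divr_gt0 // mc_gt0.
  have [|r /= r0 hr] := h (mc (g lam%:C) / 2)%:C; first by rewrite ltcR.
  have [e e0 he] := ccont_neq0 gc g0.
  pose m := Num.min d (Num.min r e).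
  have m0 : 0 < m by rewrite !lt_min d0 r0 e0.
  have m2 : m / 2 < m by lra.
  have [md [mr me]] : m / 2 < d /\ m / 2 < r /\ m / 2 < e.
    by move: m2; rewrite {2}/m !lt_min => /and3P[].
  have ml : `|lam + m / 2 - lam| = m / 2 by rewrite addrAC subrr add0r gtr0_norm // divr_gt0.
  have nl : lam + m / 2 != lam by rewrite -subr_eq0 -normr_eq0 ml gt_eqF // divr_gt0.
  have := hr (lam + m / 2); rewrite /ball_ /= distrC ml => /(_ mr nl).
  rewrite sub0r normrN fg // ?ml // nE ltcR => h1.
  have := he (lam + m / 2)%:C I; rewrite mcBR ml => /(_ me) h2.
  by have := lt_trans h1 h2; rewrite ltxx.
move=> g0; apply/cvgrPdist_lt => e; rewrite ltcE => /andP[/eqP ei e0].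
have [r r0 hr] := gc _ e0.
have m0 : 0 < Num.min d r by rewrite lt_min d0 r0.
exists (Num.min d r) => // mu /= ; rewrite distrC lt_min => /andP[md mr] ml.
have -> : e = (complex.Re e)%:C by apply: complex_ext.
rewrite sub0r normrN fg // nE ltcR.
by have := hr mu%:C I; rewrite mcBR g0 subr0; apply.
Qed.

(** Above the real line E + [fstar E] cannot vanish because the moduli differ; the symmetry of A
    covers the lower half-plane. *)
Lemma A_zero_real z : A z = 0 -> complex.Im z = 0.
Proof.
have up u : 0 < complex.Im u -> A u != 0.
  move=> uu; rewrite /dB_A mulf_neq0 ?invr_eq0 ?pnatr_eq0 //.
  have lt : mc (fstar E u) < mc (E u) by exact: HB_star_lt.
  rewrite -mc_gt0; have := mc_dist (E u) (- fstar E u).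
  by rewrite mcN opprK; lra.
move=> Az; apply/eqP; rewrite eq_le !leNgt; apply/andP; split; apply/negP => y0.
  by have := up _ y0; rewrite Az eqxx.
have : A (conjc z) != 0 by apply: up; rewrite imJ oppr_gt0.
by rewrite -mc_gt0 -mcJ -[conjc _]/(fstar A z) fstar_A Az mc0 ltxx.
Qed.

Lemma node_im mu r : complex.Im (nd mu%:C r) = complex.Im (w ^+ r) * mu.
Proof. by rewrite /node !cE /=; ring. Qed.

Lemma mc_omega r : mc (w ^+ r) = 1.
Proof. by rewrite mcX mcE /= cos2Dsin2 sqrtr1 expr1n. Qed.

Lemma holo_det n (M : C -> 'M[C]_n) z : (forall i j, holo (fun x => M x i j) z) ->
  holo (fun x => \det (M x)) z.
Proof.
move=> hM; apply: holo_sum => s; apply: holoM; first exact: holo_cst.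
exact: holo_prod.
Qed.

Lemma holo_node r z : holo (fun x => nd x r) z.
Proof.
apply: holoD; first exact: holo_cst.
by apply: holoM; [exact: holo_cst|exact: holo_id].
Qed.

Lemma holo_det_interp z : holo (fun x => \det (imx x)) z.
Proof.
apply: holo_det => i j; rewrite /interp_mx.
case: (split_ordP j) => l ->.
  rewrite (_ : (fun x => _) = fun x => A (nd x i) * w ^+ (i * l)).
    apply: holoM; last exact: holo_cst.
    by apply: (holo_comp (f := A)); [exact: holo_node|exact: holo_A].
  by apply/funext => x; rewrite row_mxEl mxE.
rewrite (_ : (fun x => _) = fun x => B (nd x i) * w ^+ (i * rev_ord l)).
  apply: holoM; last exact: holo_cst.
  by apply: (holo_comp (f := B)); [exact: holo_node|exact: holo_B].
by apply/funext => x; rewrite row_mxEr mxE.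
Qed.

Lemma uniform_radius n (P : nat -> R -> Prop) :
  (forall r, (r < n)%N -> exists2 d, 0 < d & forall e, e <= d -> P r e) ->
  exists2 d, 0 < d & forall r, (r < n)%N -> P r d.
Proof.
move=> h; suff [d d0 hd] : exists2 d, 0 < d & forall r e, (r < n)%N -> e <= d -> P r e.
  by exists d => // r rn; apply: hd.
elim: n h => [|n IH] h; first by exists 1.
have [|d d0 hd] := IH; first by move=> r rn; apply: h; exact: ltnW.
have [e e0 he] := h n (ltnSn n).
exists (Num.min d e); first by rewrite lt_min d0 e0.
move=> r x rn; rewrite le_min => /andP[xd xe].
move: rn; rewrite ltnS leq_eqVlt => /predU1P[->|rn]; [exact: he|exact: hd].
Qed.

Lemma A_node_neq0 lam : exists2 d, 0 < d & forall mu, mu != lam -> `|mu - lam| < d ->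
  forall r, (r < k + k)%N -> A (nd mu%:C r) != 0.
Proof.
suff [d d0 hd] : exists2 d, 0 < d & forall r, (r < k + k)%N ->
    forall mu, mu != lam -> `|mu - lam| < d -> A (nd mu%:C r) != 0.
  by exists d => // mu ml md r rk; exact: hd.
apply: uniform_radius.
move=> r rk; have Ai : A 'i%C != 0.
  by apply/eqP => /A_zero_real /eqP; rewrite /= oner_eq0.
have [d d0 hd] := isolated_zeros (nd lam%:C r) (holo_A HB_E) Ai.
exists d => // e ed mu ml md.
have nn : mc (nd mu%:C r - nd lam%:C r) = `|mu - lam|.
  rewrite (_ : _ - _ = w ^+ r * (mu - lam)%:C); first by rewrite mcM mc_omega mul1r mcR.
  by rewrite /node rmorphB /=; ring.
apply: hd; last by rewrite nn; exact: lt_le_trans ed.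
by rewrite -subr_eq0 -mc_gt0 nn normr_gt0 subr_eq0.
Qed.

(* The zeros of A are real, hence only the factors A (al + mu) and A (al - mu)
   of the product over all nodes can vanish. *)
Lemma zero_of_equationP lam : 0 < lam ->
  zero_of_equation E k al lam <-> \det (imx lam%:C) = 0.
Proof.
move=> l0; have k2 : (0 < k + k)%N by rewrite addn_gt0 k_gt0.
have kk : (k < k + k)%N by rewrite -addn1 leq_add2l.
pose r0 := Ordinal k2; pose rk := Ordinal kk.
have r0k : rk != r0 by rewrite -val_eqE /= gtn_eqF.
(* Dividing [det_interp_mx] by everything that cannot vanish at lam leaves [eq_lhs]; the nodes r0
   and rk are al + mu and al - mu. *)
pose K x := (k + k)%:R ^+ k * \prod_(r < k + k | (r != r0) && (r != rk)) A (nd x r).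
have Kl : K lam%:C != 0.
  rewrite mulf_neq0 ?expf_neq0 ?pnatr_eq0 ?addn_eq0 ?(gtn_eqF k_gt0) //.
  apply/prodf_neq0 => r /andP[n0 nk]; apply/eqP => /A_zero_real /eqP.
  rewrite node_im mulf_eq0 (gt_eqF l0) orbF; apply/negP; apply: omega_im_neq0 => //.
  by rewrite ltn_ord andbT lt0n.
have Kc : ccont setT K lam%:C.
  apply: holo_cont; apply: holoM; first exact: holo_cst.
  rewrite (_ : (fun x => _) = fun x => \prod_(r < k + k)
      (if (r != r0) && (r != rk) then A (nd x r) else 1)); last first.
    by apply/funext => x; rewrite big_mkcond.
  apply: holo_prod => r; case: ((r != r0) && (r != rk)); last exact: holo_cst.
  by apply: (holo_comp (f := A)); [exact: holo_node|exact: holo_A].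
pose g x := \det (fourier_mx R k) * \det (imx x) / K x.
have gc : ccont setT g lam%:C.
  apply: ccontM; last exact: ccontV.
  by apply: ccontM; [exact: ccont_cst|apply: holo_cont; exact: holo_det_interp].
have [d d0 hd] := A_node_neq0 lam.
have fg mu : mu != lam -> `|mu - lam| < d -> eq_lhs E k al mu = g mu%:C.
  move=> ml md; have A0 := hd mu ml md.
  rewrite /g det_interp_mx //; last by move=> r; exact: A0.
  rewrite /eq_lhs (bigD1 r0) //= (bigD1 rk) //=.
  have -> : (al + mu)%:C = nd mu%:C r0 by rewrite /node expr0 mul1r rmorphD.
  have -> : (al - mu)%:C = nd mu%:C rk by rewrite /node /= omega_k // mulN1r rmorphB.
  have Km : \prod_(r < k + k | (r != r0) && (r != rk)) A (nd mu%:C r) != 0.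
    by apply/prodf_neq0 => r _; apply: A0.
  have k2C : (k + k)%:R ^+ k != 0 :> C.
    by rewrite expf_neq0 // pnatr_eq0 addn_eq0 (gtn_eqF k_gt0).
  by rewrite /K; field; rewrite Km k2C.
rewrite /zero_of_equation (punctured_limit gc d0 fg) /g; split.
  move/eqP; rewrite mulf_eq0 invr_eq0 (negbTE Kl) orbF mulf_eq0.
  by rewrite (negbTE (det_fourier_neq0 R k_gt0)) => /eqP.
by move=> ->; rewrite mulr0 mul0r.
Qed.

(** In the variable (X - al) / x the nodes become roots of unity and evaluation there a Fourier
    sum. *)
Definition node_poly x (v : 'I_k -> C) : {poly C} :=
  \sum_(j < k) v j *: (x^-1 *: ('X - al%:C%:P)) ^+ j.

Lemma size_node_lin x : x != 0 -> size (x^-1 *: ('X - al%:C%:P)) = 2.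
Proof. by move=> x0; rewrite size_scale ?invr_eq0 // size_XsubC. Qed.

Lemma node_poly_comp x v : node_poly x v =
  (\poly_(j < k) (if insub j is Some i then v i else 0)) \Po (x^-1 *: ('X - al%:C%:P)).
Proof.
rewrite poly_def raddf_sum; apply: eq_bigr => j _ /=.
by rewrite comp_polyZ comp_Xn_poly valK.
Qed.

Lemma size_node_poly x v : x != 0 -> (size (node_poly x v) <= k)%N.
Proof. by move=> x0; rewrite node_poly_comp size_comp_poly2 ?size_node_lin // size_poly. Qed.

Lemma node_poly_eq0 x v : x != 0 -> node_poly x v = 0 -> forall j, v j = 0.
Proof.
move=> x0 /eqP; rewrite node_poly_comp comp_poly2_eq0 ?size_node_lin // => /eqP p0 j.
by have := coef_poly k (fun j => if insub j is Some i then v i else 0) j; rewrite p0 coef0 ltn_ord valK.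
Qed.

Lemma node_polyE x v r : x != 0 -> (node_poly x v).[nd x r] = \sum_(j < k) v j * w ^+ (r * j).
Proof.
move=> x0; rewrite /node_poly horner_sum; apply: eq_bigr => j _.
rewrite hornerZ horner_exp hornerZ hornerXsubC /node addrAC subrr add0r.
by rewrite mulrCA mulVf // mulr1 exprM.
Qed.

Lemma coef_node_poly x : exists2 K, 0 < K & forall v (M : R), (forall j, mc (v j) <= M) ->
  forall i, mc (node_poly x v)`_i <= K * M.
Proof.
have /choice[c hc] : forall j : 'I_k, exists c : R, 1 <= c /\
    forall i, mc ((x^-1 *: ('X - al%:C%:P)) ^+ j)`_i <= c.
  by move=> j; have [L L1 hL] := coef_bounded ((x^-1 *: ('X - al%:C%:P)) ^+ j); exists L.
have s0 : 0 <= \sum_(j < k) c j by apply: sumr_ge0 => j _; have [] := hc j; lra.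
exists (1 + \sum_(j < k) c j); first by lra.
move=> v M vM i; have M0 : 0 <= M.
  by apply: le_trans (mc_ge0 _) (vM (Ordinal k_gt0)).
rewrite /node_poly coef_sum; apply: le_trans (mc_sum _ _ _) _.
apply: (@le_trans _ _ ((\sum_(j < k) c j) * M)); last by rewrite ler_wpM2r // lerDr.
rewrite mulr_suml; apply: ler_sum => j _.
by rewrite coefZ mcM mulrC ler_pM ?mc_ge0 //; case: (hc j).
Qed.

Lemma interp_mxE x (v : 'cV[C]_(k + k)) r : x != 0 ->
  comb E (node_poly x (fun j => v (lshift k j) 0)) (node_poly x (fun j => v (rshift k (rev_ord j)) 0))
    (nd x (nat_of_ord r)) = (imx x *m v) r 0.
Proof.
move=> x0; rewrite /comb !node_polyE // mxE big_split_ord /= !mulr_sumr; congr (_ + _).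
  by apply: eq_bigr => j _; rewrite row_mxEl mxE; ring.
rewrite (reindex_inj rev_ord_inj) /=; apply: eq_bigr => j _.
by rewrite row_mxEr mxE rev_ordK /=; ring.
Qed.

End ZeroEquation.

(** * The concrete nodes and the conclusion *)

Section ExtremalNodes.
Variable R : realType.
Local Notation C := R[i].
Variable E : C -> C.
Hypotheses (HB_E : hermite_biehler E) (E_real : forall x : R, E x%:C != 0).
Variables (k : nat) (al : R).
Hypotheses (k_gt0 : (0 < k)%N) (Xk_neq0 : exists f, dB_X E k f /\ nonzero_fun f).
Variable lam : R.
Hypothesis lam_gt0 : 0 < lam.
Local Notation w := (omega R k).
Local Notation lamC := (lam%:C : C).

Let lamC0 : lamC != 0. Proof. by rewrite -mc_gt0 mcR gtr0_norm. Qed.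

Definition nodes : seq C := mkseq (node k al lamC) (k + k).

Lemma nodes_size : size nodes = (k + k)%N. Proof. exact: size_mkseq. Qed.

Lemma nodes_mem c : c \in nodes -> exists r : 'I_(k + k), c = node k al lamC r.
Proof.
by case/mapP => r; rewrite mem_iota => /andP[_ rk] ->; exists (Ordinal rk).
Qed.

Lemma nodes_uniq : uniq nodes.
Proof.
rewrite /nodes map_inj_in_uniq ?iota_uniq // => r s; rewrite !mem_iota /= !add0n => rk sk.
move=> /addrI /(mulIf lamC0) /eqP.
by rewrite (eq_prim_root_expr (omega_primitive R k_gt0)) !modn_small // => /eqP.
Qed.

Lemma nodes_prod z :
  \prod_(c <- nodes) (z - c) = (z - al%:C) ^+ (2 * k) - (lam ^+ (2 * k))%:C.
Proof.
rewrite /nodes /mkseq big_map -[X in iota 0 X]subn0 -/(index_iota 0 (k + k)) big_mkord.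
have -> : (2 * k = k + k)%N by rewrite mul2n addnn.
transitivity (\prod_(r < k + k) (lamC * ((z - al%:C) / lamC - w ^+ r))).
  by apply: eq_bigr => r _; rewrite /node; field.
rewrite big_split /= prodr_const card_ord omega_prod //.
by rewrite mulrBr mulr1 expr_div_n mulrCA mulfV ?expf_neq0 // mulr1 rmorphXn.
Qed.

(** A kernel vector of the matrix is the coefficient vector of a nonzero pair (Q, P) whose
    combination vanishes at all nodes. *)
Lemma EP_le_of_det0 : \det (interp_mx E k al lamC) = 0 -> EP E k al <= lam ^+ (2 * k).
Proof.
move=> /eqP; rewrite -det_tr => /det0P[v v0 vM].
have Mv : interp_mx E k al lamC *m v^T = 0 by rewrite -[LHS]trmxK trmx_mul trmxK vM trmx0.
pose Q := node_poly al lamC (fun j => v^T (lshift k j) 0).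
pose P := node_poly al lamC (fun j => v^T (rshift k (rev_ord j)) 0).
apply: (@EP_le_singular R E HB_E E_real k al k_gt0 Xk_neq0 nodes _ nodes_size nodes_uniq nodes_prod Q P).
- exact: size_node_poly.
- exact: size_node_poly.
- rewrite -negb_and; apply: contra v0 => /andP[/eqP Q0 /eqP P0].
  have q0 := node_poly_eq0 lamC0 Q0; have p0 := node_poly_eq0 lamC0 P0.
  apply/eqP/matrixP => a j; rewrite !ord1 [RHS]mxE.
  case: (split_ordP j) => i ->; first by have := q0 i; rewrite mxE.
  by have := p0 (rev_ord i); rewrite rev_ordK mxE.
- by move=> c /nodes_mem[r ->]; rewrite interp_mxE // Mv mxE.
Qed.

(** The inverse matrix yields a correction of the order of the values of f at the nodes, and
    [local_bound] estimates these by the norm of f. *)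
Lemma EP_neq_of_det : \det (interp_mx E k al lamC) != 0 -> EP E k al != lam ^+ (2 * k).
Proof.
move=> d0; apply: (@EP_neq_regular R E HB_E E_real k al Xk_neq0 nodes _ nodes_size nodes_uniq nodes_prod).
pose M := invmx (interp_mx E k al lamC).
have Mu : interp_mx E k al lamC \in unitmx by rewrite unitmxE unitfE.
pose T := \sum_(r <- nodes) mc r + 1.
have T0 : 0 < T by rewrite ltr_wpDl // sumr_ge0 // => c _; exact: mc_ge0.
have [K K0 hK] := local_bound HB_E E_real T0.
have nT (r : 'I_(k + k)) : mc (node k al lamC r) <= T.
  have rn : node k al lamC r \in nodes.
    by apply/mapP; exists (val r) => //; rewrite mem_iota /= add0n.
  rewrite /T (bigD1_seq _ rn nodes_uniq) /= -addrA lerDl addr_ge0 // sumr_ge0 // => c _.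
  exact: mc_ge0.
have [K1 K10 hK1] := coef_node_poly al k_gt0 lamC.
pose S := \sum_i \sum_j mc (M i j).
have S0 i j : mc (M i j) >= 0 by exact: mc_ge0.
exists (K1 * (S * K)) => f Hf.
pose b : 'cV[C]_(k + k) := \col_r (- f (node k al lamC r)).
pose v := M *m b.
have vS i : mc (v i 0) <= S * (K * Num.sqrt (sqn E f)).
  have b0 j : mc (b j 0) <= K * Num.sqrt (sqn E f) by rewrite mxE mcN; exact: hK.
  have KN : 0 <= K * Num.sqrt (sqn E f) by apply: le_trans (b0 i); exact: mc_ge0.
  rewrite mxE; apply: le_trans (mc_sum _ _ _) _.
  apply: (@le_trans _ _ ((\sum_j mc (M i j)) * (K * Num.sqrt (sqn E f)))).
    by rewrite mulr_suml; apply: ler_sum => j _; rewrite mcM ler_wpM2l.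
  rewrite ler_wpM2r // /S [leRHS](bigD1 i) //= lerDl.
  by apply: sumr_ge0 => j _; apply: sumr_ge0.
exists (node_poly al lamC (fun j => v (lshift k j) 0)),
  (node_poly al lamC (fun j => v (rshift k (rev_ord j)) 0)).
split.
- by split; exact: size_node_poly.
- by move=> i; rewrite -!mulrA; exact: hK1.
- by move=> i; rewrite -!mulrA; exact: hK1.
- move=> c /nodes_mem[r ->]; rewrite interp_mxE // /v mulmxA mulmxV // mul1mx mxE.
  by rewrite subrr.
Qed.

End ExtremalNodes.

Theorem theorem4 (R : realType) (k : nat) (alpha : R) (E : R[i] -> R[i])
    (k_gt0 : (0 < k)%N)
    (HB_E : hermite_biehler E)
    (C1 : forall x : R, E x%:C != 0)
    (C2 : real_entire (fun z => E ('i%C * z)))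
    (C3 : ~ dB_space E (dB_A E))
    (Xk_neq0 : exists f, dB_X E k f /\ nonzero_fun f) :
  first_positive_zero (zero_of_equation E k alpha)
    (EP E k alpha `^ (2 * k)%:R^-1).
Proof.
have EP0 := EP_gt0 HB_E C1 alpha Xk_neq0.
set lam := EP E k alpha `^ _.
have lam0 : 0 < lam by exact: powR_gt0.
have lamX : lam ^+ (2 * k) = EP E k alpha.
  rewrite -powR_mulrn ?ltW // -powRrM mulVf ?powRr1 ?ltW //.
  by rewrite pnatr_eq0 muln_eq0 /= -lt0n.
split=> //.
  apply/(zero_of_equationP HB_E alpha k_gt0 lam0)/eqP; apply: contraT => d0.
  by have := EP_neq_of_det HB_E C1 k_gt0 Xk_neq0 lam0 d0; rewrite lamX eqxx.
move=> mu mu0 mul /(zero_of_equationP HB_E alpha k_gt0 mu0) d0.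
have := EP_le_of_det0 HB_E C1 k_gt0 Xk_neq0 mu0 d0.
by rewrite -lamX leNgt ltr_pXn2r ?muln_gt0 ?nnegrE ?(ltW lam0) ?(ltW mu0) ?mul.
Qed.
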